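(* Let $\alpha$ be a countable ordinal and let $\psi_\alpha$ be the $\mathcal{L}_{\omega_1,\omega}$-sentence defined in the context. The maximal models spectrum of $\psi_\alpha$ is characterized by the following: (1) $\psi_\alpha$ has a maximal model of size $\aleph_{\alpha+1}$. (2) If $\lambda^{\aleph_0}\ge\aleph_{\alpha+1}$ for some $\aleph_0\le\lambda\le\aleph_\alpha$, then $\psi_\alpha$ has a maximal model of size $\lambda^{\aleph_0}$. (3) If there exists a $(\mu,\aleph_{\alpha+1},\kappa)$-Kurepa tree, $\aleph_1\le\mu\le\aleph_{\alpha+1}$, with exactly $\kappa$ cofinal branches, then $\psi_\alpha$ has a maximal model of size $\kappa$. (4) $\psi_\alpha$ has maximal models only in those cardinalities required by (1)-(3).
   Context: The sentence $\psi_\alpha$. Fix a countable ordinal $\alpha$. The vocabulary $\tau$ has constants $0$ and $c_n$ ($n\in\omega$), unary predicates $L_\beta$ ($0\le\beta\le\alpha+1$), binary relation symbols $S,V,T$ and $<_\beta$ ($1\le\beta\le\alpha+1$), and ternary relation symbols $F_\beta$ ($0\le\beta\le\alpha$) and $G$. Write $V(a)=\{x: V(a,x)\}$. Saying that $F(x,\cdot,\cdot)$ is a surjection from $A$ to $B$ means that $\{(y,z):F(x,y,z)\}$ is the graph of a surjection $A\to B$. $\psi_\alpha$ is the $\mathcal{L}_{\omega_1,\omega}(\tau)$-sentence that is the conjunction of the following requirements. (a) $L_{\alpha+1}$ is linearly ordered by $<_{\alpha+1}$ with minimum $0$; it may or may not have a maximum element. Every non-maximum $a\in L_{\alpha+1}$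 has an immediate successor $b$, and $S(a,b)$ expresses that $b$ is the successor of $a$. The maximum, if it exists, is called $m$ and is not a successor. (b) For $a\in L_{\alpha+1}$, $V(a)$ is the set of nodes at level $a$; it is disjoint from every $L_\beta$, and $V(a)\cap V(b)=\emptyset$ for $a\ne b$. The universe is the union of all the $L_\beta$ and all the $V(a)$. (c) $T$ is a tree ordering on $V=\bigcup_{a\in L_{\alpha+1}}V(a)$. If $T(x,y)$, then the level of $x$ is strictly below the level of $y$. If $y\in V(a)$ and $b<_{\alpha+1}a$, there is $x\in V(b)$ with $T(x,y)$. If $a$ is a limit (neither a successor nor $0$), two distinct elements of $V(a)$ do not have the same $T$-predecessors. The tree is pruned (every node is contained in a maximal branch). If $m$ exists, the elements of $V(m)$ play the role of maximal branches through the tree (a model need not contain all maximal branches). (d) $\forall x\,(L_0(x)\leftrightarrow\bigvee_n x=c_n)$, so $L_0$ has size $\aleph_0$. (e) Each $L_\beta$, $1\le\beta\le\alpha$, is linearly ordered by $<_\beta$ and may or may not have a maximum. For limit $\beta$, $L_\beta=\bigcup_{\gamma<\beta}L_\gamma$ (the order $<_\beta$ being unrelated to the previous orders). (f) For $\beta<\alpha$ and every $x\in L_{\beta+1}$, $F_\beta(x,\cdot,\cdot)$ is a surjection from $L_\beta$ to $\{b\in L_{\beta+1}: b\le_{\beta+1}x\}$. (g) For every $x\in L_{\alpha+1}$ that is not the maximum of $L_{\alpha+1}$, $F_\alpha(x,\cdot,\cdot)$ is a surjection from $L_\alpha$ to $\{b\in L_{\alpha+1}:b\le_{\alpha+1}x\}$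 and $G(x,\cdot,\cdot)$ is a surjection from $L_\alpha$ to $V(x)$. A model of $\psi_\alpha$ is maximal if it is not a proper substructure of another model of $\psi_\alpha$. The maximal models spectrum is the class of $\kappa$ such that $\psi_\alpha$ has a maximal model of size $\kappa$. For $\kappa\ge\lambda\ge\mu$ and $\kappa>\mu$, a $(\mu,\lambda,\kappa)$-Kurepa tree is a tree of height $\mu$, each level of which has $<\lambda$ elements, and with $\kappa$ branches of height $\mu$ (cofinal branches).
   Formalization: ''Pruned'' is read as: every node lies on a branch (any subset of the model) meeting every level. This is not an L_{ω1,ω} condition when there is no maximum m; with the first-order reading, (4) fails for α=1 (pruned Aronszajn tree of height ω_1). *)

(* Defs.v *)
From mathcomp Require Import all_boot.
From mathcomp Require Import boolp classical_sets functions cardinality.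

Set Implicit Arguments.
Unset Strict Implicit.
Unset Printing Implicit Defensive.

Local Open Scope classical_set_scope.
Local Open Scope card_scope.

Definition linear_on {X : Type} (lt : X -> X -> Prop) (D : set X) : Prop :=
  [/\ forall x, D x -> ~ lt x x,
      forall x y z, D x -> D y -> D z -> lt x y -> lt y z -> lt x z
    & forall x y, D x -> D y -> [\/ lt x y, x = y | lt y x]].

Definition well_order_on {X : Type} (lt : X -> X -> Prop) (D : set X) : Prop :=
  linear_on lt D /\
  forall Y : set X, Y `<=` D -> Y !=set0 ->
    exists2 y, Y y & forall z, Y z -> z = y \/ lt y z.

(* An ordinal is given by a well-ordered type; its elements stand for the
   ordinals below it. *)
Record Ord : Type := MkOrd {
  ord_car :> Type;
  ord_lt : ord_car -> ord_car -> Prop;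
  ord_wo : well_order_on ord_lt [set: ord_car] }.

Definition below (a : Ord) (i : a) : set a := [set j | ord_lt j i].

Lemma ord_wf (a : Ord) : well_founded (@ord_lt a).
Proof.
move=> i; apply: contrapT => nAcc_i.
have [_ /(_ [set j | ~ Acc (@ord_lt a) j])] := ord_wo a.
case=> // [|j nAcc_j minj]; first by exists i.
apply: nAcc_j; constructor => k kj; apply: contrapT => nAcc_k.
have [[irr tr _] _] := ord_wo a.
case: (minj k nAcc_k) => [kE|jk]; first by apply: (irr j) => //; rewrite -{1}kE.
by apply: (irr j) => //; apply: (tr j k j).
Qed.

Lemma empty_wo : well_order_on (fun _ _ : void => False) [set: void].
Proof. by split=> [|Y _ [[]]]; split=> -[]. Qed.

Definition Ord0 : Ord := MkOrd empty_wo.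

Definition succ_lt {X : Type} (lt : X -> X -> Prop) (x y : option X) : Prop :=
  match x, y with
  | Some x, Some y => lt x y
  | Some _, None => True
  | None, _ => False
  end.

Lemma succ_wo (a : Ord) : well_order_on (succ_lt (@ord_lt a)) [set: option a].
Proof.
have [[irr tr tot] least] := ord_wo a; split.
  split=> [[x|] _ //=|[x|] [y|] [z|] _ _ _ //=|[x|] [y|] _ _ /=].
  - exact: irr.
  - exact: tr.
  - by case: (tot x y) => // [xy|->|yx]; [apply: Or31|apply: Or32|apply: Or33].
  - exact: Or31.
  - exact: Or33.
  - exact: Or32.
move=> Y _ [y0 Yy0].
have [[y Yy]|noY] := pselect (exists y, Y (Some y)).
  have [//||z Yz minz] := least [set y | Y (Some y)]; first by exists y.
  exists (Some z) => // -[u|] Yu; last by right.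
  by case: (minz u Yu) => [->|]; [left|right].
exists None => [|[u|] Yu]; last by left.
- by case: y0 Yy0 => // y Yy; case: noY; exists y.
- by case: noY; exists u.
Qed.

(* [a + 1]; its greatest element [None] stands for the ordinal [a] itself. *)
Definition OrdS (a : Ord) : Ord := MkOrd (succ_wo a).

Definition pos (a : Ord) (i : a) : Prop := exists j, ord_lt j i.

Definition is_succ (a : Ord) (i j : a) : Prop :=
  ord_lt i j /\ forall k, ord_lt k j -> k = i \/ ord_lt k i.

Definition is_limit (a : Ord) (i : a) : Prop :=
  pos i /\ ~ exists j, is_succ j i.

Definition card_lt {X Y : Type} (A : set X) (B : set Y) : Prop :=
  A #<= B /\ ~ (B #<= A).

(* [Y] has the least infinite cardinality greater than that of all [g j]. *)
Definition least_above (J : Type) (g : J -> Type) (Y : Type) : Prop :=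
  let above (Z : Type) :=
    infinite_set [set: Z] /\ forall j, card_lt [set: g j] [set: Z] in
  above Y /\ forall Z : Type, above Z -> [set: Y] #<= [set: Z].

Lemma card_leTT (X Y : Type) :
  [set: X] #<= [set: Y] <-> exists f : X -> Y, injective f.
Proof.
split=> [/card_leP[f]|[f injf]].
  exists (fun x => val (f (exist _ x (mem_set (I : [set: X] x))))) => x y.
  by move=> /val_inj /inj => /(_ (mem_set I) (mem_set I)) [].
have [g] : $|{injfun [set: X] >-> [set: Y]}|.
  by apply/injfunPex; exists f => // x y _ _ /injf.
exact: inj_card_le g.
Qed.

Lemma ex_least_card (K : Type) (X : K -> Type) : K ->
  exists k, forall l, [set: X k] #<= [set: X l].
Proof.
move=> k0.
pose T := forall k, X k.
pose P (A : set T) := forall s t k, A s -> A t -> s k = t k -> s = t.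
have [|A [PA maxA]] := @Zorn_bigcup _ P.
  move=> F FP totF s t k [B FB Bs] [C FC Ct] st.
  have [BC|CB] := totF _ _ FB FC.
    exact: (FP C FC s t k (BC s Bs) Ct st).
  exact: (FP B FB s t k Bs (CB t Ct) st).
have [[k surjk]|nsurj] := pselect (exists k, forall x, exists2 s, A s & s k = x).
  exists k => l; apply/card_leTT.
  have /choice[f fP] : forall x, exists s, A s /\ s k = x.
    by move=> x; have [s As sk] := surjk x; exists s.
  exists (fun x => f x l) => x y fxy.
  have [Ax <-] := fP x; have [Ay <-] := fP y.
  by rewrite (PA _ _ l Ax Ay fxy).
have out k : exists x, forall s, A s -> s k <> x.
  apply: contrapT => nout; apply: nsurj; exists k => x.
  apply: contrapT => nx; apply: nout; exists x => s As sk.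
  by apply: nx; exists s.
pose t : T := fun k => sval (cid (out k)).
have tP s k : A s -> s k <> t k by apply: (svalP (cid (out k))).
exfalso; apply: (maxA (A `|` [set t])).
  split=> [s|]; first by left.
  by move=> /(_ t (or_intror erefl)) At; apply: (tP t k0 At).
move=> s u k [As|->] [Au|->] // su.
- exact: (PA s u k).
- by case: (tP s k As).
- by case: (tP u k Au).
Qed.

Lemma card_le_total (X Y : Type) :
  [set: X] #<= [set: Y] \/ [set: Y] #<= [set: X].
Proof.
have [[] H] := @ex_least_card bool (fun b => if b then X else Y) true.
  by left; apply: (H false).
by right; apply: (H true).
Qed.

Lemma ex_least_above (J : Type) (g : J -> Type) : exists Y, least_above g Y.
Proof.
pose U := set (nat + {j : J & g j}).
pose above (Z : Type) :=
  infinite_set [set: Z] /\ forall j, card_lt [set: g j] [set: Z].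
have above_mono (Z Z' : Type) : [set: Z] #<= [set: Z'] -> above Z -> above Z'.
  move=> ZZ' [Zinf Zg]; split.
    by move=> /(card_le_finite ZZ').
  move=> j; have [le nle] := Zg j; split; first exact: card_le_trans le ZZ'.
  by move=> le'; apply: nle; apply: card_le_trans ZZ' le'.
have inU (X : Type) (f : X -> nat + {j : J & g j}) : injective f ->
    card_lt [set: X] [set: U].
  move=> finj; split.
    apply/card_leTT; exists (fun x => [set f x]) => x y.
    by move=> /(congr1 (fun A : U => A (f x))) xy; apply: finj; rewrite -[_ = _]xy.
  move=> /card_leTT[h hinj].
  pose D : U := [set y | exists2 A : U, y = f (h A) & ~ A y].
  have nD : ~ D (f (h D)).
    by move=> /[dup] DD [A /finj /hinj <-].
  by apply: (nD); exists D.
have aboveU : above U.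
  split.
    have [le _] := inU nat inl (fun m n => @inl_inj _ _ m n).
    by move=> /(card_le_finite le); apply: infinite_nat.
  move=> j; apply: (inU _ (fun x => inr (existT _ j x))) => x y [].
  exact: (@existT_inj2 {classic J}).
pose sub (B : {B : set U | above {u | B u}}) := {u | sval B u}.
have aboveT : above {u | [set: U] u}.
  apply: above_mono aboveU; apply/card_leTT.
  by exists (fun u => exist _ u I) => u v /(congr1 sval).
have [[B aB] Bmin] := ex_least_card sub
  (exist (fun B : set U => above {u | B u}) _ aboveT).
exists {u | B u}; split=> // Z aZ.
have [ZU|UZ] := card_le_total Z U; last first.
  apply: card_le_trans UZ; apply/card_leTT; exists sval => u v.
  by apply: eq_sig_hprop => *; exact: Prop_irrelevance.
have /card_leTT[h hinj] := ZU.
have aR : above {u | range h u}.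
  apply: above_mono aZ; apply/card_leTT.
  exists (fun z => exist _ (h z) (imageT h z)) => u v /(congr1 sval).
  exact: hinj.
apply: card_le_trans (Bmin (exist (fun B : set U => above {u | B u}) _ aR)) _.
apply/card_leTT; exists (fun u : {u | range h u} => sval (cid2 (svalP u))).
move=> u v; case: cid2 => z /= _ zu; case: cid2 => z' /= _ zv zz'.
by apply: eq_sig_hprop; [move=> *; exact: Prop_irrelevance|rewrite -zu zz'].
Qed.

Definition aleph_below (a : Ord) : a -> Type :=
  Fix (@ord_wf a) (fun _ => Type) (fun i alephs =>
    sval (cid (@ex_least_above {j : a | ord_lt j i}
                 (fun j => alephs (sval j) (svalP j))))).

(* aleph_a, as a type of that cardinality. *)
Definition aleph (a : Ord) : Type := @aleph_below (OrdS a) None.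

(* The fixed-point equation: [aleph_below i] is the least infinite cardinal
   greater than [aleph_below j] for every [j < i]. *)
Lemma aleph_belowP (a : Ord) (i : a) :
  least_above (fun j : {j : a | ord_lt j i} => aleph_below (sval j))
    (aleph_below i).
Proof.
rewrite /aleph_below Fix_eq; first exact: (svalP (cid (ex_least_above _))).
move=> x f g fg; suff -> : f = g by [].
by apply: functional_extensionality_dep => y; apply: functional_extensionality_dep.
Qed.

Definition chain {X : Type} (lt : X -> X -> Prop) (B : set X) : Prop :=
  forall x y, B x -> B y -> [\/ lt x y, x = y | lt y x].

Definition maximal_chain {X : Type} (lt : X -> X -> Prop) (D B : set X) : Prop :=
  [/\ B `<=` D, chain lt B
    & forall C : set X, C `<=` D -> chain lt C -> B `<=` C -> C = B].

Definition tree {X : Type} (lt : X -> X -> Prop) : Prop :=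
  [/\ forall x, ~ lt x x,
      forall x y z, lt x y -> lt y z -> lt x z
    & forall x, well_order_on lt [set y | lt y x]].

(* The predecessors of [x] have order type [i]. *)
Definition at_level {X : Type} (lt : X -> X -> Prop) (a : Ord) (i : a) : set X :=
  [set x | exists f : X -> a,
     set_bij [set y | lt y x] (below i) f /\
     forall y z, lt y x -> lt z x -> (lt y z <-> ord_lt (f y) (f z))].

Definition has_height {X : Type} (lt : X -> X -> Prop) (a : Ord) : Prop :=
  (forall x, exists i : a, at_level lt i x) /\
  (forall i : a, at_level lt i !=set0).

Definition cofinal_branch {X : Type} (lt : X -> X -> Prop) (a : Ord) : set (set X) :=
  [set B | maximal_chain lt [set: X] B /\
           forall i : a, B `&` at_level lt i !=set0].

Definition initial (a : Ord) : Prop :=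
  forall i : a, card_lt (below i) [set: a].

(* [mu] is both a cardinal and the height of the tree, hence an initial
   ordinal; [lam] and [kap] are arbitrary types of the given cardinalities. *)
Definition Kurepa_tree (mu : Ord) (lam kap : Type)
    {X : Type} (lt : X -> X -> Prop) : Prop :=
  [/\ initial mu,
      [/\ [set: lam] #<= [set: kap], [set: mu] #<= [set: lam]
        & card_lt [set: mu] [set: kap]],
      tree lt /\ has_height lt mu,
      forall i : mu, card_lt (at_level lt i) [set: lam]
    & [set: kap] #<= cofinal_branch lt mu].

(* The elements of [OrdS (OrdS al)] are the ordinals at most [al + 1]. *)
Notation idx al := (OrdS (OrdS al)).

(* Structures for the vocabulary tau of psi_al; [F_] is indexed by the
   ordinals at most [al]. *)
Record structure (al : Ord) : Type := Structure {
  dom :> Type;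
  zero_ : dom;
  c_ : nat -> dom;
  L_ : idx al -> set dom;
  lt_ : {b : idx al | pos b} -> dom -> dom -> Prop;
  S_ : dom -> dom -> Prop;
  V_ : dom -> set dom;
  T_ : dom -> dom -> Prop;
  F_ : OrdS al -> dom -> dom -> dom -> Prop;
  G_ : dom -> dom -> dom -> Prop }.

Arguments zero_ {al} _.
Arguments c_ {al} _ _.
Arguments L_ {al} _ _ _.
Arguments lt_ {al} _ _ _ _.
Arguments S_ {al} _ _ _.
Arguments V_ {al} _ _ _.
Arguments T_ {al} _ _ _.
Arguments F_ {al} _ _ _ _ _.
Arguments G_ {al} _ _ _ _.

Definition embedding (al : Ord) (M N : structure al) (e : M -> N) : Prop :=
  injective e /\
  [/\ e (zero_ M) = zero_ N,
      forall n, e (c_ M n) = c_ N n,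
      forall b x, L_ M b x <-> L_ N b (e x),
      forall b x y, lt_ M b x y <-> lt_ N b (e x) (e y) &
      [/\ forall x y, S_ M x y <-> S_ N (e x) (e y),
          forall x y, V_ M x y <-> V_ N (e x) (e y),
          forall x y, T_ M x y <-> T_ N (e x) (e y),
          forall b x y z, F_ M b x y z <-> F_ N b (e x) (e y) (e z)
        & forall x y z, G_ M x y z <-> G_ N (e x) (e y) (e z)]].

Definition surjection_graph {X : Type} (R : X -> X -> Prop) (A B : set X) : Prop :=
  [/\ forall y z, R y z -> A y /\ B z,
      forall y, A y -> exists! z, R y z
    & forall z, B z -> exists y, R y z].

Section Psi.
Variables (al : Ord) (M : structure al).

(* The ordinal [al + 1]; the ordinal [al] is [Some None], and [b < al] is
   [Some (Some b)]. *)
Definition top : idx al := None.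

Lemma pos_top : pos top.
Proof. by exists (Some None). Qed.

Definition Ltop : set M := L_ M top.
Definition lttop : M -> M -> Prop := lt_ M (exist _ top pos_top).

Definition is_max (m : M) : Prop :=
  Ltop m /\ forall x, Ltop x -> x = m \/ lttop x m.

Definition succ_of (a b : M) : Prop :=
  [/\ Ltop a, Ltop b, lttop a b &
      forall x, Ltop x -> lttop x b -> x = a \/ lttop x a].

Definition nodes : set M := [set x | exists2 a, Ltop a & V_ M a x].

Definition psi_a : Prop :=
  [/\ linear_on lttop Ltop,
      Ltop (zero_ M) /\ (forall x, Ltop x -> x = zero_ M \/ lttop (zero_ M) x),
      forall a, Ltop a -> ~ is_max a -> exists b, succ_of a b,
      forall a b, S_ M a b <-> succ_of a b
    & forall m, is_max m -> ~ exists a, S_ M a m].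

Definition psi_b : Prop :=
  [/\ forall a b, Ltop a -> V_ M a `&` L_ M b = set0,
      forall a b, Ltop a -> Ltop b -> a <> b -> V_ M a `&` V_ M b = set0
    & forall x, (exists b, L_ M b x) \/ nodes x].

(* [B] is any subset of [M], not necessarily represented by an element of
   [M]; if [L_(al+1)] has a maximum [m], [B] has to meet [V(m)] as well. *)
Definition maximal_branch (B : set M) : Prop :=
  maximal_chain (T_ M) nodes B /\ forall a, Ltop a -> B `&` V_ M a !=set0.

(* [T] is a strict partial order on the nodes in which the predecessors of a
   node are linearly ordered (as [L_(al+1)] is only linearly ordered,
   they need not be well-ordered). *)
Definition psi_c : Prop :=
  [/\ (forall x y z, T_ M x y -> T_ M y z -> T_ M x z) /\
      (forall z, chain (T_ M) [set x | T_ M x z]),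
      forall x y, T_ M x y ->
        exists a b, [/\ Ltop a, Ltop b, V_ M a x, V_ M b y & lttop a b],
      forall a b y, Ltop a -> Ltop b -> V_ M a y -> lttop b a ->
        exists2 x, V_ M b x & T_ M x y,
      forall a, Ltop a -> a <> zero_ M -> (~ exists b, S_ M b a) ->
        forall y z, V_ M a y -> V_ M a z ->
        (forall x, T_ M x y <-> T_ M x z) -> y = z
    & forall x, nodes x -> exists2 B, maximal_branch B & B x].

(* The [c_n] are pairwise distinct, so that [L_0] has size aleph_0. *)
Definition psi_d : Prop :=
  injective (c_ M) /\
  forall b : idx al, ~ pos b -> forall x, L_ M b x <-> exists n, x = c_ M n.

Definition psi_e : Prop :=
  (forall b : {b : idx al | pos b}, sval b <> top ->
     linear_on (lt_ M b) (L_ M (sval b))) /\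
  (forall b : idx al, is_limit b ->
     L_ M b = \bigcup_(c in below b) L_ M c).

(* Here [sval b'] ranges over the successors [b + 1] of the ordinals
   [b < al]. *)
Definition psi_f : Prop :=
  forall (b : al) (b' : {b : idx al | pos b}),
    is_succ (Some (Some b) : idx al) (sval b') ->
    forall x, L_ M (sval b') x ->
    surjection_graph (F_ M (Some b) x) (L_ M (Some (Some b)))
      [set y | L_ M (sval b') y /\ (y = x \/ lt_ M b' y x)].

Definition psi_g : Prop :=
  forall x, Ltop x -> ~ is_max x ->
    surjection_graph (F_ M None x) (L_ M (Some None))
      [set y | Ltop y /\ (y = x \/ lttop y x)] /\
    surjection_graph (G_ M x) (L_ M (Some None)) (V_ M x).

(* [M] is a model of psi_al. *)
Definition psi : Prop :=
  [/\ psi_a, psi_b, psi_c, psi_d & [/\ psi_e, psi_f & psi_g]].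

End Psi.

(* Up to isomorphism, [M] is a substructure of [N] via an embedding; it is
   proper when the embedding is not onto. *)
Definition maximal_model (al : Ord) (M : structure al) : Prop :=
  psi M /\
  forall (N : structure al) (e : M -> N), psi N -> embedding e ->
    forall y : N, exists x : M, e x = y.

Definition has_maximal_model (al : Ord) (kap : Type) : Prop :=
  exists M : structure al, maximal_model M /\ [set: M] #= [set: kap].

(* Main.v *)
Require Import Defs.
From mathcomp Require Import all_boot.
From mathcomp Require Import boolp classical_sets functions cardinality.
From mathcomp Require wochoice.

Set Implicit Arguments.
Unset Strict Implicit.
Unset Printing Implicit Defensive.

Local Open Scope classical_set_scope.
Local Open Scope card_scope.

(** The sets $L_\beta$, $\beta\le\alpha$, have at most $\aleph_\beta$ elements,
    there are at most $\aleph_{\alpha+1}$ levels, and a level that is not maximal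
    has at most $\aleph_\alpha$ nodes ([L_card_le], [nonmax_card_le],
    [V_card_le]). Only a maximal level $m$ can be large, and its nodes are
    branches of the tree formed by the levels below it.

    A model that is maximal has a maximal level, since otherwise all branches
    could be added on top of the tree ([maximal_has_max]); all branches below
    $m$ are nodes of $m$ ([maximal_complete]); each $L_\beta$ has size exactly
    $\aleph_\beta$, since otherwise one of them could be prolonged
    ([maximal_L_big]); and the model has at least $\aleph_{\alpha+1}$ elements,
    since otherwise $\omega$ copies of the level $m$ could be inserted just below
    $m$ ([maximal_not_small]). Hence its size is $\aleph_{\alpha+1}$, unless it is
    a larger number $\kappa$ of branches through the levels below $m$. These may be
    replaced by a cofinal subset of order type their cofinality $\mu$
    ([ex_cofinal]), an initial ordinal. If $\mu$ is uncountable, this gives a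
    Kurepa tree ([subtree_Kurepa]). If $\mu=\omega$, the tree has height $\omega$
    and at most $\aleph_\alpha$ nodes, and a tree of this kind with more than
    $\aleph_\alpha$ branches has exactly $\aleph_\alpha^{\aleph_0}$ of them
    ([omega_tree_branches]).

    Conversely, let $|L_\beta|=\aleph_\beta$ for $\beta\le\alpha$ and let the nodes
    of the maximal level $m\ne0$ be all the branches below it, at least
    $\aleph_{\alpha+1}$ in number; then the model is maximal ([complete_maximal]).
    In an extension no $L_\beta$ grows, because a new element would lie above too
    many old ones or in an initial segment that is already enumerated. A new level
    cannot lie below an old level other than $m$ for the same reason; anywhere else
    it would make some non-maximal level have more than $\aleph_\alpha$ nodes. And
    there is no branch left for a new node of level $m$. Models of this kind exist
    for every suitable set of branches ([maximal_model_of_branches]); the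
    three kinds of maximal models come from the sequences of length
    $\omega_{\alpha+1}$ with at most one entry different from zero, the sequences
    of length $\omega$ in $\lambda$, and the cofinal branches of a Kurepa tree. *)

(** * Cardinal arithmetic *)

Lemma sval_inj (T : Type) (P : T -> Prop) (x y : {z | P z}) : sval x = sval y -> x = y.
Proof. by case: x y => [x ?] [y ?] /= e; subst y; congr exist; exact: Prop_irrelevance. Qed.

(** Comparing cardinals through a relation, rather than a function, avoids
    values for the points outside of [A]. *)
Lemma card_le_rel (X Y : Type) (A : set X) (B : set Y) (R : X -> Y -> Prop) :
  (forall x, A x -> exists2 y, B y & R x y) ->
  (forall x x' y, A x -> A x' -> B y -> R x y -> R x' y -> x = x') ->
  A #<= B.
Proof.
move=> tot inj.
have AxP (x : {x | A x}) : exists2 y, B y & R (sval x) y.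
  by apply: tot; exact: (svalP x).
have le : [set: {x | A x}] #<= [set: {y | B y}].
  apply/card_leTT; exists (fun x => exist B (sval (cid2 (AxP x))) (s2valP (cid2 (AxP x)))).
  move=> x x' /(congr1 sval) /= E; case: cid2 E => y /= By Rxy; case: cid2 => y' /= By' Rxy' E.
  move: x x' Rxy Rxy' => [x Ax] [x' Ax'] /= Rxy Rxy'.
  by apply: sval_inj; apply: (inj x x' y) => //; rewrite E.
have eqs (Z : Type) (C : set Z) : [set: {z | C z}] #= C.
  have E : C = range (fun z : {z | C z} => sval z).
    apply/seteqP; split=> [z Cz|_ [z _ <-]]; last exact: (svalP z).
    by exists (exist _ z Cz).
  rewrite [X in _ #= X]E card_eq_sym; apply: inj_card_eq => z z' _ _.
  exact: sval_inj.
by rewrite -(card_le_eql (eqs X A)) -(card_le_eqr (eqs Y B)).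
Qed.

Lemma card_subtype (X : Type) (A : set X) : [set: {x | A x}] #= A.
Proof.
rewrite card_eq_le; apply/andP; split.
  apply: (@card_le_rel _ _ _ _ (fun x y => sval x = y)) => [x _|x x' y _ _ _ <-].
    by exists (sval x) => //; exact: (svalP x).
  by move=> e; exact/sval_inj/esym.
apply: (@card_le_rel _ _ _ _ (fun x y => sval y = x)) => [x Ax|x x' y _ _ _ <- <- //].
by exists (exist _ x Ax).
Qed.

Lemma card_le_inj (X Y : Type) (A : set X) (B : set Y) (f : X -> Y) :
  (forall x, A x -> B (f x)) ->
  (forall x x', A x -> A x' -> f x = f x' -> x = x') -> A #<= B.
Proof.
move=> fB inj; apply: (@card_le_rel _ _ _ _ (fun x y => f x = y)) => [x Ax|].
  by exists (f x); [exact: fB|].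
by move=> x x' y Ax Ax' _ E E'; apply: inj => //; rewrite E E'.
Qed.

Lemma card_le_surj (X Y : Type) (A : set X) (B : set Y) (f : Y -> X) :
  (forall x, A x -> exists2 y, B y & f y = x) -> A #<= B.
Proof.
move=> fA; apply: (@card_le_rel _ _ _ _ (fun x y => f y = x)) => [//|].
by move=> x x' y _ _ _ <- <-.
Qed.

Lemma card_le_fun (X Y : Type) (A : set X) (B : set Y) (y0 : Y) : A #<= B ->
  exists f : X -> Y, (forall x, A x -> B (f x)) /\
    (forall x x', A x -> A x' -> f x = f x' -> x = x').
Proof.
rewrite -(card_le_eql (card_subtype A)) -(card_le_eqr (card_subtype B)) => /card_leTT[g ginj].
exists (fun x => if pselect (A x) is left Ax then sval (g (exist _ x Ax)) else y0); split.
  by move=> x Ax; case: pselect => // ?; exact: (svalP (g _)).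
move=> x x' Ax Ax'; case: pselect => // Bx; case: pselect => // Bx' E.
suff : g (exist _ x Bx) = g (exist _ x' Bx') by move/ginj => [].
exact: sval_inj.
Qed.

Lemma card_le_totalS (X Y : Type) (A : set X) (B : set Y) : A #<= B \/ B #<= A.
Proof.
rewrite -(card_le_eql (card_subtype A)) -(card_le_eqr (card_subtype B)).
by rewrite -(card_le_eqr (card_subtype A)) -(card_le_eql (card_subtype B)); exact: card_le_total.
Qed.

Lemma card_ltNge (X Y : Type) (A : set X) (B : set Y) : ~ (B #<= A) -> card_lt A B.
Proof. by move=> nBA; split=> //; case: (card_le_totalS A B). Qed.

Lemma card_le_lt_trans (X Y Z : Type) (A : set X) (B : set Y) (C : set Z) :
  A #<= B -> card_lt B C -> card_lt A C.
Proof.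
move=> AB [BC nCB]; split; first exact: card_le_trans AB BC.
by move=> CA; apply: nCB; exact: card_le_trans CA AB.
Qed.

Lemma card_lt_le_trans (X Y Z : Type) (A : set X) (B : set Y) (C : set Z) :
  card_lt A B -> B #<= C -> card_lt A C.
Proof.
move=> [AB nBA] BC; split; first exact: card_le_trans AB BC.
by move=> CA; apply: nBA; exact: card_le_trans BC CA.
Qed.

(** Zorn's lemma gives a maximal infinite set $A$ together with an injection of
    $A \times A$ into $A$. The complement of $A$ is then smaller than $A$, since
    a copy of $A$ inside the complement would leave room to extend the
    injection; so $A$ has the size of the whole type. The injection is
    handled through its graph, from whose diagonal $A$ is read off. *)
Section Squares.
Variable X : Type.
Hypothesis Xinf : [set: nat] #<= [set: X].

Let dom (S : set (X * X * X)) : set X := [set x | exists z, S (x, x, z)].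

Let square_inj (S : set (X * X * X)) : Prop :=
  [/\ forall x y z, S (x, y, z) -> [/\ dom S x, dom S y & dom S z],
      forall x y, dom S x -> dom S y -> exists z, S (x, y, z)
    & forall x y x' y' z, S (x, y, z) -> S (x', y', z) -> x = x' /\ y = y'].

Lemma square_injP (S : set (X * X * X)) : square_inj S -> dom S `*` dom S #<= dom S.
Proof.
move=> [SD Stot Sinj].
apply: (@card_le_rel _ _ _ _ (fun p z => S (p.1, p.2, z))) => [[x y] [/= Dx Dy]|].
  by have [z Sz] := Stot x y Dx Dy; exists z => //; have [] := SD _ _ _ Sz.
by move=> [x y] [x' y'] z _ _ _ /= h h'; have [-> ->] := Sinj _ _ _ _ _ h h'.
Qed.

Let infinite_square (S : set (X * X * X)) : Prop :=
  square_inj S /\ [set: nat] #<= dom S.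

Lemma infinite_square_nat : exists S, infinite_square S.
Proof.
have /card_leTT[h hinj] := Xinf.
have /card_leTT[p pinj] : [set: nat * nat] #<= [set: nat].
  by rewrite (card_le_eql card_nat2).
pose S := [set t | exists m n, t = (h m, h n, h (p (m, n)))].
have dE x : dom S x <-> exists n, x = h n.
  split=> [[z [m [n [-> _ _]]]]|[n ->]]; first by exists m.
  by exists (h (p (n, n))); exists n, n.
exists S; split.
  split=> [x y z [m [n [-> -> ->]]]|x y /dE[m ->] /dE[n ->]|].
  - by split; apply/dE; [exists m|exists n|exists (p (m, n))].
  - by exists (h (p (m, n))); exists m, n.
  - move=> x y x' y' z [m [n [-> -> ->]]] [m' [n' [-> -> /hinj /pinj]]].
    by move=> [-> ->].
apply: (@card_le_inj _ _ _ _ h) => [n _|m n _ _ /hinj //].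
by apply/dE; exists n.
Qed.

Lemma card_le_square_sum (A : set X) (Y : Type) (B C : set Y) :
  [set: nat] #<= A -> A `*` A #<= A -> B #<= A -> C #<= A -> B `|` C #<= A.
Proof.
move=> Ainf AA BA CA; apply: card_le_trans AA.
have [x0 _] : exists x, A x.
  by apply: infinite_setN0; apply/infiniteP.
have [h [hA hinj]] := card_le_fun x0 Ainf.
have [f [fA finj]] := card_le_fun x0 BA.
have [g [gA ginj]] := card_le_fun x0 CA.
pose k y := if pselect (B y) then (h 0%N, f y) else (h 1%N, g y).
have h01 : h 0%N <> h 1%N by move/hinj => /(_ I I).
apply: (@card_le_inj _ _ _ _ k) => y; rewrite /k.
  case: pselect => [By|nBy] [] // Cy; split => /=; by [exact: hA|exact: fA|exact: gA].
move=> y' Uy Uy'; case: pselect => By; case: pselect => By' // [].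
- by apply: finj.
- by move=> e; case: h01.
- by move=> e; case: h01.
- by case: Uy => // Cy; case: Uy' => // Cy'; apply: ginj.
Qed.

Lemma square_extend (S : set (X * X * X)) (B : set X) (b0 : X) :
  infinite_square S -> B b0 -> B `<=` ~` dom S -> B #<= dom S -> dom S #<= B ->
  exists S', S `<` S' /\ infinite_square S'.
Proof.
move=> [Ssq Sinf] Bb0 BS BA AB; set A := dom S in Sinf BS BA AB.
have AA : A `*` A #<= A := square_injP Ssq.
(* The new pairs, those not in the square of [A], all get values in [B]. *)
have UA : A `|` B #<= A by apply: card_le_square_sum => //; exact: card_lexx.
have [u [uA uinj]] := card_le_fun b0 UA.
have [v [vA vinj]] := card_le_fun b0 (card_le_trans AA AB).
pose w x y := v (u x, u y).
have wB x y : (A `|` B) x -> (A `|` B) y -> B (w x y).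
  by move=> Ux Uy; apply: vA; split; apply: uA.
have winj x y x' y' : (A `|` B) x -> (A `|` B) y -> (A `|` B) x' -> (A `|` B) y' ->
    w x y = w x' y' -> x = x' /\ y = y'.
  move=> Ux Uy Ux' Uy' /(vinj (u x, u y) (u x', u y')).
  move=> /(_ (conj (uA _ Ux) (uA _ Uy)) (conj (uA _ Ux') (uA _ Uy'))) [e1 e2].
  by split; apply: uinj.
have [SD Stot Sinj] := Ssq.
pose S' := S `|` [set t | [/\ (A `|` B) t.1.1, (A `|` B) t.1.2,
                           ~ (A t.1.1 /\ A t.1.2) & t.2 = w t.1.1 t.1.2]].
have dS' : dom S' = A `|` B.
  apply/seteqP; split=> [x [z [Sx|[/= Ux]]] //|x [Ax|Bx]]; first by left; exists z.
    by have [z Sz] := Ax; exists z; left.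
  exists (w x x); right; split=> //=; [by right|by right|].
  by case=> Ax _; apply: (BS x).
exists S'; split; [split|].
- by move=> t St; left.
- move=> sub; have SS := sub (b0, b0, w b0 b0); have [|Ab0 _ _] := SD b0 b0 (w b0 b0).
    apply: SS; by right; split=> //=; [right|right|case=> Ab0 _; apply: (BS b0)].
  exact: (BS b0).
split; last first.
  by rewrite dS'; apply: card_le_trans Sinf (subset_card_le _); left.
split; rewrite ?dS'.
- move=> x y z [/SD[? ? ?]|[/= Ux Uy _ ->]]; first by split; left.
  by split=> //; right; apply: wB.
- move=> x y Ux Uy; have [[Ax Ay]|nA] := pselect (A x /\ A y).
    by have [z Sz] := Stot x y Ax Ay; exists z; left.
  by exists (w x y); right; split.
- move=> x y x' y' z [Sz|[/= Ux Uy nA ->]] [Sz'|[/= Ux' Uy' nA' zE]].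
  + exact: Sinj Sz Sz'.
  + by have [_ _ Az] := SD _ _ _ Sz; case: (BS z) => //; rewrite zE; apply: wB.
  + by have [_ _ Az] := SD _ _ _ Sz'; case: (BS _ _ Az); apply: wB.
  + by apply: winj.
Qed.

Lemma square_chain (F : set (set (X * X * X))) :
  F `<=` infinite_square -> total_on F subset -> F !=set0 ->
  infinite_square (\bigcup_(S in F) S).
Proof.
move=> FP totF [S0 FS0].
have up (S1 S2 : set (X * X * X)) : F S1 -> F S2 ->
    exists2 S, F S & S1 `<=` S /\ S2 `<=` S.
  move=> F1 F2; case: (totF _ _ F1 F2) => h; [exists S2|exists S1] => //;
    by split=> //; exact: subset_refl.
have domU x : dom (\bigcup_(S in F) S) x <-> exists2 S, F S & dom S x.
  split=> [[z [S FS Sx]]|[S FS [z Sx]]]; first by exists S => //; exists z.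
  by exists z, S.
split; last first.
  have [_ inf0] := FP _ FS0.
  by apply: card_le_trans inf0 (subset_card_le _) => x dx; apply/domU; exists S0.
split.
- move=> x y z [S FS Sz]; have [[SD _ _] _] := FP _ FS; have [? ? ?] := SD _ _ _ Sz.
  by split; apply/domU; exists S.
- move=> x y /domU[S1 F1 [zx d1]] /domU[S2 F2 [zy d2]].
  have [S FS [s1 s2]] := up _ _ F1 F2; have [[_ Stot _] _] := FP _ FS.
  have [||z Sz] := Stot x y; [by exists zx; apply: s1|by exists zy; apply: s2|].
  by exists z, S.
- move=> x y x' y' z [S1 F1 d1] [S2 F2 d2].
  have [S FS [s1 s2]] := up _ _ F1 F2; have [[_ _ Sinj] _] := FP _ FS.
  exact: Sinj (s1 _ d1) (s2 _ d2).
Qed.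

Lemma card_le_squareT : [set: X * X] #<= [set: X].
Proof.
have [S00 inf00] := infinite_square_nat.
have [|S [P maxS]] := @Zorn_bigcup _ (fun S => S = set0 \/ infinite_square S).
  move=> F FP totF.
  have [[S0 [FS0 inf0]]|none] := pselect (exists S, F S /\ infinite_square S); last first.
    left; apply/seteqP; split=> // t [S FS St]; have [E|i] := FP _ FS.
      by rewrite E in St.
    by case: none; exists S.
  right; have -> : \bigcup_(S in F) S = \bigcup_(S in F `&` infinite_square) S.
    apply/seteqP; split=> [t [S FS St]|t [S [FS _] St]]; last by exists S.
    have [E|i] := FP _ FS; first by rewrite E in St.
    by exists S.
  apply: square_chain; [by move=> S []| |by exists S0].
  by move=> S1 S2 [F1 _] [F2 _]; apply: totF.
have Sinf : infinite_square S.
  case: P => // S0; exfalso; apply: (maxS S00); last by right.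
  rewrite S0; split=> // le; have [_ inf] := inf00.
  have : [set: nat] #<= dom set0.
    by apply: card_le_trans inf (subset_card_le _) => x [z /le].
  by move=> /infiniteP/infinite_setN0[x [z]].
have AA := square_injP Sinf.1; have Ainf := Sinf.2.
have XA : [set: X] #<= dom S.
  have [le|/card_ltNge[le _]] := pselect (~` dom S #<= dom S).
    rewrite -(setUv (dom S)); apply: card_le_square_sum => //; exact: card_lexx.
  have [x0 dx0] : exists x, dom S x by apply: infinite_setN0; apply/infiniteP.
  have [f [fA finj]] := card_le_fun x0 le.
  have [||||S' [ltS S'inf]] := @square_extend S (f @` dom S) (f x0) Sinf.
  - by exists x0.
  - by move=> _ [x dx <-]; apply: fA.
  - exact: card_image_le.
  - by apply: (@card_le_inj _ _ _ _ f) => // x dx; exists x.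
  by case: (maxS S' ltS); right.
apply: card_le_trans (subset_card_le (@subsetT _ (dom S))).
apply: card_le_trans AA.
have [x0 dx0] : exists x, dom S x by apply: infinite_setN0; apply/infiniteP.
have [f [fA finj]] := card_le_fun x0 XA.
apply: (@card_le_inj _ _ _ _ (fun p => (f p.1, f p.2))).
  by move=> [x y] _; split; apply: fA.
by move=> [x y] [x' y'] _ _ [/finj /= -> // /finj ->].
Qed.

End Squares.

Section InfiniteCardinal.
Variable X : Type.
Hypothesis Xinf : [set: nat] #<= [set: X].

Lemma card_leX (Y Z : Type) (A : set Y) (B : set Z) :
  A #<= [set: X] -> B #<= [set: X] -> A `*` B #<= [set: X].
Proof.
move=> AX BX; apply: card_le_trans (card_le_squareT Xinf).
have [x0 _] : [set: X] !=set0 by apply: infinite_setN0; apply/infiniteP.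
have [f [_ finj]] := card_le_fun x0 AX; have [g [_ ginj]] := card_le_fun x0 BX.
apply: (@card_le_inj _ _ _ _ (fun p => (f p.1, g p.2))) => //.
move=> [x y] [x' y'] [/= ? ?] [/= ? ?] [e1 e2]; congr (_, _); by [apply: finj|apply: ginj].
Qed.

Lemma card_le_prodT (Y Z : Type) :
  [set: Y] #<= [set: X] -> [set: Z] #<= [set: X] -> [set: Y * Z] #<= [set: X].
Proof. by rewrite -setXTT; exact: card_leX. Qed.

Lemma card_le_bigcup (I Y : Type) (D : set I) (F : I -> set Y) :
  D #<= [set: X] -> (forall i, D i -> F i #<= [set: X]) ->
  \bigcup_(i in D) F i #<= [set: X].
Proof.
move=> DX FX; apply: card_le_trans (card_leX DX (card_lexx [set: X])).
have [x0 _] : [set: X] !=set0 by apply: infinite_setN0; apply/infiniteP.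
have /choice[f fP] i : exists f : Y -> X,
    D i -> forall y y', F i y -> F i y' -> f y = f y' -> y = y'.
  have [Di|nDi] := pselect (D i); last by exists (fun=> x0).
  by have [f [_ finj]] := card_le_fun x0 (FX i Di); exists f.
apply: (@card_le_rel _ _ _ _ (fun y p => F p.1 y /\ f p.1 y = p.2)).
  by move=> y [i Di Fy]; exists (i, f i y).
by move=> y y' [i x] _ _ [/= Di _] [/= Fy <-] [/= Fy' e]; apply: (fP i).
Qed.

Lemma card_leU (Y : Type) (A B : set Y) :
  A #<= [set: X] -> B #<= [set: X] -> A `|` B #<= [set: X].
Proof.
move=> AX BX; rewrite -bigcup2E; apply: card_le_bigcup => // -[|[|n]] _ //=.
Qed.

Lemma card_le_sumT (Y Z : Type) :
  [set: Y] #<= [set: X] -> [set: Z] #<= [set: X] -> [set: Y + Z] #<= [set: X].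
Proof.
move=> YX ZX; have -> : [set: Y + Z] = inl @` [set: Y] `|` inr @` [set: Z].
  by apply/seteqP; split=> // -[y|z] _; [left; exists y|right; exists z].
by apply: card_leU; apply: card_le_trans (card_image_le _ _) _.
Qed.

Lemma card_le_optionT (Y : Type) : [set: Y] #<= [set: X] -> [set: option Y] #<= [set: X].
Proof.
move=> YX; apply: card_le_trans (card_le_sumT YX (card_le_trans (countableP [set: unit]) Xinf)).
apply: (@card_le_inj _ _ _ _ (fun o => if o is Some y then inl y else inr tt)) => //.
by move=> [y|] [y'|] _ _ // [->].
Qed.

Lemma card_le_seqT : [set: seq X] #<= [set: X].
Proof.
have -> : [set: seq X] = \bigcup_(n in [set: nat]) [set s | size s = n].
  by apply/seteqP; split=> // s _; exists (size s).
apply: card_le_bigcup => // n _; elim: n => [|n IHn].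
  apply: card_le_trans Xinf.
  by apply: (@card_le_inj _ _ _ _ (fun=> 0%N)) => // s s' /size0nil -> /size0nil ->.
apply: card_le_trans (card_leX (card_lexx [set: X]) IHn).
have [x0 _] : [set: X] !=set0 by apply: infinite_setN0; apply/infiniteP.
apply: (@card_le_inj _ _ _ _ (fun s => (head x0 s, behead s))).
  by move=> [|x s] //= [<-].
by move=> [|x s] [|x' s'] //= _ _ [-> ->].
Qed.

End InfiniteCardinal.

Lemma card_le_sequence (Y Z : Type) :
  [set: Y] #<= [set: Z] -> [set: nat -> Y] #<= [set: nat -> Z].
Proof.
move=> /card_leTT[f finj]; apply/card_leTT; exists (fun u n => f (u n)) => u v uv.
by apply: functional_extensionality_dep => n; apply: finj; exact: (congr1 (@^~ n) uv).
Qed.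

Lemma card_le_sequence2 (Y : Type) : [set: nat -> nat -> Y] #<= [set: nat -> Y].
Proof.
have /card_leTT[p pinj] : [set: nat] #<= [set: nat * nat] by rewrite (card_le_eqr card_nat2).
have /card_leTT[q qinj] : [set: nat * nat] #<= [set: nat] by rewrite (card_le_eql card_nat2).
(* [r] inverts the pairing function [q]. *)
have /choice[r rP] n : exists p : nat * nat, forall p', n = q p' -> p = p'.
  have [[p' ->]|none] := pselect (exists p', n = q p'); first by exists p' => p2 /qinj.
  by exists (0, 0)%N => p' e; case: none; exists p'.
apply/card_leTT; exists (fun u n => u (r n).1 (r n).2) => u v uv.
apply: functional_extensionality_dep => m; apply: functional_extensionality_dep => n.
by move: (congr1 (@^~ (q (m, n))) uv); rewrite (rP _ (m, n) erefl).
Qed.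

Lemma card_le_nat_sequence : [set: nat -> nat] #<= [set: nat -> bool].
Proof.
apply: card_le_trans (card_le_sequence2 bool).
apply/card_leTT; exists (fun u m n => u m == n) => u v uv.
apply: functional_extensionality_dep => m.
by have := congr1 (fun w => w m (u m)) uv; rewrite eqxx => /esym /eqP.
Qed.

(** * Well-orders and alephs *)

Section OrdTheory.
Variable a : Ord.
Implicit Types i j k : a.

Lemma ord_irr i : ~ ord_lt i i.
Proof. by have [[irr _ _] _] := ord_wo a; exact: irr. Qed.

Lemma ord_trans i j k : ord_lt i j -> ord_lt j k -> ord_lt i k.
Proof. by have [[_ tr _] _] := ord_wo a; exact: tr. Qed.

Lemma ord_total i j : [\/ ord_lt i j, i = j | ord_lt j i].
Proof. by have [[_ _ tot] _] := ord_wo a; exact: tot. Qed.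

Lemma ord_least (P : a -> Prop) : (exists i, P i) ->
  exists2 i, P i & forall j, P j -> j = i \/ ord_lt i j.
Proof. by move=> [i Pi]; have [_ least] := ord_wo a; apply: (least P) => //; exists i. Qed.

Lemma ord_lt_nle i j : ord_lt i j -> ~ (j = i \/ ord_lt j i).
Proof. by move=> ij [e|ji]; apply: (@ord_irr i); [rewrite -{2}e|exact: ord_trans ji]. Qed.

Lemma ord_zero_succ_limit i : [\/ ~ pos i, exists j, is_succ j i | is_limit i].
Proof.
have [pi|npi] := pselect (pos i); last exact: Or31.
by have [s|ns] := pselect (exists j, is_succ j i); [exact: Or32|apply: Or33].
Qed.

Lemma is_limitP i j : is_limit i -> ord_lt j i -> exists2 k, is_succ j k & ord_lt k i.
Proof.
move=> [_ nsucc] ji.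
have [k jk kmin] : exists2 k, ord_lt j k & forall l, ord_lt j l -> l = k \/ ord_lt k l.
  by apply: ord_least; exists i.
have sjk : is_succ j k.
  split=> // l lk; case: (ord_total l j) => [lj|e|jl]; [by right|by left|].
  by case: (kmin l jl) => [e|kl]; case: (@ord_irr k); [rewrite -{1}e|exact: ord_trans lk].
exists k => //; case: (kmin i ji) => // e; case: nsucc; exists j.
by rewrite e.
Qed.

Lemma is_succ_inj i i' j : is_succ i j -> is_succ i' j -> i = i'.
Proof.
move=> [ij mi] [i'j mi']; case: (mi' i ij) => // ii'; case: (mi i' i'j) => // i'i.
by case: (@ord_irr i); exact: ord_trans i'i.
Qed.

End OrdTheory.

Lemma sub_wo (X : Type) (lt : X -> X -> Prop) (D : set X) :
  well_order_on lt D ->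
  well_order_on (fun x y : {x | D x} => lt (sval x) (sval y)) [set: {x | D x}].
Proof.
move=> [[irr tr tot] least]; split.
  split=> [[x Dx] _|[x Dx] [y Dy] [z Dz] _ _ _|[x Dx] [y Dy] _ _] /=.
  - exact: irr.
  - exact: tr.
  - case: (tot x y Dx Dy) => [h|h|h]; [exact: Or31| |exact: Or33].
    by apply: Or32; apply: sval_inj.
move=> Y _ [[x Dx] Yx].
have [||y [Dy Yy] ymin] := least [set y | exists Dy : D y, Y (exist _ y Dy)].
- by move=> y [].
- by exists x, Dx.
exists (exist _ y Dy) => // -[z Dz] Yz.
case: (ymin z); [by exists Dz| |by right].
by move=> e; left; apply: sval_inj.
Qed.

Definition Ord_on (X : Type) (lt : X -> X -> Prop) (D : set X)
    (wo : well_order_on lt D) : Ord := MkOrd (sub_wo wo).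

Lemma ex_ord (X : Type) : exists a : Ord, ord_car a = X.
Proof.
have [R wo] := @wochoice.well_ordering_principle {classic X}.
have anti : antisymmetric R.
  move=> x y.
  exact: (@wochoice.wo_chain_antisymmetric {classic X} R predT (wochoice.withinW wo)).
unshelve eexists (@MkOrd X (fun x y => R x y /\ x <> y) _); last by [].
have least (Y : set X) : Y !=set0 -> exists2 y, Y y & forall z, Y z -> R y z.
  move=> [x Yx]; have [|y [[]]] := wo (fun y => `[< Y y >]); first by exists x; apply/asboolP.
  by move=> /asboolP Yy ymin _; exists y => // z Yz; apply: ymin; apply/asboolP.
have tot x y : R x y \/ R y x.
  have [|z [->|->] zmin] := least [set z | z = x \/ z = y]; first by exists x; left.
  - by left; apply: zmin; right.
  - by right; apply: zmin; left.
have trans x y z : R x y -> R y z -> R x z.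
  move=> xy yz.
  have [|w [->|[->|->]] wmin] := least [set w | w = x \/ w = y \/ w = z]; first by exists x; left.
  - by apply: wmin; right; right.
  - have e : x = y by apply: anti; rewrite xy wmin //; left.
    by rewrite e.
  - have e : y = z by apply: anti; rewrite yz wmin //; right; left.
    by rewrite -e.
split.
  split=> [x _ []|x y z _ _ _ [xy nxy] [yz nyz]|x y _ _] //.
    split; first exact: trans yz.
    by move=> e; apply: nxy; apply: anti; rewrite xy e yz.
  have [e|ne] := pselect (x = y); first exact: Or32.
  by case: (tot x y) => h; [apply: Or31|apply: Or33]; split=> // /esym.
move=> Y _ /least[y Yy ymin]; exists y => // z Yz.
have [e|ne] := pselect (z = y); [by left|right; split; first exact: ymin].
by move=> /esym.
Qed.

(** A well-order of [X] is cut at the first element that has as many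
    predecessors as [X] has elements. *)
Lemma ex_initial (X : Type) : exists a : Ord, initial a /\ [set: a] #= [set: X].
Proof.
have [w wX] := ex_ord X.
have [[i0 Pi0]|none] := pselect (exists i : w, [set: w] #<= below i); last first.
  exists w; split; last by rewrite wX; exact: card_eqxx.
  by move=> i; apply: card_ltNge => le; apply: none; exists i.
have [i Pi mini] := @ord_least w (fun i => [set: w] #<= below i) (ex_intro _ i0 Pi0).
have wo : well_order_on (@ord_lt w) (below i).
  have [[irr tr tot] least] := ord_wo w; split; last first.
    by move=> Y _; apply: least.
  by split; [move=> x _; exact: irr|move=> x y z _ _ _; exact: tr|move=> x y _ _; exact: tot].
exists (Ord_on wo); split.
  move=> [j ji]; apply: card_ltNge => le.
  have lej : [set: w] #<= below j.
    apply: card_le_trans Pi _; rewrite -(card_le_eql (card_subtype (below i))).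
    apply: card_le_trans le _; apply: (@card_le_inj _ _ _ _ sval) => //.
    by move=> x y _ _; exact: sval_inj.
  case: (mini j lej) => [e|ij]; last exact: (@ord_irr w i (ord_trans ij ji)).
  by apply: (@ord_irr w i); rewrite -{1}e.
rewrite -wX (card_eql (card_subtype (below i))) card_eq_le Pi andbT.
exact: subset_card_le.
Qed.

Notation "'ℵ' i" := [set: aleph_below i] (at level 9, i at level 8).

Section Alephs.
Variable a : Ord.
Implicit Types i j k : a.

Lemma aleph_infinite i : [set: nat] #<= ℵ i.
Proof. by have [[inf _] _] := aleph_belowP i; apply/infiniteP. Qed.

Lemma aleph_lt i j : ord_lt i j -> card_lt (ℵ i) (ℵ j).
Proof. by have [[_ lt] _] := aleph_belowP j; move=> ij; exact: (lt (exist _ i ij)). Qed.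

Lemma aleph_le i j : i = j \/ ord_lt i j -> ℵ i #<= ℵ j.
Proof. by move=> [->|/aleph_lt[]//]. Qed.

Lemma aleph_least i (Z : Type) : [set: nat] #<= [set: Z] ->
  (forall j, ord_lt j i -> card_lt (ℵ j) [set: Z]) -> ℵ i #<= [set: Z].
Proof.
move=> Zinf lt; have [_ least] := aleph_belowP i; apply: least.
by split; [apply/infiniteP|move=> [j ji]; exact: lt].
Qed.

Lemma aleph_zero_le i (Z : Type) : ~ pos i -> [set: nat] #<= [set: Z] -> ℵ i #<= [set: Z].
Proof. by move=> ni Zinf; apply: aleph_least => // j ji; case: ni; exists j. Qed.

Lemma aleph_succ_le i j (Z : Type) (A : set Z) : is_succ i j -> ~ (A #<= ℵ i) -> ℵ j #<= A.
Proof.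
move=> [ij jmin] nle; have [iA _] := card_ltNge nle.
rewrite -(card_le_eqr (card_subtype A)); apply: aleph_least.
  by rewrite (card_le_eqr (card_subtype A)); apply: card_le_trans (aleph_infinite i) iA.
move=> k kj; apply: (@card_le_lt_trans _ _ _ _ (ℵ i)); first exact: aleph_le (jmin k kj).
by apply: card_ltNge; rewrite (card_le_eql (card_subtype A)).
Qed.

Lemma aleph_limit_le i (Z : Type) (A : set Z) : is_limit i ->
  (forall j, ord_lt j i -> ℵ j #<= A) -> ℵ i #<= A.
Proof.
move=> li leA; have [[j ji] _] := li.
rewrite -(card_le_eqr (card_subtype A)); apply: aleph_least.
  by rewrite (card_le_eqr (card_subtype A)); apply: card_le_trans (aleph_infinite j) (leA _ ji).
move=> {ji}j ji; have [k [jk _] ki] := is_limitP li ji.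
by apply: card_lt_le_trans (aleph_lt jk) _; rewrite (card_le_eqr (card_subtype A)); exact: leA.
Qed.

End Alephs.

Lemma aleph_Some (a : Ord) (i : a) : [set: @aleph_below (OrdS a) (Some i)] #= ℵ i.
Proof.
elim/(well_founded_ind (@ord_wf a)): i => i IH.
rewrite card_eq_le; apply/andP; split.
  apply: aleph_least => [|[j|] //= ji]; first exact: aleph_infinite.
  apply: card_le_lt_trans (aleph_lt ji).
  by rewrite (card_le_eql (IH j ji)).
apply: aleph_least => [|j ji]; first exact: aleph_infinite.
apply: (@card_le_lt_trans _ _ _ _ [set: @aleph_below (OrdS a) (Some j)]).
  by rewrite (card_le_eqr (IH j ji)).
by apply: aleph_lt.
Qed.

Section OrdSTheory.
Variable a : Ord.
Implicit Types i j : a.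

Lemma pos_Some i : @pos (OrdS a) (Some i) <-> pos i.
Proof. by split=> [[[j|] //= ji]|[j ji]]; [exists j|exists (Some j)]. Qed.

Lemma is_succ_Some i j : @is_succ (OrdS a) (Some i) (Some j) <-> is_succ i j.
Proof.
split=> -[/= ij jmin].
  by split=> // k kj; case: (jmin (Some k) kj) => [[->]|h]; [left|right].
by split=> //= -[k|] //= kj; case: (jmin k kj) => [->|h]; [left|right].
Qed.

Lemma is_limit_Some i : @is_limit (OrdS a) (Some i) <-> is_limit i.
Proof.
split=> -[/pos_Some pi ns]; split=> //.
  by move=> [j ji]; apply: ns; exists (Some j); apply/is_succ_Some.
by move=> [[j|] ji]; [apply: ns; exists j; apply/is_succ_Some|case: ji].
Qed.

Lemma is_succ_None : @is_succ (OrdS (OrdS a)) (Some None) None.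
Proof. by split=> //= -[[k|]|] //= _; [right|left]. Qed.

End OrdSTheory.

Lemma aleph_topE (a : Ord) : [set: @aleph_below (OrdS (OrdS a)) (Some None)] #= [set: aleph a].
Proof. exact: aleph_Some. Qed.

(** * Branches of trees of countable height *)

(** A pruned tree of height $\omega$ is given by its set of branches and the
    map [p n] sending a branch to its node at level [n]; distinct nodes of one
    level get distinct names in [L]. *)
Section OmegaTree.
Variables (Br L : Type) (p : nat -> Br -> L).
Hypothesis Linf : [set: nat] #<= [set: L].
Hypothesis p_mono : forall n x y, p n.+1 x = p n.+1 y -> p n x = p n y.
Hypothesis p_sep : forall x y, (forall n, p n x = p n y) -> x = y.
Hypothesis p_complete : forall b : nat -> Br,
  (forall n, p n (b n) = p n (b n.+1)) -> exists x, forall n, p n x = p n (b n).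

Lemma p_mono_le k n x y : k <= n -> p n x = p n y -> p k x = p k y.
Proof. by move=> /subnK <-; elim: (n - k) => // m IHm /p_mono. Qed.

(** A pair of a level [n] and a branch stands for the node at level [n] of that
    branch; a step leads to a node strictly above. *)
Section Walk.
Variables (A : Type) (step : nat * Br -> A -> nat * Br) (t0 : nat * Br).
Hypothesis stepP : forall t s,
  t.1 < (step t s).1 /\ p t.1 (step t s).2 = p t.1 t.2.

Fixpoint walk (f : nat -> A) n :=
  if n is m.+1 then step (walk f m) (f m) else t0.

(** A walk climbs at least one level at each step, so its nodes determine a
    branch. *)
Lemma walk_branch f :
  exists x, forall n, p (walk f n).1 x = p (walk f n).1 (walk f n).2.
Proof.
have le n : n <= (walk f n).1.
  by elim: n => // n IHn; apply: leq_ltn_trans IHn _; exact: (stepP _ _).1.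
have [|x xP] := p_complete (b := fun n => (walk f n).2).
  by move=> n; apply: (p_mono_le (le n)); rewrite /= (stepP _ _).2.
exists x => n; rewrite xP.
have : forall m, n <= m -> p (walk f n).1 (walk f m).2 = p (walk f n).1 (walk f n).2.
  move=> m /subnK <-; elim: (m - n) => // d <-; rewrite addSn /=.
  apply: p_mono_le (stepP _ _).2.
  by elim: d => // d IHd; apply: leq_trans IHd _; rewrite addSn /= ltnW //; exact: (stepP _ _).1.
by apply; exact: le.
Qed.

End Walk.

Section BigCones.
Variable x0 : Br.
Let cone (t : nat * Br) : set Br := [set y | p t.1 y = p t.1 t.2].
Hypothesis cone_big : forall t, ~ (cone t #<= [set: L]).

(** Each cone contains two branches, which separate at some level; choosing
    between them again and again embeds the binary tree. *)
Lemma cantor_card_le : [set: nat -> bool] #<= [set: Br].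
Proof.
have split_cone t : exists q : nat * (bool -> Br),
    [/\ t.1 < q.1, forall b, cone t (q.2 b) & p q.1 (q.2 true) <> p q.1 (q.2 false)].
  have [y ty ny] : exists2 y, cone t y & y <> t.2.
    apply: contrapT => none; apply: (cone_big (t := t)); apply: card_le_trans Linf.
    apply: (@card_le_inj _ _ _ _ (fun=> 0%N)) => // x x' tx tx' _.
    have eq z : cone t z -> z = t.2 by move=> tz; apply: contrapT => nz; apply: none; exists z.
    by rewrite (eq x tx) (eq x' tx').
  have [n neq] : exists n, p n y <> p n t.2.
    apply: contrapT => none; apply: ny; apply: p_sep => n.
    by apply: contrapT => h; apply: none; exists n.
  exists (n, fun b => if b then y else t.2); split=> //=; last by case.
  by rewrite ltnNge; apply/negP => le; apply: neq; exact: p_mono_le le ty.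
have /choice[q qP] := split_cone.
pose step t b := ((q t).1, (q t).2 b).
have stepP t b : t.1 < (step t b).1 /\ p t.1 (step t b).2 = p t.1 t.2.
  by have [lt c _] := qP t; split=> //; exact: c.
have /choice[B BP] := walk_branch (0, x0) stepP.
apply/card_leTT; exists B => f g fg.
have next n : walk step (0, x0) f n = walk step (0, x0) g n -> f n = g n.
  move=> e; have [_ _ ne] := qP (walk step (0, x0) g n).
  move: (BP f n.+1) (BP g n.+1); rewrite fg /= e => -> /=.
  by case: (f n) (g n) => -[] // E; case: ne.
have same n : walk step (0, x0) f n = walk step (0, x0) g n.
  by elim: n => //= n IHn; rewrite (next n IHn) IHn.
by apply: functional_extensionality_dep => n; apply: next; exact: same.
Qed.

(** The nodes above a given node are numbered by at least [N], so a sequence of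
    elements of [N] guides a walk. The branch thus followed and the levels
    of the steps determine the nodes visited, hence the sequence. *)
Lemma power_card_le : [set: nat -> L] #<= [set: Br].
Proof.
have Brinf : [set: nat] #<= [set: Br].
  apply: card_le_trans cantor_card_le; apply/card_leTT.
  exists (fun m n => n == m) => m m' e.
  by have := congr1 (@^~ m) e; rewrite eqxx => /esym /eqP.
pose above (t : nat * Br) : set (nat * L) :=
  [set q | t.1 < q.1 /\ exists2 y, cone t y & p q.1 y = q.2].
have [t0 t0min] := @ex_least_card _ (fun t => {q | above t q}) (0, x0).
pose N := {q | above t0 q}.
have hP t : exists h : N -> {q | above t q}, injective h by exact/card_leTT/t0min.
pose h t := sval (cid (hP t)).
have hinj t : injective (h t) := svalP (cid (hP t)).
have stepE t (s : N) : exists t' : nat * Br,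
    [/\ t.1 < t'.1, cone t t'.2 & sval (h t s) = (t'.1, p t'.1 t'.2)].
  case: (h t s) => -[k c] [/= lt [y ty yc]]; exists (k, y); split=> //=.
  by rewrite yc.
pose step t s := sval (cid (stepE t s)).
have stepP t s : t.1 < (step t s).1 /\ p t.1 (step t s).2 = p t.1 t.2.
  by rewrite /step; case: cid => t' /= [? ? _].
have step_inj t s s' : (step t s).1 = (step t s').1 ->
    p (step t s).1 (step t s).2 = p (step t s').1 (step t s').2 -> s = s'.
  rewrite /step; case: cid => t1 /= [_ _ E1]; case: cid => t2 /= [_ _ E2] e1 e2.
  by apply: (hinj t); apply: sval_inj; rewrite E1 E2 e2 e1.
have NL : [set: nat -> N] #<= [set: Br].
  have levels := card_le_trans card_le_nat_sequence cantor_card_le.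
  apply: card_le_trans (card_le_prodT Brinf levels (card_lexx _)).
  have /choice[B BP] := walk_branch t0 stepP.
  apply/card_leTT; exists (fun f => (fun n => (walk step t0 f n).1, B f)) => f g [k_fg B_fg].
  have lev n : (walk step t0 f n).1 = (walk step t0 g n).1 := congr1 (@^~ n) k_fg.
  have next n : walk step t0 f n = walk step t0 g n -> f n = g n.
    move=> e; have := lev n.+1; rewrite /= e => k; apply: step_inj (k) _.
    by move: (BP f n.+1) (BP g n.+1); rewrite B_fg /= e => <- <-; rewrite k.
  have same n : walk step t0 f n = walk step t0 g n.
    by elim: n => //= n IHn; rewrite (next n IHn) IHn.
  by apply: functional_extensionality_dep => n; apply: next; exact: same.
(* A branch of the cone of [t0] is a sequence of nodes above [t0]. *)
have LN : [set: L] #<= [set: nat -> N].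
  case: (card_le_total L (nat -> N)) => // le; case: (cone_big (t := t0)).
  apply: card_le_trans le.
  have lev y n : cone t0 y -> above t0 ((t0.1 + n).+1, p (t0.1 + n).+1 y).
    by move=> ty; split=> /=; [rewrite ltnS leq_addr|exists y].
  apply: (@card_le_rel _ _ _ _ (fun y u => forall n, (sval (u n)).2 = p (t0.1 + n).+1 y)).
    by move=> y ty; exists (fun n => exist _ _ (lev y n ty)).
  move=> y y' u ty ty' _ uy uy'; apply: p_sep => n.
  have [le'|lt] := leqP n t0.1.
    by apply: (p_mono_le le'); rewrite [LHS]ty [RHS]ty'.
  by have := uy' (n - t0.1.+1); rewrite uy -addSn subnKC.
apply: card_le_trans (card_le_sequence LN) (card_le_trans (card_le_sequence2 N) NL).
Qed.

End BigCones.
End OmegaTree.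

(** The branches through a cone with at most $|L|$ branches number at most $|L|$
    altogether, so they may be discarded; in what remains, let $\nu$ be the
    least number of nodes above a node. Walking up the tree, jumping at each step
    to one of $\nu$ nodes above the current one, codes a sequence in
    $\nu^\omega$ by a branch together with the levels of the jumps; as there are
    at least $2^{\aleph_0}$ branches, the levels cost nothing. Some cone injects
    into $\nu^\omega$, which is therefore more than $|L|$ and so at least
    $|L|^\omega$. *)
Lemma omega_tree_branches (Br L : Type) (p : nat -> Br -> L) :
  [set: nat] #<= [set: L] ->
  (forall n x y, p n.+1 x = p n.+1 y -> p n x = p n y) ->
  (forall x y, (forall n, p n x = p n y) -> x = y) ->
  (forall b : nat -> Br, (forall n, p n (b n) = p n (b n.+1)) ->
     exists x, forall n, p n x = p n (b n)) ->
  ~ ([set: Br] #<= [set: L]) -> [set: nat -> L] #<= [set: Br].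
Proof.
move=> Linf mono sep complete big.
pose cone (n : nat) (x : Br) : set Br := [set y | p n y = p n x].
pose good : set Br := [set x | forall n, ~ (cone n x #<= [set: L])].
have bad_small : ~` good #<= [set: L].
  have -> : ~` good = \bigcup_(q in [set q : nat * L | [set y | p q.1 y = q.2] #<= [set: L]])
                         [set y | p q.1 y = q.2].
    apply/seteqP; split=> [x ngx|x [[n c] /= le xc] gx].
      have [n le] : exists n, cone n x #<= [set: L].
        by apply: contrapT => none; apply: ngx => n le; apply: none; exists n.
      by exists (n, p n x).
    by apply: (gx n); rewrite /cone xc.
  apply: card_le_bigcup => //.
  exact: card_le_trans (card_leT _) (card_le_prodT Linf Linf (card_lexx _)).
have goodU (A : set Br) : A `&` good #<= [set: L] -> A #<= [set: L].
  move=> le; have -> : A = (A `&` good) `|` (A `&` ~` good) by rewrite -setIUr setUv setIT.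
  by apply: card_leU => //; apply: card_le_trans bad_small; apply: subset_card_le; exact: subIsetr.
have [x0 gx0] : good !=set0.
  apply: contrapT => none; apply: big; apply: goodU; rewrite setTI.
  apply: card_le_trans Linf; apply: (@card_le_inj _ _ _ _ (fun=> 0%N)) => // x x' gx.
  by case: none; exists x.
apply: (@card_le_trans _ _ _ [set: {x | good x}]); last first.
  by rewrite (card_le_eql (card_subtype good)); exact: card_leT.
apply: (@power_card_le _ _ (fun n x => p n (sval x)) Linf _ _ _ (exist _ x0 gx0)).
- by move=> n x y; exact: mono.
- by move=> x y xy; apply: sval_inj; exact: sep.
- move=> b bP; have [x xP] := complete (fun n => sval (b n)) bP.
  have gx : good x by move=> n; rewrite /cone xP; exact: (svalP (b n)).
  by exists (exist _ x gx).
- move=> [n [x gx]] /= le; apply: (gx n); apply: goodU.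
  apply: card_le_trans le.
  apply: (@card_le_rel _ _ _ _ (fun y z => y = sval z)) => [y [cy gy]|].
    by exists (exist _ y gy).
  by move=> y y' z _ _ _ -> ->.
Qed.

(** * Models: cardinality bounds and levels *)

Lemma surjection_graph_card_le (X : Type) (R : X -> X -> Prop) (A B : set X) :
  surjection_graph R A B -> B #<= A.
Proof.
move=> [RAB tot surj]; apply: (@card_le_rel _ _ _ _ (fun z y => R y z)).
  by move=> z /surj[y Ryz]; exists y => //; have [] := RAB _ _ Ryz.
by move=> z z' y _ _ Ay Rz Rz'; have [w [_ uw]] := tot y Ay; rewrite -(uw _ Rz) (uw _ Rz').
Qed.

Lemma ex_surjection_graph (X : Type) (A B : set X) :
  B !=set0 -> B #<= A -> exists R, surjection_graph R A B.
Proof.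
move=> [b Bb] BA; have [f [fA finj]] := card_le_fun b BA.
pose good y z := B z /\ f z = y.
exists (fun y z => A y /\ (good y z \/ (~ (exists z, good y z) /\ z = b))); split.
- by move=> y z [Ay [[Bz _]|[_ ->]]].
- move=> y Ay; have [[z gz]|none] := pselect (exists z, good y z).
    exists z; split=> [|w [_ [[Bw fw]|[none]]]]; first by split=> //; left.
      by case: gz => Bz fz; apply: finj => //; rewrite fw.
    by case: none; exists z.
  exists b; split=> [|w [_ [gw|[_ ->]]]] //; first by split=> //; right.
  by case: none; exists w.
- by move=> z Bz; exists (f z); split; [exact: fA|left].
Qed.

(** A set of size $|Y|$ in a linear order whose initial segments are smaller
    than $Y$ has no upper bound, so it covers the order by $|Y|$ initial
    segments. *)
Lemma linear_card_le (Y X : Type) (lt : X -> X -> Prop) (D : set X) :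
  [set: nat] #<= [set: Y] -> linear_on lt D ->
  (forall x, D x -> card_lt [set y | D y /\ (y = x \/ lt y x)] [set: Y]) ->
  D #<= [set: Y].
Proof.
move=> Yinf [irr tr tot] seg; case: (card_le_totalS D [set: Y]) => // YD.
have [[d0 Dd0]|D0] := pselect (exists d, D d); last first.
  by rewrite (_ : D = set0) ?card_ge0 //; apply/seteqP; split=> // d Dd; case: D0; exists d.
have [f [fD finj]] := card_le_fun d0 YD.
have [[d [Dd dP]]|cof] := pselect (exists d, D d /\ forall k, lt (f k) d).
  have [_ []] := seg d Dd.
  apply: (@card_le_inj _ _ _ _ f) => // k _; split; [exact: fD|by right].
have -> : D = \bigcup_(k in [set: Y]) [set y | D y /\ (y = f k \/ lt y (f k))].
  apply/seteqP; split=> [d Dd|d [k _ []] //].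
  apply: contrapT => none; apply: cof; exists d; split=> // k.
  case: (tot (f k) d (fD k I) Dd) => // h; case: none; exists k => //; split=> //; auto.
apply: card_le_bigcup => // k _; exact: (seg (f k) (fD k I)).1.
Qed.

Section ModelTheory.
Variables (al : Ord) (M : structure al).
Hypothesis psiM : psi M.
Implicit Types (a m x y z : M).

Local Notation Ltop := (@Ltop al M).
Local Notation lttop := (@lttop al M).

Lemma top_linear : linear_on lttop Ltop. Proof. by case: psiM => -[]. Qed.
Lemma top_irr a : Ltop a -> ~ lttop a a. Proof. by case: top_linear => irr _ _; exact: irr. Qed.
Lemma top_trans a b c : Ltop a -> Ltop b -> Ltop c -> lttop a b -> lttop b c -> lttop a c.
Proof. by case: top_linear => _ tr _; exact: tr. Qed.
Lemma top_total a b : Ltop a -> Ltop b -> [\/ lttop a b, a = b | lttop b a].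
Proof. by case: top_linear => _ _; exact. Qed.
Lemma top_zero : Ltop (zero_ M). Proof. by case: psiM => -[_ []]. Qed.
Lemma top_zero_min a : Ltop a -> a = zero_ M \/ lttop (zero_ M) a.
Proof. by case: psiM => -[_ [_ h] _ _ _] _ _ _ _; exact: h. Qed.
Lemma top_asym a b : Ltop a -> Ltop b -> lttop a b -> ~ lttop b a.
Proof. by move=> La Lb ab ba; apply: (top_irr La); exact: top_trans ba. Qed.

Lemma nonmax_succ a : Ltop a -> ~ is_max a -> exists b, succ_of a b.
Proof. by case: psiM => -[_ _ h _ _] _ _ _ _; exact: h. Qed.

Lemma succE a b : S_ M a b <-> succ_of a b.
Proof. by case: psiM => -[_ _ _ h _] _ _ _ _; exact: h. Qed.

Lemma max_not_succ m : is_max m -> ~ exists a, S_ M a m.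
Proof. by case: psiM => -[_ _ _ _ h] _ _ _ _; exact: h. Qed.

Lemma max_unique m m' : is_max m -> is_max m' -> m = m'.
Proof.
move=> [Lm mm] [Lm' mm']; case: (mm m' Lm') => // h; case: (mm' m Lm) => // h'.
by case: (top_asym Lm Lm' h').
Qed.

Lemma below_nonmax a b : Ltop a -> Ltop b -> lttop a b -> ~ is_max a.
Proof.
move=> La Lb ab [_ amax]; case: (amax b Lb) => [e|]; last exact: top_asym.
by apply: (top_irr La); rewrite -{2}e.
Qed.

Lemma nonmax_lt a m : is_max m -> Ltop a -> a <> m -> lttop a m.
Proof. by move=> [_ mmax] La am; case: (mmax a La). Qed.

Lemma lt_max_ex a m : is_max m -> Ltop a -> a <> m -> exists b, [/\ Ltop b, b <> m & lttop a b].
Proof.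
move=> mm La am; have [|b sab] := @nonmax_succ a La.
  by move=> amax; apply: am; exact: max_unique.
exists b; have [_ Lb ab _] := sab; split=> // bm; subst b.
by apply: (max_not_succ mm); exists a; apply/succE.
Qed.

Lemma node_level a b x : Ltop a -> Ltop b -> V_ M a x -> V_ M b x -> a = b.
Proof.
case: psiM => _ [_ dis _] _ _ _ La Lb ax bx; apply: contrapT => ab.
have : (V_ M a `&` V_ M b) x by [].
by rewrite dis.
Qed.

Lemma T_trans x y z : T_ M x y -> T_ M y z -> T_ M x z.
Proof. by case: psiM => _ _ [[tr _] _ _ _ _] _ _; exact: tr. Qed.

Lemma T_chain z : chain (T_ M) [set x | T_ M x z].
Proof. by case: psiM => _ _ [[_ ch] _ _ _ _] _ _; exact: ch. Qed.

Lemma T_level x y : T_ M x y ->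
  exists a b, [/\ Ltop a, Ltop b, V_ M a x, V_ M b y & lttop a b].
Proof. by case: psiM => _ _ [_ lev _ _ _] _ _; exact: lev. Qed.

Lemma T_lt a b x y : Ltop a -> Ltop b -> V_ M a x -> V_ M b y -> T_ M x y -> lttop a b.
Proof.
move=> La Lb ax by_ /T_level[a' [b' [La' Lb' a'x b'y]]].
by rewrite (node_level La' La a'x ax) (node_level Lb' Lb b'y by_).
Qed.

Lemma T_pred a b y : Ltop a -> Ltop b -> V_ M a y -> lttop b a ->
  exists2 x, V_ M b x & T_ M x y.
Proof. by case: psiM => _ _ [_ _ pr _ _] _ _; exact: pr. Qed.

Lemma T_pred_unique a x y z : Ltop a -> V_ M a x -> V_ M a y -> T_ M x z -> T_ M y z -> x = y.
Proof.
move=> La ax ay xz yz; case: (T_chain xz yz) => // h.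
  by case: (top_irr La); exact: T_lt h.
by case: (top_irr La); exact: T_lt h.
Qed.

Lemma T_below a b x y z : Ltop a -> Ltop b -> V_ M a x -> V_ M b y -> lttop a b ->
  T_ M x z -> T_ M y z -> T_ M x y.
Proof.
move=> La Lb ax by_ ab xz yz; case: (T_chain xz yz) => // [e|yx].
  by case: (top_irr La); rewrite -{2}(node_level Lb La by_ _) // -e.
by case: (top_asym La Lb ab); exact: T_lt yx.
Qed.

Lemma T_separated a y z : Ltop a -> a <> zero_ M -> (~ exists b, S_ M b a) ->
  V_ M a y -> V_ M a z -> (forall x, T_ M x y <-> T_ M x z) -> y = z.
Proof. by case: psiM => _ _ [_ _ _ sep _] _ _ La a0 ns; exact: sep. Qed.

Lemma max_no_T m x y : is_max m -> V_ M m x -> ~ T_ M x y.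
Proof.
move=> mmax mx xy; have [a [c [La Lc ax cy ac]]] := T_level xy.
apply: (below_nonmax La Lc ac).
by rewrite (node_level La mmax.1 ax mx).
Qed.

Lemma max_node_above (m : M) a x : is_max m -> Ltop a -> a <> m -> V_ M a x ->
  exists2 v, V_ M m v & T_ M x v.
Proof.
move=> mmax La am ax; case: psiM => _ _ [_ _ _ _ pruned] _ _.
have [|B [[Bn Bch _] Bmeet] Bx] := pruned x; first by exists a.
have [v [Bv mv]] := Bmeet m mmax.1; exists v => //.
case: (Bch x v Bx Bv) => // [E|vx]; last by case: (max_no_T mmax mv vx).
by subst x; case: am; exact: (node_level La mmax.1 ax mv).
Qed.

Lemma node_not_L a b x : Ltop a -> V_ M a x -> ~ L_ M b x.
Proof.
case: psiM => _ [dis _ _] _ _ _ La ax bx.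
by have : (V_ M a `&` L_ M b) x by []; rewrite dis.
Qed.

Lemma L_zero b x : ~ pos b -> L_ M b x <-> exists n, x = c_ M n.
Proof. by case: psiM => _ _ _ [_ h] _ nb; exact: h. Qed.

Lemma L_limit b : is_limit b -> L_ M b = \bigcup_(c in below b) L_ M c.
Proof. by case: psiM => _ _ _ _ [[_ h] _ _]; exact: h. Qed.

Lemma L_linear (b : {b : idx al | pos b}) : linear_on (lt_ M b) (L_ M (sval b)).
Proof.
case: psiM => _ _ _ _ [[h _] _ _]; have [e|ne] := pselect (sval b = top al); last exact: h.
case: b e => b pb /= e; subst b; rewrite (_ : pb = pos_top al) //; first exact: top_linear.
Qed.

Lemma F_surj (b c : OrdS al) (pc : pos (Some c : idx al)) x : is_succ b c ->
  L_ M (Some c) x ->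
  surjection_graph (F_ M b x) (L_ M (Some b))
    [set y | L_ M (Some c) y /\ (y = x \/ lt_ M (exist _ _ pc) y x)].
Proof.
case: b => [b|] bc Lx; last by case: bc.
case: psiM => _ _ _ _ [_ h _].
by apply: (h b (exist _ _ pc)) => //=; apply/is_succ_Some.
Qed.

Lemma Ftop_surj x : Ltop x -> ~ is_max x ->
  surjection_graph (F_ M None x) (L_ M (Some None)) [set y | Ltop y /\ (y = x \/ lttop y x)].
Proof. by case: psiM => _ _ _ _ [_ _ h] Lx nx; have [] := h x Lx nx. Qed.

Lemma G_surj x : Ltop x -> ~ is_max x ->
  surjection_graph (G_ M x) (L_ M (Some None)) (V_ M x).
Proof. by case: psiM => _ _ _ _ [_ _ h] Lx nx; have [] := h x Lx nx. Qed.

Lemma nonmax_node_ex a : Ltop a -> ~ is_max a -> exists v, V_ M a v.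
Proof.
move=> La na; have [_ Gtot _] := G_surj La na.
have [FL _ Fsurj] := Ftop_surj La na.
have [y Fy] := Fsurj a (conj La (or_introl erefl)); have [Ly _] := FL _ _ Fy.
have [v [Gv _]] := Gtot y Ly; exists v.
by have [h _ _] := G_surj La na; have [] := h _ _ Gv.
Qed.

Hypothesis al_countable : countable [set: al].

Lemma idx_countable : countable [set: idx al].
Proof. by rewrite /countable; do 2! apply: card_le_optionT => //; exact: card_lexx. Qed.

Lemma L_card_le (b : OrdS al) : L_ M (Some b) #<= ℵ (Some b : idx al).
Proof.
elim/(well_founded_ind (@ord_wf (OrdS al))): b => b IH.
have inf := aleph_infinite (Some b : idx al).
case: (ord_zero_succ_limit b) => [nb|[c cb]|lb].
- have nb' : ~ pos (Some b : idx al) by move/pos_Some.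
  apply: card_le_trans inf; apply: (@card_le_surj _ _ _ _ (c_ M)) => x.
  by move=> /(L_zero x nb')[n ->]; exists n.
- have pb : pos (Some b : idx al) by exists (Some c); exact: cb.1.
  apply: (linear_card_le inf (L_linear (exist _ _ pb))) => x Lx.
  apply: (card_le_lt_trans (B := ℵ (Some c : idx al))); last first.
    by apply: aleph_lt; exact: cb.1.
  apply: card_le_trans (IH c cb.1).
  exact: surjection_graph_card_le (F_surj pb cb Lx).
- rewrite L_limit; last exact/is_limit_Some.
  apply: card_le_bigcup => //.
    by apply: card_le_trans (card_leT _) _; apply: card_le_trans idx_countable inf.
  move=> [c|] //= cb; apply: card_le_trans (IH c cb) _.
  by apply: (aleph_lt (i := Some c : idx al) _).1.
Qed.

Lemma Lal_card_le : L_ M (Some None) #<= ℵ (Some None : idx al).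
Proof. exact: L_card_le. Qed.

Lemma V_card_le a : Ltop a -> ~ is_max a -> V_ M a #<= ℵ (Some None : idx al).
Proof.
move=> La na.
exact: card_le_trans (surjection_graph_card_le (G_surj La na)) Lal_card_le.
Qed.

Lemma seg_card_le a : Ltop a -> ~ is_max a ->
  [set y | Ltop y /\ (y = a \/ lttop y a)] #<= ℵ (Some None : idx al).
Proof.
move=> La na.
exact: card_le_trans (surjection_graph_card_le (Ftop_surj La na)) Lal_card_le.
Qed.

Lemma nonmax_card_le : [set a | Ltop a /\ ~ is_max a] #<= ℵ (None : idx al).
Proof.
apply: (linear_card_le (lt := lttop)); first exact: aleph_infinite.
  split=> [x [Lx _]|x y z [Lx _] [Ly _] [Lz _]|x y [Lx _] [Ly _]].
  - exact: top_irr.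
  - exact: top_trans.
  - exact: top_total.
move=> x [Lx nx]; apply: card_le_lt_trans (aleph_lt (is_succ_None al).1).
apply: card_le_trans (seg_card_le Lx nx).
by apply: subset_card_le => y [[Ly _] h].
Qed.

(** The height, the levels below the maximum and the sets $L_\beta$ are small:
    only the top level can push the size of a model beyond
    $\aleph_{\alpha+1}$. *)
Lemma model_card_le (Y : Type) (m : M) : is_max m ->
  ℵ (None : idx al) #<= [set: Y] -> V_ M m #<= [set: Y] ->
  [set: M] #<= [set: Y].
Proof.
move=> mm topY VY.
have natY := card_le_trans (aleph_infinite _) topY.
have alY : ℵ (Some None : idx al) #<= [set: Y].
  exact: card_le_trans (aleph_lt (is_succ_None al).1).1 topY.
have nonmaxE a : Ltop a -> a <> m -> ~ is_max a.
  by move=> La am amax; apply: am; exact: max_unique.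
have topl : Ltop #<= [set: Y].
  have -> : Ltop = [set a | Ltop a /\ ~ is_max a] `|` [set m].
    apply/seteqP; split=> [a La|a [[] //|->]]; last by case: mm.
    have [e|am] := pselect (a = m); [by right|left; split=> //; exact: nonmaxE].
  apply: card_leU => //; first exact: card_le_trans nonmax_card_le topY.
  exact: card_le_trans (countable1 m) natY.
have -> : [set: M] = \bigcup_(b in [set: idx al]) L_ M b `|` \bigcup_(a in Ltop) V_ M a.
  apply/seteqP; split=> // x _; case: psiM => _ [_ _ /(_ x)[[b bx]|[a La ax]]] _ _ _.
    by left; exists b.
  by right; exists a.
apply: card_leU => //; apply: card_le_bigcup => //.
- exact: card_le_trans idx_countable natY.
- case=> [b|] _ //; apply: card_le_trans (L_card_le b) _.
  by apply: card_le_trans topY; apply: (aleph_lt (j := None : idx al) _).1.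
- move=> a La; have [->//|am] := pselect (a = m).
  exact: card_le_trans (V_card_le La (nonmaxE a La am)) alY.
Qed.

End ModelTheory.

(** * A criterion for maximality *)

(** A branch through the levels other than [m]; the empty set is one when [m] is
    the only level. *)
Definition branch_below (al : Ord) (M : structure al) (m : M) (B : set M) : Prop :=
  [/\ forall x, B x -> exists a, [/\ Ltop a, a <> m & V_ M a x],
      chain (T_ M) B
    & forall a, Ltop a -> a <> m -> B `&` V_ M a !=set0].

Definition complete_at (al : Ord) (M : structure al) (m : M) : Prop :=
  forall B, branch_below m B -> exists2 v, V_ M m v & forall x, T_ M x v <-> B x.

Lemma surjection_graph_range (X Y : Type) (e : X -> Y)
    (R : X -> X -> Prop) (A B : set X) (R' : Y -> Y -> Prop) (A' B' : set Y) :
  surjection_graph R A B -> surjection_graph R' A' B' ->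
  (forall x y, R x y <-> R' (e x) (e y)) ->
  (forall y, A' y -> exists2 x, A x & e x = y) ->
  forall z, B' z -> exists x, e x = z.
Proof.
move=> [_ tot _] [R'AB tot' surj'] RR' A'A z /surj'[y R'yz].
have [A'y _] := R'AB _ _ R'yz; have [x Ax xy] := A'A y A'y.
have [w [Rxw _]] := tot x Ax; exists w.
have [w' [_ uw]] := tot' y A'y; rewrite -(uw z R'yz) -(uw (e w)) //.
by rewrite -xy; apply/RR'.
Qed.

Section Criterion.
Variables (al : Ord) (al_countable : countable [set: al]).
Variables (M : structure al) (m : M).
Hypothesis psiM : psi M.
Hypothesis L_big : forall b : OrdS al,
  ℵ (Some b : idx al) #<= L_ M (Some b).
Hypothesis m_max : is_max m.
Hypothesis m_nonzero : m <> zero_ M.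
Hypothesis V_big : ~ (V_ M m #<= ℵ (Some None : idx al)).
Hypothesis m_complete : complete_at m.

Variables (N : structure al) (e : M -> N).
Hypothesis psiN : psi N.
Hypothesis e_emb : embedding e.

Lemma emb_inj : injective e. Proof. by case: e_emb. Qed.
Lemma emb_zero : e (zero_ M) = zero_ N. Proof. by case: e_emb => _ []. Qed.
Lemma emb_c n : e (c_ M n) = c_ N n. Proof. by case: e_emb => _ []. Qed.
Lemma emb_L b x : L_ M b x <-> L_ N b (e x). Proof. by case: e_emb => _ []. Qed.
Lemma emb_lt b x y : lt_ M b x y <-> lt_ N b (e x) (e y).
Proof. by case: e_emb => _ []. Qed.
Lemma emb_Ltop x : Ltop x <-> Ltop (e x). Proof. exact: emb_L. Qed.
Lemma emb_lttop x y : lttop x y <-> lttop (e x) (e y). Proof. exact: emb_lt. Qed.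
Lemma emb_V x y : V_ M x y <-> V_ N (e x) (e y). Proof. by case: e_emb => _ [_ _ _ _ []]. Qed.
Lemma emb_T x y : T_ M x y <-> T_ N (e x) (e y). Proof. by case: e_emb => _ [_ _ _ _ []]. Qed.
Lemma emb_F b x y z : F_ M b x y z <-> F_ N b (e x) (e y) (e z).
Proof. by case: e_emb => _ [_ _ _ _ []]. Qed.
Lemma emb_G x y z : G_ M x y z <-> G_ N (e x) (e y) (e z).
Proof. by case: e_emb => _ [_ _ _ _ []]. Qed.

(** New elements of $L_{\beta+1}$ cannot lie below an old one, whose initial
    segment is already enumerated; nor can they lie above all of
    $L_{\beta+1}$, which is too large to be an initial segment. *)
Lemma emb_onto_L (b : OrdS al) y : L_ N (Some b) y -> exists2 x, L_ M (Some b) x & e x = y.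
Proof.
elim/(well_founded_ind (@ord_wf (OrdS al))): b y => b IH y Ly.
suff [x xy] : exists x, e x = y by exists x => //; apply/emb_L; rewrite xy.
case: (ord_zero_succ_limit b) => [nb|[c cb]|lb].
- have nb' : ~ pos (Some b : idx al) by move/pos_Some.
  by move: Ly => /(L_zero psiN y nb')[n ->]; exists (c_ M n); rewrite emb_c.
- have pb : pos (Some b : idx al) by exists (Some c); exact: cb.1.
  have [[x Lx yx]|none] := pselect (exists2 x, L_ M (Some b) x &
      y = e x \/ lt_ N (exist _ _ pb) y (e x)).
    apply: (surjection_graph_range (F_surj psiM pb cb Lx)
             (F_surj psiN pb cb ((emb_L _ _).1 Lx)) (emb_F c x) (IH c cb.1)).
    by split.
  have [_ []] := @aleph_lt (idx al) (Some c) (Some b) cb.1.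
  apply: card_le_trans (L_big b) _; apply: card_le_trans (L_card_le psiN al_countable c).
  apply: card_le_trans (surjection_graph_card_le (F_surj psiN pb cb Ly)).
  apply: (@card_le_inj _ _ _ _ e) => [x Lx|x x' _ _ /emb_inj //].
  have Lex := (emb_L _ _).1 Lx; split=> //.
  have [_ _ tot] := L_linear psiN (exist _ _ pb).
  case: (tot y (e x) Ly Lex) => [h|h|h]; [by case: none; exists x; auto|by left|by right].
- move: Ly; rewrite (L_limit psiN) ?is_limit_Some // => -[[c|] //= cb Lc].
  by have [x _ xy] := IH c cb y Lc; exists x.
Qed.

Lemma Ltop_m : Ltop m. Proof. by case: m_max. Qed.

(** An element of $N$ above all levels of the tree of $M$ other than $m$ would be
    a level with too many nodes: branches below $m$ already differ there. *)
Lemma emb_onto_top y : Ltop y -> exists2 x, Ltop x & e x = y.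
Proof.
move=> Ly; suff [x xy] : exists x, e x = y by exists x => //; apply/emb_Ltop; rewrite xy.
have Lm := Ltop_m; have Lem := (emb_Ltop _).1 Lm.
have [[a [La am ya]]|none] := pselect (exists a, [/\ Ltop a, a <> m &
      y = e a \/ lttop y (e a)]).
  have Lea := (emb_Ltop _).1 La.
  have eam := (emb_lttop _ _).1 (nonmax_lt m_max La am).
  have na := below_nonmax psiM La Lm (nonmax_lt m_max La am).
  apply: (surjection_graph_range (Ftop_surj psiM La na)
           (Ftop_surj psiN Lea (below_nonmax psiN Lea Lem eam)) (emb_F None a) (@emb_onto_L None)).
  by split.
have above a : Ltop a -> a <> m -> lttop (e a) y.
  move=> La am; case: (top_total psiN ((emb_Ltop _).1 La) Ly) => // h;
    by case: none; exists a; split=> //; auto.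
case: (top_total psiN Ly Lem) => [ym|->|my]; [exfalso|by exists m|exfalso]; apply: V_big.
  apply: card_le_trans (V_card_le psiN al_countable Ly (below_nonmax psiN Ly Lem ym)).
  apply: (@card_le_rel _ _ _ _ (fun v u => T_ N u (e v))).
    move=> v mv; have [u yu uv] := T_pred psiN Lem Ly ((emb_V _ _).1 mv) ym.
    by exists u.
  have preds v v' u : V_ M m v -> V_ N y u -> T_ N u (e v) -> T_ N u (e v') ->
      forall x, T_ M x v -> T_ M x v'.
    move=> mv yu uv uv' x xv; have [a [b [La Lb ax bv ab]]] := T_level psiM xv.
    have bm := node_level psiM Lb Lm bv mv; subst b.
    have am : a <> m by move=> E; subst a; exact: (top_irr psiM Lm).
    apply/emb_T; apply: (T_trans psiN) uv'.
    apply: (T_below psiN ((emb_Ltop _).1 La) Ly ((emb_V _ _).1 ax) yu (above a La am) _ uv).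
    exact/emb_T.
  move=> v v' u mv mv' yu uv uv'.
  apply: (T_separated psiM Lm m_nonzero (max_not_succ psiM m_max) mv mv').
  by move=> x; split; [exact: preds uv uv' x|exact: preds uv' uv x].
apply: card_le_trans (V_card_le psiN al_countable Lem (below_nonmax psiN Lem Ly my)).
by apply: (@card_le_inj _ _ _ _ e) => [v /emb_V|v v' _ _ /emb_inj].
Qed.

Lemma emb_max : is_max (e m).
Proof.
split=> [|y /emb_onto_top[x Lx <-]]; first by apply/emb_Ltop; case: m_max.
by case: m_max => _ /(_ x Lx)[->|h]; [left|right; apply/emb_lttop].
Qed.

(** A new node of level [m] has the predecessors of an old one, because these form
    a branch of the tree of [M]; and a limit level has no two such nodes. *)
Lemma emb_onto_node a y : Ltop a -> V_ N (e a) y -> exists x, e x = y.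
Proof.
move=> La ay; have Lm := Ltop_m.
have lower b z : Ltop b -> b <> m -> V_ N (e b) z -> exists x, e x = z.
  move=> Lb bm; have bltm := nonmax_lt m_max Lb bm.
  apply: (surjection_graph_range (G_surj psiM Lb (below_nonmax psiM Lb Lm bltm))
    (G_surj psiN ((emb_Ltop _).1 Lb) _) (emb_G b) (@emb_onto_L None)).
  by apply: (below_nonmax psiN _ ((emb_Ltop m).1 Lm)); [exact/emb_Ltop|exact/emb_lttop].
have [E|am] := pselect (a = m); last exact: lower ay.
subst a; have Lem := (emb_Ltop m).1 Lm.
have [|v mv vP] := m_complete (B := [set x | T_ N (e x) y]).
  split=> [x xy|x x' xy x'y|b Lb bm].
  - have [b [c [/emb_onto_top[b' Lb' <-] Lc bx cy bc]]] := T_level psiN xy.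
    have cm := node_level psiN Lc Lem cy ay; subst c.
    exists b'; split=> //; last exact/emb_V.
    by move=> E; subst b'; exact: (top_irr psiN Lem).
  - case: (T_chain psiN xy x'y) => [/emb_T h|/emb_inj h|/emb_T h].
    + exact: Or31.
    + exact: Or32.
    + exact: Or33.
  - have [||z bz zy] := T_pred psiN Lem _ ay (b := e b); first exact/emb_Ltop.
      by apply/emb_lttop; exact: nonmax_lt.
    have [x xz] := lower _ _ Lb bm bz; subst z.
    by exists x; split=> //; apply/emb_V.
exists v; apply: (T_separated psiN Lem _ (max_not_succ psiN emb_max) ((emb_V _ _).1 mv) ay).
  by rewrite -emb_zero => /emb_inj.
have half w z : V_ N (e m) w -> T_ N z w -> exists x, e x = z.
  move=> mw zw; have [b [c [/emb_onto_top[b' Lb' <-] Lc bz cw bc]]] := T_level psiN zw.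
  have cm := node_level psiN Lc Lem cw mw; subst c.
  apply: (lower b') => //.
  by move=> E; subst b'; exact: (top_irr psiN Lem).
move=> z; split=> zv.
  have [x xz] := half _ _ ((emb_V _ _).1 mv) zv; subst z.
  by apply/(vP x)/emb_T.
have [x xz] := half _ _ ay zv; subst z.
by apply/emb_T/vP.
Qed.

Lemma emb_onto y : exists x, e x = y.
Proof.
case: psiN => _ [_ _ /(_ y)[[[b|] Ly]|[a /emb_onto_top[x Lx <-] ay]]] _ _ _.
- by have [x _ xy] := emb_onto_L Ly; exists x.
- by have [x _ xy] := emb_onto_top Ly; exists x.
- exact: emb_onto_node ay.
Qed.

End Criterion.

Lemma complete_maximal (al : Ord) (M : structure al) (m : M) :
  countable [set: al] -> psi M ->
  (forall b : OrdS al, ℵ (Some b : idx al) #<= L_ M (Some b)) ->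
  is_max m -> m <> zero_ M ->
  ~ (V_ M m #<= ℵ (Some None : idx al)) ->
  complete_at m -> maximal_model M.
Proof.
move=> alc psiM Lbig mm m0 Vbig mc; split=> // N e psiN emb y.
exact: (emb_onto alc psiM Lbig mm m0 Vbig mc psiN emb).
Qed.

(** * Models with prescribed branches *)

Lemma card_eq_nat_enum (X : Type) (A : set X) : A #= [set: nat] ->
  exists2 c : nat -> X, injective c & forall x, A x <-> exists n, x = c n.
Proof.
rewrite card_eq_sym => /card_bijP[f [g fK gK]].
pose n_ (n : nat) : [set: nat] := exist _ n (mem_set I).
exists (fun n => val (f (n_ n))).
  by move=> m n /val_inj /(can_inj fK) [].
move=> x; split=> [Ax|[n ->]]; last exact/set_mem/(valP (f _)).
exists (val (g (exist _ x (mem_set Ax)))).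
have -> : n_ (val (g (exist _ x (mem_set Ax)))) = g (exist _ x (mem_set Ax)) by apply: val_inj.
by rewrite gK.
Qed.

(** When there is a top level, prunedness only requires that every node lie
    below some node of the top level, whose predecessors form a branch. *)
Lemma psi_c_of_max (al : Ord) (M : structure al) (m : M) :
  linear_on (@lttop al M) (@Ltop al M) ->
  (forall (a b x : M), Ltop a -> Ltop b -> V_ M a x -> V_ M b x -> a = b) ->
  is_max m ->
  (forall x y z, T_ M x y -> T_ M y z -> T_ M x z) ->
  (forall x y, T_ M x y -> exists a b, [/\ Ltop a, Ltop b, V_ M a x, V_ M b y & lttop a b]) ->
  (forall a b y, Ltop a -> Ltop b -> V_ M a y -> lttop b a -> exists2 x, V_ M b x & T_ M x y) ->
  (forall a x y z, Ltop a -> V_ M a x -> V_ M a y -> T_ M x z -> T_ M y z -> x = y) ->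
  (forall a, Ltop a -> a <> zero_ M -> (~ exists b, S_ M b a) ->
     forall y z, V_ M a y -> V_ M a z -> (forall x, T_ M x y <-> T_ M x z) -> y = z) ->
  (forall a x, Ltop a -> a <> m -> V_ M a x -> exists2 v, V_ M m v & T_ M x v) ->
  psi_c M.
Proof.
move=> [irr tr tot] lev [Lm mmax] Ttr Tlev Tpred Tuniq Tsep Tup.
have lower a b x y z : Ltop a -> Ltop b -> V_ M a x -> V_ M b y -> T_ M x z -> T_ M y z ->
    lttop a b -> T_ M x y.
  move=> La Lb ax bY xz yz ab; have [x' ax' x'y] := Tpred b a y Lb La bY ab.
  by rewrite (Tuniq a x x' z La ax ax' xz (Ttr _ _ _ x'y yz)).
have ch z : chain (T_ M) [set x | T_ M x z].
  move=> x y xz yz; have [a [_ [La _ ax _ _]]] := Tlev _ _ xz.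
  have [b [_ [Lb _ bY _ _]]] := Tlev _ _ yz.
  case: (tot a b La Lb) => [ab|E|ba].
  - by apply: Or31; exact: (lower a b x y z).
  - by subst b; apply: Or32; exact: (Tuniq a x y z).
  - by apply: Or33; exact: (lower b a y x z).
have lt_m v y : V_ M m v -> ~ T_ M v y.
  move=> mv vy; have [a [b [La Lb av bY ab]]] := Tlev _ _ vy.
  have E := lev _ _ _ La Lm av mv; subst a.
  case: (mmax b Lb) => [E|bm]; first by subst b; exact: irr ab.
  by apply: (irr m) => //; exact: tr bm.
split=> // x [a La ax].
have [v mv xv] : exists2 v, V_ M m v & x = v \/ T_ M x v.
  have [E|am] := pselect (a = m); first by subst a; exists x => //; left.
  by have [v mv xv] := Tup a x La am ax; exists v => //; right.
exists [set y | y = v \/ T_ M y v] => //; split; last first.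
  move=> b Lb; have [E|bm] := pselect (b = m); first by subst b; exists v; split=> //; left.
  have [|y bY yv] := Tpred m b v Lm Lb mv; first by case: (mmax b Lb).
  by exists y; split=> //; right.
split.
- move=> y [->|yv]; first by exists m.
  by have [b [_ [Lb _ bY _ _]]] := Tlev _ _ yv; exists b.
- move=> y z [->|yv] [->|zv]; [exact: Or32|exact: Or33|exact: Or31|exact: ch yv zv].
- move=> C Cn Cch BC; apply/seteqP; split=> // y Cy.
  by case: (Cch y v Cy (BC v (or_introl erefl))) => [h|h|/lt_m]; [right|left|].
Qed.

Section InitialPieces.
Variables (al W : Ord).
Hypothesis W_card : [set: W] #= ℵ (Some None : idx al).

(** When [W] is the initial ordinal of size $\aleph_\alpha$, this is its initial
    segment of type $\omega_\beta$. The segments increase with $\beta$ and are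
    continuous at limits, so they can serve as the sets $L_\beta$, all
    ordered as in [W]. *)
Definition piece (b : OrdS al) : set W :=
  [set w | card_lt (below w) ℵ (Some b : idx al)].

Lemma piece_down b w w' : piece b w -> ord_lt w' w -> piece b w'.
Proof.
move=> bw w'w; apply: card_le_lt_trans bw; apply: subset_card_le => z zw'.
exact: ord_trans w'w.
Qed.

Lemma piece_big b : ℵ (Some b : idx al) #<= piece b.
Proof.
have [[w0 nw0]|all] := pselect (exists w, ~ piece b w).
  have [w nw wmin] := @ord_least W (fun w => ~ piece b w) (ex_intro _ w0 nw0).
  have sub : below w `<=` piece b.
    move=> v vw; apply: contrapT => nv; case: (wmin v nv) => [E|wv].
      by apply: (@ord_irr W v); rewrite {2}E.
    by apply: (@ord_irr W v); exact: ord_trans wv.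
  apply: card_le_trans (subset_card_le sub).
  by apply: contrapT => nle; apply: nw; exact: card_ltNge.
have -> : piece b = setT.
  by apply/seteqP; split=> // w _; apply: contrapT => nw; apply: all; exists w.
rewrite (card_le_eqr W_card); apply: aleph_le.
by case: b {all} => [b|]; [right|left].
Qed.

Lemma piece_seg b c w : is_succ b c -> piece c w ->
  [set v | v = w \/ ord_lt v w] #<= piece b.
Proof.
move=> bc cw; apply: card_le_trans (piece_big b).
have inf := @aleph_infinite (idx al) (Some b).
have -> : [set v | v = w \/ ord_lt v w] = [set w] `|` below w.
  by apply/seteqP; split=> v [->|h]; [left|right|left|right].
apply: card_leU => //; first exact: card_le_trans (countable1 w) inf.
apply: contrapT => nle; have [_ []] := cw.
by apply: (aleph_succ_le (i := Some b : idx al)) => //; exact/is_succ_Some.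
Qed.

Lemma piece_limit b : is_limit b -> piece b = \bigcup_(c in below b) piece c.
Proof.
move=> lb; apply/seteqP; split=> [w bw|w [c cb cw]]; last first.
  by apply: card_lt_le_trans cw _; apply: (@aleph_lt (idx al) (Some c) (Some b) _).1.
have [c cb nle] : exists2 c, ord_lt c b & ~ (ℵ (Some c : idx al) #<= below w).
  apply: contrapT => none; have [_ []] := bw.
  apply: (@aleph_limit_le (idx al)); first exact/is_limit_Some.
  move=> [c|] //= cb; apply: contrapT => nle; apply: none; by exists c.
by exists c => //; exact: card_ltNge.
Qed.

Lemma piece_zero b : ~ pos b -> piece b #= [set: nat].
Proof.
move=> nb; have nb' : ~ pos (Some b : idx al) by move/pos_Some.
have [le ge] : piece b #<= [set: nat] /\ [set: nat] #<= piece b; last first.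
  by rewrite card_eq_le le ge.
split; last exact: card_le_trans (aleph_infinite _) (piece_big b).
have [[irr tr tot] _] := ord_wo W.
apply: (@linear_card_le _ _ (@ord_lt W)); first exact: card_lexx.
  by split=> [x _|x y z _ _ _|x y _ _]; [exact: irr|exact: tr|exact: tot].
move=> w bw; apply: card_ltNge => /infiniteP; apply.
have : finite_set ([set w] `|` below w).
  rewrite finite_setU; split; first exact: finite_set1.
  apply/finite_setPn => le; have [_ []] := bw.
  exact: card_le_trans (aleph_zero_le nb' (card_lexx _)) le.
by apply: sub_finite_set => v [_ [->|h]]; [left|right].
Qed.

End InitialPieces.

Definition surj_rel (X : Type) (A B : set X) : X -> X -> Prop :=
  if pselect (exists R, surjection_graph R A B) is left h then sval (cid h)
  else fun _ _ => False.

Lemma surj_relP (X : Type) (A B : set X) :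
  B !=set0 -> B #<= A -> surjection_graph (surj_rel A B) A B.
Proof.
move=> B0 BA; rewrite /surj_rel; case: pselect => [h|[]]; first exact: (svalP (cid h)).
exact: ex_surjection_graph.
Qed.

(** A set [Br] of branches through levels indexed by [K] is described by the
    relations [E k], agreement at all levels below [k]. Its nodes are the classes
    of these relations, so the conditions on limit levels and on
    completeness become conditions on [E]. *)
Section Construction.
Variables (al K : Ord) (Br : Type) (E : K -> Br -> Br -> Prop).
Hypothesis K_pos : exists k : K, True.
Hypothesis K_nomax : forall k : K, exists k', ord_lt k k'.
Hypothesis K_seg : forall k : K,
  below k #<= ℵ (Some None : idx al).
Hypothesis E_refl : forall k x, E k x x.
Hypothesis E_sym : forall k x y, E k x y -> E k y x.
Hypothesis E_trans : forall k x y z, E k x y -> E k y z -> E k x z.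
Hypothesis E_mono : forall i j x y, ord_lt i j -> E j x y -> E i x y.
Hypothesis E_limit : forall j x y, is_limit j ->
  (forall i, ord_lt i j -> E i x y) -> E j x y.
Hypothesis E_sep : forall x y, (forall i, E i x y) -> x = y.
Hypothesis E_complete : forall b : K -> Br,
  (forall i j, ord_lt i j -> E i (b i) (b j)) -> exists x, forall i, E i x (b i).
Hypothesis E_small : forall k,
  range (E k) #<= ℵ (Some None : idx al).
Hypothesis Br_big : ℵ (None : idx al) #<= [set: Br].

Variable W : Ord.
Hypothesis W_initial : initial W.
Hypothesis W_card : [set: W] #= ℵ (Some None : idx al).
Variable c : nat -> W.
Hypothesis c_inj : injective c.
Hypothesis c_zero : forall b : OrdS al, ~ pos b -> forall w, @piece al W b w <-> exists n, w = c n.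

(** The last element of [OrdS K] is the maximal level, where a node is a branch. *)
Definition agree (l : OrdS K) (x : Br) : set Br :=
  if l is Some k then E k x else [set x].

Implicit Types (l : OrdS K) (k : K).

Lemma agree_refl l x : agree l x x. Proof. by case: l => [k|] //=. Qed.

Lemma agree_eq l x y : agree l x y -> agree l x = agree l y.
Proof.
case: l => [k|] /=; last by move=> ->.
by move=> xy; apply/seteqP; split=> z; apply: E_trans => //; exact: E_sym.
Qed.

Lemma agree_mono l l' x : ord_lt l l' -> agree l' x `<=` agree l x.
Proof.
case: l l' => [k|] [k'|] //= kk' y; first exact: E_mono.
by move=> ->.
Qed.

Lemma agree_limit l x y : is_limit l ->
  (forall k, ord_lt (Some k : OrdS K) l -> agree (Some k) x y) -> agree l x y.
Proof.
case: l => [k|] /=; first by move=> /is_limit_Some lk h; apply: E_limit => // i ik; exact: h.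
by move=> _ h; apply/esym/E_sep => k; exact: (h k).
Qed.

Definition node : Type := {p : OrdS K * set Br | exists x, p.2 = agree p.1 x}.
Definition mknode l x : node := exist _ (l, agree l x) (ex_intro _ x erefl).
Definition lev (n : node) : OrdS K := (sval n).1.

Lemma nodeE (n : node) : exists x, n = mknode (lev n) x.
Proof. by case: n => -[l s] /= [x e]; exists x; subst s; exact: sval_inj. Qed.

Lemma mknode_eq l x y : agree l x y -> mknode l x = mknode l y.
Proof. by move=> xy; apply: sval_inj; rewrite /= (agree_eq xy). Qed.

Definition tnode (n n' : node) : Prop :=
  ord_lt (lev n) (lev n') /\ (sval n').2 `<=` (sval n).2.

Lemma tnodeP l l' x y : tnode (mknode l x) (mknode l' y) <-> ord_lt l l' /\ agree l x y.
Proof.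
split=> -[ll' h]; split=> //; first by apply: (h y); exact: agree_refl.
by move=> z /= /(agree_mono ll'); rewrite /= (agree_eq h).
Qed.

Definition point : Type := (W + (OrdS K + node))%type.
Definition pL (b : idx al) : set point := [set x |
  match b, x with
  | Some b, inl w => @piece al W b w
  | None, inr (inl _) => True
  | _, _ => False
  end].
Definition plt (x y : point) : Prop :=
  match x, y with
  | inl w, inl w' => ord_lt w w'
  | inr (inl l), inr (inl l') => ord_lt l l'
  | _, _ => False
  end.
Definition pV (x : point) : set point := [set y |
  match x, y with inr (inl l), inr (inr n) => lev n = l | _, _ => False end].
Definition pS (x y : point) : Prop :=
  match x, y with inr (inl l), inr (inl l') => is_succ l l' | _, _ => False end.
Definition pT (x y : point) : Prop :=
  match x, y with inr (inr n), inr (inr n') => tnode n n' | _, _ => False end.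
Definition pF (b : OrdS al) (x : point) : point -> point -> Prop :=
  surj_rel (pL (Some b)) [set y | y = x \/ plt y x].
Definition pG (x : point) : point -> point -> Prop :=
  surj_rel (pL (Some None)) (pV x).

Lemma level_least : {l : OrdS K | forall l', l' = l \/ ord_lt l l'}.
Proof.
have [|l _ lmin] := cid2 (@ord_least (OrdS K) (fun=> True) _); first by exists None.
by exists l => l'; exact: lmin.
Qed.

Definition branch_model : structure al :=
  @Structure al point (inr (inl (sval level_least))) (fun n => inl (c n))
    pL (fun _ => plt) pS pV pT pF pG.
Local Notation M := branch_model.

Lemma pLtop (x : M) : Ltop x <-> exists l, x = inr (inl l).
Proof.
case: x => [w|[l|n]]; split=> //; try by case.
by exists l.
Qed.

Lemma pmax : @is_max al M (inr (inl None)).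
Proof.
by split=> // x /pLtop[[k|] ->]; [right|left].
Qed.

Lemma pmaxE (l : OrdS K) : @is_max al M (inr (inl l)) -> l = None.
Proof.
case: l => [k|] // [_ /(_ (inr (inl None)) I)[|]] //.
Qed.

Lemma level_succ (k : K) : exists l : OrdS K, is_succ (Some k : OrdS K) l.
Proof.
have [k' kk'] := K_nomax k.
have [l kl lmin] := @ord_least (OrdS K) (fun l => ord_lt (Some k : OrdS K) l)
  (ex_intro _ (Some k') kk').
exists l; split=> // l' l'l; case: (ord_total l' (Some k : OrdS K)) => [h|h|h]; [by right|by left|].
by case: (ord_lt_nle l'l); case: (lmin _ h); [left|right].
Qed.

Lemma psuccE (l l' : OrdS K) :
  @succ_of al M (inr (inl l)) (inr (inl l')) <-> is_succ l l'.
Proof.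
split=> [[_ _ ll' h]|[ll' h]].
  by split=> // k kl'; case: (h (inr (inl k)) I kl') => [[->]|]; [left|right].
split=> // x /pLtop[k ->] kl'; case: (h k kl') => [->|]; [by left|by right].
Qed.

Lemma pnot_succ_None : ~ exists l : OrdS K, is_succ l (None : OrdS K).
Proof.
move=> [[k|] [kl h]] //; have [k' kk'] := K_nomax k.
case: (h (Some k') I) => [[E']|/= h']; case: (@ord_irr K k); first by rewrite -{2}E'.
exact: ord_trans h'.
Qed.

Lemma level_linear : linear_on (@lttop al M) (@Ltop al M).
Proof.
split.
- by move=> x /pLtop[l ->]; exact: ord_irr.
- by move=> x y z /pLtop[l ->] /pLtop[l' ->] /pLtop[l'' ->]; exact: ord_trans.
- move=> x y /pLtop[l ->] /pLtop[l' ->].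
  by case: (ord_total l l') => [h|->|h]; [exact: Or31|exact: Or32|exact: Or33].
Qed.

Lemma branch_model_a : psi_a M.
Proof.
split.
- exact: level_linear.
- split=> // x /pLtop[l ->].
  by case: (svalP level_least l) => [->|]; [left|right].
- move=> x /pLtop[[k|] ->]; last by case; exact: pmax.
  by have [l kl] := level_succ k; exists (inr (inl l)); exact/psuccE.
- move=> [w|[l|n]] [w'|[l'|n']]; split=> //; try by case.
  + by move=> h; apply/psuccE.
  + by move/psuccE.
- move=> x mx; have [/pLtop[l E'] _] := mx; subst x.
  have -> := pmaxE mx; move=> [[w|[l'|n]]] //= h.
  by apply: pnot_succ_None; exists l'.
Qed.

Lemma pV_lev (l : OrdS K) (y : M) : V_ M (inr (inl l)) y -> exists x, y = inr (inr (mknode l x)).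
Proof.
case: y => [w|[l'|n]] //= <-; have [x nx] := nodeE n.
by exists x; congr (inr (inr _)).
Qed.

Lemma branch_model_b : psi_b M.
Proof.
split.
- move=> a b /pLtop[l ->]; apply/seteqP; split=> // x [lx].
  by have [y ->] := pV_lev lx; case: b => [b|].
- move=> a b /pLtop[l ->] /pLtop[l' ->] ll'; apply/seteqP; split=> // x [lx l'x].
  have [y E'] := pV_lev lx; subst x; case: ll'.
  by move: l'x => /= <-.
- move=> [w|[l|n]].
  + left; exists (Some None); apply: (@card_lt_le_trans _ _ _ _ [set: W]).
      exact: W_initial.
    by rewrite (card_le_eql W_card); exact: card_lexx.
  + by left; exists None.
  + by right; exists (inr (inl (lev n))).
Qed.

Lemma branch_model_c : psi_c M.
Proof.
apply: (@psi_c_of_max al M (inr (inl None))).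
- exact: level_linear.
- move=> a b x /pLtop[l ->] /pLtop[l' ->] lx l'x.
  by have [y E'] := pV_lev lx; subst x; move: l'x => /= <-.
- exact: pmax.
- move=> [w|[l|n]] [w'|[l'|n']] [w''|[l''|n'']] //= [h1 h2] [h3 h4].
  by split; [exact: ord_trans h3|move=> z /h4 /h2].
- move=> [w|[l|n]] [w'|[l'|n']] //= [h1 h2].
  by exists (inr (inl (lev n))), (inr (inl (lev n'))).
- move=> a b y /pLtop[l ->] /pLtop[l' ->] ly /= l'l.
  have [x ->] := pV_lev ly; exists (inr (inr (mknode l' x))) => //.
  by apply/tnodeP; split=> //; exact: agree_refl.
- move=> a x y z /pLtop[l ->] lx ly.
  have [x' ->] := pV_lev lx; have [y' ->] := pV_lev ly; case: z => [w|[l'|n]] //=.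
  have [z ->] := nodeE n; move=> /tnodeP[_ xz] /tnodeP[_ yz].
  by congr (inr (inr _)); apply: mknode_eq; rewrite (agree_eq xz) -(agree_eq yz); exact: agree_refl.
- move=> a /pLtop[l ->] l0 ns y z ly lz same.
  have [x xE] := pV_lev ly; have [x' x'E] := pV_lev lz; subst y z.
  congr (inr (inr _)); apply: mknode_eq; apply: agree_limit.
    split; last by move=> [l' l'l]; apply: ns; exists (inr (inl l')).
    case: (svalP level_least l) => [E'|h]; last by exists (sval level_least).
    by case: l0; rewrite E'.
  move=> k kl; have : T_ M (inr (inr (mknode (Some k) x))) (inr (inr (mknode l x'))).
    by apply/same/tnodeP; split=> //; exact: agree_refl.
  by move=> /tnodeP[].
- move=> a y /pLtop[[k|] ->] ym ly; last by case: ym.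
  have [x ->] := pV_lev ly; exists (inr (inr (mknode None x))) => //.
  by apply/tnodeP; split=> //; exact: E_refl.
Qed.

Lemma branch_model_d : psi_d M.
Proof.
split; first by move=> m n [/c_inj].
move=> [b|] nb x; last by case: nb; exact: pos_top.
have nb' : ~ pos b by move=> h; apply: nb; apply/pos_Some.
split=> [|[n ->]]; last by apply/(c_zero nb'); exists n.
by case: x => [w|//] /= /(c_zero nb')[n ->]; exists n.
Qed.

Lemma branch_model_e : psi_e M.
Proof.
split.
  move=> [[b|] pb] //= _; split.
  - by move=> [w|[l|n]] //= _; exact: ord_irr.
  - by move=> [w|[l|n]] [w'|[l'|n']] [w''|[l''|n'']] //= _ _ _; exact: ord_trans.
  - move=> [w|[l|n]] [w'|[l'|n']] //= _ _.
    by case: (ord_total w w') => [h|->|h]; [exact: Or31|exact: Or32|exact: Or33].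
move=> [b|] lb; last by have [_ []] := lb; exists (Some None); exact: is_succ_None.
have lb' : is_limit b by apply/is_limit_Some.
apply/seteqP; split=> [[w|[l|n]] //= bw|[w|[l|n]] [[d|] //= db dw]] //.
  by move: bw; rewrite (@piece_limit al W b lb') => -[d db dw]; exists (Some d).
by rewrite (@piece_limit al W b lb'); exists d.
Qed.

Lemma branch_model_f : psi_f M.
Proof.
move=> b [[b'|] pb'] /= bb' x; last first.
  by case: bb' => _ /(_ (Some None) I) [e|h] //; discriminate e.
have bb'' : is_succ (Some b : OrdS al) b' by apply/is_succ_Some.
case: x => [w|//] bw.
have -> : [set y | pL (Some b') y /\ (y = inl w \/ plt y (inl w))] =
          [set y | y = inl w \/ plt y (inl w)].
  apply/seteqP; split=> [y []//|[w'|y] h]; split=> //; last by case: y h => [l|n] [].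
  by case: h => [[->]//|h]; exact: piece_down h.
apply: surj_relP; first by exists (inl w); left.
apply: (@card_le_trans _ _ _ [set v | v = w \/ ord_lt v w]).
  apply: (@card_le_rel _ _ _ _ (fun y v => y = inl v)).
    move=> [w'|[l|n]] [] //; first by move=> [->]; exists w => //; left.
    by move=> h; exists w' => //; right.
  by move=> y y' v _ _ _ -> ->.
have bw' : piece b' w := bw.
apply: card_le_trans (piece_seg W_card bb'' bw') _.
by apply: (@card_le_inj _ _ _ _ inl) => // v v' _ _ [].
Qed.

Lemma piece_card_le (Y : Type) (A : set Y) :
  A #<= ℵ (Some None : idx al) -> A #<= pL (Some None).
Proof.
move=> le; apply: card_le_trans le _; apply: card_le_trans (piece_big W_card None) _.
by apply: (@card_le_inj _ _ _ _ inl) => // v v' _ _ [].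
Qed.

Lemma branch_model_g : psi_g M.
Proof.
move=> a /pLtop[[k|] ->] nx; last by case: nx; exact: pmax.
split.
  have -> : [set y | @Ltop al M y /\
              (y = inr (inl (Some k)) \/ @lttop al M y (inr (inl (Some k))))] =
            [set y | y = inr (inl (Some k)) \/ plt y (inr (inl (Some k)))].
    apply/seteqP; split=> [y []//|y h]; split=> //.
    by case: h => [->//|]; case: y => [w|[l|n]].
  apply: surj_relP; first by exists (inr (inl (Some k))); left.
  apply: piece_card_le; apply: (@card_le_trans _ _ _ ([set k] `|` below k)).
    apply: (@card_le_rel _ _ _ _ (fun y v => y = inr (inl (Some v)))).
      move=> [w|[[k'|]|n]] [] //=; first by move=> [->]; exists k => //; left.
      by move=> k'k; exists k' => //; right.
    by move=> y y' v _ _ _ -> ->.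
  have inf := @aleph_infinite (idx al) (Some None).
  by apply: card_leU => //; exact: card_le_trans (countable1 k) inf.
apply: surj_relP.
  have [x _] : [set: Br] !=set0.
    by apply: infinite_setN0; apply/infiniteP; exact: card_le_trans (aleph_infinite _) Br_big.
  by exists (inr (inr (mknode (Some k) x))).
apply: piece_card_le; apply: card_le_trans (E_small k).
apply: (@card_le_rel _ _ _ _ (fun y s => exists x, y = inr (inr (mknode (Some k) x)) /\ s = E k x)).
  by move=> y /pV_lev[x ->]; exists (E k x); [exists x|exists x].
move=> y y' s _ _ _ [x [-> sx]] [x' [-> sx']]; congr (inr (inr _)); apply: mknode_eq.
by rewrite /= -sx sx'; exact: E_refl.
Qed.

Lemma branch_model_psi : psi M.
Proof.
split; [exact: branch_model_a|exact: branch_model_b|exact: branch_model_c|exact: branch_model_d|].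
by split; [exact: branch_model_e|exact: branch_model_f|exact: branch_model_g].
Qed.

Lemma branch_model_top_card (Y : Type) (f : Br -> Y) : injective f ->
  forall A : set Y, (forall x, A (f x)) -> [set: Br] #<= A.
Proof. by move=> finj A Af; apply: (@card_le_inj _ _ _ _ f) => // x y _ _ /finj. Qed.

Lemma pV_None_inj : injective (fun x => inr (inr (mknode None x)) : M).
Proof.
by move=> x y [] e; have : [set y] x by rewrite -e.
Qed.

Lemma branch_model_complete : @complete_at al M (inr (inl None)).
Proof.
move=> B [Bn Bch Bm].
have /choice[b bP] k : exists x, B (inr (inr (mknode (Some k) x))).
  have [||y [By /pV_lev[x yE]]] := Bm (inr (inl (Some k))) => //.
  by exists x; rewrite -yE.
have same_lev n n' : B (inr (inr n)) -> B (inr (inr n')) -> lev n = lev n' -> n = n'.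
  move=> Bn1 Bn2 e; case: (Bch _ _ Bn1 Bn2) => [[h _]|[//]|[h _]].
    by move: h; rewrite e => /ord_irr.
  by move: h; rewrite e => /ord_irr.
have [|x xP] := E_complete (b := b).
  move=> i j ij; case: (Bch _ _ (bP i) (bP j)) => [/tnodeP[_ h]|[e _]|/tnodeP[/= ji]] //.
    by case: (@ord_irr K i); rewrite {2}e.
  by case: (@ord_irr K i (ord_trans ij ji)).
have nodex k : mknode (Some k) (b k) = mknode (Some k) x by apply/esym/mknode_eq; exact: xP.
exists (inr (inr (mknode None x))) => // y; split.
  case: y => [w|[l|n]] //=; have [y ->] := nodeE n; case: (lev n) => [k|] /tnodeP[] //= _ kyx.
  by rewrite (mknode_eq (l := Some k) kyx) -nodex; exact: bP.
move=> By; have [a [/pLtop[l aE] am ly]] := Bn y By; subst a.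
have [z zE] := pV_lev ly; subst y; case: l am ly By => [k|] am ly By; last by case: am.
by rewrite (same_lev _ _ By (bP k) erefl) nodex; apply/tnodeP; split=> //; exact: E_refl.
Qed.

Lemma branch_model_maximal (al_countable : countable [set: al]) : has_maximal_model al Br.
Proof.
have BrV : [set: Br] #<= @V_ al M (inr (inl None)).
  exact: (branch_model_top_card pV_None_inj).
exists M; split.
  apply: (@complete_maximal al M (inr (inl None))) => //.
  - exact: branch_model_psi.
  - move=> b; apply: card_le_trans (piece_big W_card b) _.
    by apply: (@card_le_inj _ _ _ _ inl) => // v v' _ _ [].
  - exact: pmax.
  - have [k _] := K_pos; move=> [lE].
    by case: (svalP level_least (Some k)); rewrite -lE.
  - move=> le; have [_ []] := aleph_lt (is_succ_None al).1.
    exact: card_le_trans (card_le_trans Br_big BrV) le.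
  - exact: branch_model_complete.
rewrite card_eq_le; apply/andP; split; last exact: card_le_trans BrV (card_leT _).
apply: (@model_card_le _ _ branch_model_psi al_countable _ _ pmax) => //.
apply: (@card_le_rel _ _ _ _ (fun y x => y = inr (inr (mknode None x)))).
  by move=> y /pV_lev[x ->]; exists x.
by move=> y y' x _ _ _ -> ->.
Qed.

End Construction.

Lemma maximal_model_of_branches (al K : Ord) (Br : Type) (E : K -> Br -> Br -> Prop) :
  countable [set: al] ->
  (exists k : K, True) -> (forall k : K, exists k', ord_lt k k') ->
  (forall k : K, below k #<= ℵ (Some None : idx al)) ->
  (forall k x, E k x x) -> (forall k x y, E k x y -> E k y x) ->
  (forall k x y z, E k x y -> E k y z -> E k x z) ->
  (forall i j x y, ord_lt i j -> E j x y -> E i x y) ->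
  (forall j x y, is_limit j -> (forall i, ord_lt i j -> E i x y) -> E j x y) ->
  (forall x y, (forall i, E i x y) -> x = y) ->
  (forall b : K -> Br, (forall i j, ord_lt i j -> E i (b i) (b j)) ->
     exists x, forall i, E i x (b i)) ->
  (forall k, range (E k) #<= ℵ (Some None : idx al)) ->
  ℵ (None : idx al) #<= [set: Br] ->
  has_maximal_model al Br.
Proof.
move=> alc Kpos Knomax Kseg refl sym trans mono limit sep complete small big.
have [W [Winit Wcard]] := ex_initial (@aleph_below (idx al) (Some None)).
have [b0 _ b0min] := @ord_least (OrdS al) (fun=> True) (ex_intro _ None I).
have b0_zero : ~ pos b0.
  by move=> [b bb0]; case: (b0min b I) => h; apply: (ord_lt_nle bb0); [left|right].
have [c c_inj cP] := card_eq_nat_enum (piece_zero Wcard b0_zero).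
apply: (branch_model_maximal Kpos Knomax Kseg refl sym trans mono limit sep complete
  small big Winit Wcard c_inj _ alc).
move=> b b_zero; suff -> : b = b0 by exact: cP.
by case: (b0min b I) => // b0b; case: b_zero; exists b0.
Qed.

Lemma has_maximal_model_eq (al : Ord) (X Y : Type) : [set: X] #= [set: Y] ->
  has_maximal_model al X -> has_maximal_model al Y.
Proof. by move=> XY [M [Mmax MX]]; exists M; split=> //; rewrite (card_eql MX). Qed.

Section InfiniteInitial.
Variable mu : Ord.
Hypothesis mu_init : initial mu.
Hypothesis mu_inf : [set: nat] #<= [set: mu].

Lemma initial_nomax (i : mu) : exists j, ord_lt i j.
Proof.
apply: contrapT => none; have [_ []] := mu_init i.
have U : [set: mu] = [set i] `|` below i.
  apply/seteqP; split=> // j _; case: (ord_total i j) => [ij|->|ji]; [|by left|by right].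
  by case: none; exists j.
have bi_inf : [set: nat] #<= below i.
  apply/infiniteP => fin; have /infiniteP := mu_inf; apply.
  by rewrite U finite_setU; split => //; exact: finite_set1.
have bi_inf' : [set: nat] #<= [set: {j | below i j}].
  by rewrite (card_le_eqr (card_subtype (below i))).
rewrite U -(card_le_eqr (card_subtype (below i))); apply: card_leU => //.
  exact: card_le_trans (countable1 i) bi_inf'.
by rewrite (card_le_eqr (card_subtype (below i))); exact: card_lexx.
Qed.

Lemma initial_seg (al : Ord) (i : mu) : [set: mu] #<= ℵ (None : idx al) ->
  below i #<= ℵ (Some None : idx al).
Proof.
move=> le; apply: contrapT => nle; have [_ []] := mu_init i.
by apply: card_le_trans le _; exact: (aleph_succ_le (is_succ_None al)).
Qed.

End InfiniteInitial.

(** The model of the tree of height $\omega_{\alpha+1}$ whose branches are the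
    sequences of zeros with at most one entry equal to one; [Some i] stands for
    the sequence with a one at position [i]. *)
Lemma maximal_model_succ (al : Ord) : countable [set: al] ->
  has_maximal_model al (aleph (OrdS al)).
Proof.
move=> alc; have [K [Kinit Kcard]] := ex_initial (aleph (OrdS al)).
have natA : [set: nat] #<= [set: aleph (OrdS al)] := aleph_infinite (None : idx al).
have natK : [set: nat] #<= [set: K] by rewrite (card_le_eqr Kcard).
have Kle : [set: K] #<= ℵ (None : idx al) by rewrite (card_le_eql Kcard) card_lexx.
have Koption : [set: K] #<= [set: option K].
  by apply: (@card_le_inj _ _ _ _ Some) => // x y _ _ [].
apply: (@has_maximal_model_eq _ (option K)).
  rewrite -(card_eqr Kcard) card_eq_le Koption andbT.
  by apply: card_le_optionT => //; exact: card_lexx.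
pose ge (k : K) (x : option K) := if x is Some i then ~ ord_lt i k else True.
apply: (@maximal_model_of_branches _ K _ (fun k x y => x = y \/ ge k x /\ ge k y)) => //.
- by have /infiniteP/infinite_setN0[k _] := natK; exists k.
- exact: initial_nomax.
- by move=> k; exact: initial_seg.
- by left.
- by move=> k x y [->|[]]; [left|right].
- by move=> k x y z [->//|[kx ky]] [<-|[_ kz]]; right.
- move=> i j x y ij [->|[jx jy]]; [by left|right].
  have mono z : ge j z -> ge i z by case: z => //= l njl il; apply: njl; exact: ord_trans ij.
  by split; exact: mono.
- move=> j x y lj h; have [e|ne] := pselect (x = y); [by left|right].
  have lim z : (forall i, ord_lt i j -> ge i z) -> ge j z.
    case: z => //= l gl lj'; have [k [lk _] kj] := is_limitP lj lj'.
    exact: gl kj lk.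
  by split; apply: lim => i /h[//|[]].
- move=> x y h; apply: contrapT => ne.
  have none z : (forall i, ge i z) -> z = None.
    case: z => // l gl; have [k lk] := initial_nomax Kinit natK l.
    by case: (gl k).
  have gx i : ge i x by case: (h i) => [|[]].
  have gy i : ge i y by case: (h i) => [|[]].
  by apply: ne; rewrite (none x gx) (none y gy).
- move=> b coh; have [[i [j [bi ji]]]|none] := pselect (exists i j, b i = Some j /\ ord_lt j i).
    exists (Some j) => i'; case: (ord_total i i') => [ii'|<-|i'i]; last 2 first.
    + by left.
    + by rewrite -bi; case: (coh _ _ i'i) => [->|[]]; [left|right].
    by case: (coh _ _ ii') => [<-|[]]; [left|rewrite bi => /(_ ji)].
  exists None => i; right; split=> //; case bi : (b i) => [j|] //= ji.
  by case: none; exists i, j.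
- move=> k; have inf := @aleph_infinite (idx al) (Some None).
  apply: (@card_le_trans _ _ _ ([set None] `|` Some @` below k)).
    apply: (@card_le_surj _ _ _ _ (fun x y => x = y \/ ge k x /\ ge k y)) => s [x _ <-].
    have [kx|nkx] := pselect (ge k x).
      exists None; first by left.
      apply/funext => y; apply/propext; split=> [[<-|[_ ky]]|[<-|[_ ky]]]; by right.
    case: x nkx => [i|] nn; last by case: nn.
    by exists (Some i) => //; right; exists i => //; exact: contrapT.
  apply: card_leU => //; first exact: card_le_trans (countable1 _) inf.
  by apply: card_le_trans (card_image_le _ _) _; exact: initial_seg.
- by apply: card_le_trans Koption; rewrite (card_le_eqr Kcard) card_lexx.
Qed.

Lemma nat_wo : well_order_on (fun m n : nat => m < n) [set: nat].
Proof.
split.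
  split=> [m _|m n p _ _ _|m n _ _]; first by rewrite ltnn.
    exact: ltn_trans.
  by case: ltngtP => [h|h|h]; [exact: Or31|exact: Or33|exact: Or32].
move=> Y _ [n Yn].
have [m /asboolP Ym mmin] :=
  find_ex_minn (ex_intro (fun n => `[< Y n >]) n (asboolT Yn)).
exists m => // p Yp; have := mmin p (asboolT Yp).
by rewrite leq_eqVlt => /orP[/eqP->|]; [left|right].
Qed.

Definition Ord_nat : Ord := MkOrd nat_wo.

(** The model of the full tree of finite sequences in $\lambda$. *)
Lemma maximal_model_power (al : Ord) (lam : Type) : countable [set: al] ->
  [set: nat] #<= [set: lam] -> [set: lam] #<= [set: aleph al] ->
  [set: aleph (OrdS al)] #<= [set: nat -> lam] ->
  has_maximal_model al (nat -> lam).
Proof.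
move=> alc lam_inf lam_le big.
have inf := @aleph_infinite (idx al) (Some None).
apply: (@maximal_model_of_branches _ Ord_nat _
  (fun (n : Ord_nat) u v => forall i : Ord_nat, ord_lt i n -> u i = v i)) => //.
- by exists 0%N.
- by move=> n; exists n.+1; exact: leqnn.
- by move=> n; apply: card_le_trans inf; exact: countableP.
- by move=> n u v h i /h.
- by move=> n u v w h h' i ni; rewrite h // h'.
- by move=> m n u v mn h i im; apply: h; exact: ord_trans mn.
- move=> n u v [[m mn] ns]; case: ns; case: n mn => // n mn; exists n.
  split; first exact: leqnn.
  by move=> k; rewrite /= ltnS leq_eqVlt => /orP[/eqP|]; [left|right].
- by move=> u v h; apply/funext => i; apply: (h i.+1); exact: leqnn.
- move=> b coh; exists (fun n : nat => b n.+1 n) => n i /= ni.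
  case: (ltngtP i.+1 n) => [h|h|<- //]; last by move: (leq_trans h ni); rewrite ltnn.
  by apply: coh => //=.
- move=> n; rewrite (card_le_eqr (aleph_topE al)); apply: card_le_trans lam_le.
  apply: card_le_trans (card_le_seqT lam_inf).
  apply: (@card_le_rel _ _ _ _ (fun s t => exists u : nat -> lam,
    s = (fun v => forall i : Ord_nat, ord_lt i n -> u i = v i) /\ t = mkseq u n)).
    by move=> s [u _ <-]; exists (mkseq u n) => //; exists u.
  move=> s s' t _ _ _ [u [-> tu]] [u' [-> tu']].
  apply/funext => v; apply/propext.
  have uu' (i : nat) : i < n -> u i = u' i.
    move=> ni; have := congr1 (fun s => nth (u i) s i) tu'.
    by rewrite tu !nth_mkseq.
  by split=> h i ni; rewrite -h // uu'.
Qed.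

(** * Trees and their branches *)

Section TreeLevels.
Variables (X : Type) (lt : X -> X -> Prop) (mu : Ord).
Implicit Types (x y z : X) (i j k : mu).

(** An isomorphism between initial segments of an ordinal cannot lower any
    point: consider the least one that is lowered. *)
Lemma at_level_nlt i j x : at_level lt i x -> at_level lt j x -> ~ ord_lt i j.
Proof.
move=> [f [[fi finj fsurj] fP]] [g [[gj ginj gsurj] gP]] ij.
have key k : forall z, lt z x -> g z = k -> ~ ord_lt (f z) k.
  elim/(well_founded_ind (@ord_wf mu)): k => k IH z zx gz fzk.
  have [z' z'x gz'] : exists2 z', lt z' x & g z' = f z.
    apply: gsurj; rewrite /below /=; apply: ord_trans fzk _.
    by rewrite -gz; exact: gj.
  apply: (IH (f z) fzk z' z'x gz'); apply/(fP z' z z'x zx)/(gP z' z z'x zx).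
  by rewrite gz' gz.
have [z zx gz] := gsurj i ij.
exact: (key i z zx gz (fi z zx)).
Qed.

Lemma at_level_inj i j x : at_level lt i x -> at_level lt j x -> i = j.
Proof.
move=> ix jx; case: (ord_total i j) => // h; first by case: (at_level_nlt ix jx h).
by case: (at_level_nlt jx ix h).
Qed.

Hypothesis lt_tree : tree lt.

Lemma tree_trans x y z : lt x y -> lt y z -> lt x z.
Proof. by case: lt_tree => _ tr _; exact: tr. Qed.

Lemma tree_chain z : chain lt [set y | lt y z].
Proof. by case: lt_tree => _ _ /(_ z)[[_ _ tot] _] x y xz yz; exact: tot. Qed.

Lemma at_level_lt i x y : at_level lt i y -> lt x y -> exists2 j, ord_lt j i & at_level lt j x.
Proof.
move=> [f [[fi finj fsurj] fP]] xy; exists (f x); first exact: fi.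
have xs z : lt z x -> lt z y by move=> zx; exact: tree_trans xy.
exists f; split; last by move=> z z' /xs zy /xs z'y; exact: fP.
split.
- by move=> z zx; apply/(fP z x) => //; exact: xs.
- by move=> z z' /set_mem/xs zy /set_mem/xs z'y; apply: finj; exact: mem_set.
- move=> k kx; have [z zy zk] : exists2 z, lt z y & f z = k.
    by apply: fsurj; rewrite /below /=; apply: ord_trans kx _; exact: fi.
  by exists z => //; apply/(fP z x zy xy); rewrite zk.
Qed.

Lemma same_level_nlt i x y : at_level lt i x -> at_level lt i y -> ~ lt x y.
Proof.
move=> ix iy xy; have [j ji jx] := at_level_lt iy xy.
by apply: (@ord_irr mu i); rewrite {1}(at_level_inj ix jx).
Qed.

Lemma chain_level_inj (B : set X) i x y : chain lt B -> B x -> B y ->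
  at_level lt i x -> at_level lt i y -> x = y.
Proof.
move=> Bch Bx By ix iy; case: (Bch x y Bx By) => // h.
  by case: (same_level_nlt ix iy h).
by case: (same_level_nlt iy ix h).
Qed.

Lemma cofinal_branch_of_chain (B : set X) :
  (forall x, exists i, at_level lt i x) -> chain lt B ->
  (forall i, B `&` at_level lt i !=set0) -> cofinal_branch lt mu B.
Proof.
move=> levels Bch Bmeet; split=> //; split=> // C _ Cch BC.
apply/seteqP; split=> // y Cy; have [i iy] := levels y.
have [x [Bx ix]] := Bmeet i.
by rewrite -(chain_level_inj Cch (BC x Bx) Cy ix iy).
Qed.

Lemma cofinal_branch_down (B : set X) x y : cofinal_branch lt mu B -> B y -> lt x y -> B x.
Proof.
move=> [[_ Bch Bmax] _] By xy.
suff chU : chain lt (B `|` [set x]).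
  by rewrite -(Bmax _ (@subsetT _ _) chU (@subsetUl _ _ _)); right.
have cmp z : B z -> [\/ lt z x, z = x | lt x z].
  move=> Bz; case: (Bch z y Bz By) => [zy|->|yz].
  - exact: (tree_chain zy xy).
  - exact: Or33.
  - by apply: Or33; exact: tree_trans yz.
move=> z z' [Bz|->] [Bz'|->]; [exact: Bch|exact: cmp| |exact: Or32].
by case: (cmp z' Bz') => [h|h|h]; [exact: Or33|exact: Or32|exact: Or31].
Qed.

End TreeLevels.

(** The nodes at level $i$ of the new tree are the restrictions of cofinal
    branches to the levels below $i$; this makes the tree pruned and
    makes nodes of limit levels determined by their predecessors. *)
Lemma maximal_model_Kurepa (al mu : Ord) (kap X : Type) (lt : X -> X -> Prop) :
  countable [set: al] ->
  [set: aleph (OrdS Ord0)] #<= [set: mu] -> [set: mu] #<= [set: aleph (OrdS al)] ->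
  Kurepa_tree mu (aleph (OrdS al)) kap lt -> cofinal_branch lt mu #= [set: kap] ->
  has_maximal_model al kap.
Proof.
move=> alc mu_big mu_le [mu_init [lam_kap _ _] [lt_tree [levels _]] lev_small _] kapE.
have mu_inf : [set: nat] #<= [set: mu].
  by apply: card_le_trans mu_big; exact: (aleph_infinite (None : OrdS (OrdS Ord0))).
pose Br := {B | cofinal_branch lt mu B}.
have BrE : [set: Br] #= [set: kap] by rewrite (card_eql (card_subtype _)).
apply: (has_maximal_model_eq BrE).
have ex_node (B : Br) (i : mu) : exists2 x, sval B x & at_level lt i x.
  by case: B => B /= [_ /(_ i)[x [? ?]]]; exists x.
have Bch (B : Br) : chain lt (sval B) by case: B => B /= [[_ h _] _].
pose E (i : mu) (B B' : Br) := forall x (j : mu),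
  ord_lt j i -> at_level lt j x -> (sval B x <-> sval B' x).
have E_node i (B B' : Br) x : at_level lt i x -> sval B x -> sval B' x -> E i B B'.
  move=> ix Bx B'x; suff half (B1 B2 : Br) : sval B1 x -> sval B2 x -> forall y j, ord_lt j i ->
      at_level lt j y -> sval B1 y -> sval B2 y.
    by move=> y j ji jy; split; [exact: half ji jy|exact: half ji jy].
  move=> B1x B2x y j ji jy B1y; case: (Bch B1 y x B1y B1x) => [yx|->//|xy].
    exact: (cofinal_branch_down lt_tree (svalP B2) B2x yx).
  have [l lj lx] := at_level_lt lt_tree jy xy.
  case: (@ord_irr mu l); apply: ord_trans lj _.
  by rewrite (at_level_inj lx ix).
apply: (@maximal_model_of_branches _ mu _ E) => //.
- by have /infiniteP/infinite_setN0[k _] := mu_inf; exists k.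
- exact: initial_nomax.
- by move=> k; exact: initial_seg.
- by move=> i B B' h x j ji jx; rewrite (h x j).
- by move=> i B1 B2 B3 h h' x j ji jx; rewrite (h x j) // (h' x j).
- by move=> i j B B' ij h x l li lx; apply: (h x l) => //; exact: ord_trans ij.
- move=> j B B' lj h x l lj' lx; have [k [lk _] kj] := is_limitP lj lj'.
  exact: (h k kj x l lk lx).
- move=> B B' h; apply: sval_inj; apply/seteqP; split=> x; have [j jx] := levels x;
    have [i ji] := initial_nomax mu_init mu_inf j; by rewrite (h i x j).
- move=> b coh.
  pose B := [set x | exists i j, [/\ at_level lt j x, ord_lt j i & sval (b i) x]].
  have BP i j x : ord_lt j i -> at_level lt j x -> (B x <-> sval (b i) x).
    move=> ji jx; split=> [[i' [j' [j'x j'i' bx]]]|bx]; last by exists i, j.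
    have E' := at_level_inj j'x jx; subst j'.
    case: (ord_total i i') => [ii'|->//|i'i]; first by rewrite (coh _ _ ii' x j).
    by rewrite -(coh _ _ i'i x j).
  have Bbranch : cofinal_branch lt mu B.
    apply: cofinal_branch_of_chain => //.
      move=> x y [i [j [jx ji bx]]] [i' [j' [j'y j'i' b'y]]].
      case: (ord_total i i') => [ii'|E'|i'i].
      + apply: (Bch (b i')) => //; rewrite -(BP i' j x) //; last exact: ord_trans ii'.
        by exists i, j.
      + by subst i'; exact: (Bch (b i)).
      + apply: (Bch (b i)) => //; rewrite -(BP i j' y) //; last exact: ord_trans i'i.
        by exists i', j'.
    move=> j; have [i ji] := initial_nomax mu_init mu_inf j.
    have [x bx jx] := ex_node (b i) j.
    by exists x; split=> //; exists i, j.
  by exists (exist _ B Bbranch) => i x j ji jx /=; rewrite (BP i j).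
- move=> i; have le : at_level lt i #<= ℵ (Some None : idx al).
    apply: contrapT => nle; have [_ []] := lev_small i.
    exact: (aleph_succ_le (is_succ_None al)).
  apply: card_le_trans le.
  apply: (@card_le_rel _ _ _ _ (fun s x => exists2 B, s = E i B & sval B x)).
    by move=> s [B _ <-]; have [x Bx ix] := ex_node B i; exists x => //; exists B.
  move=> s s' x _ _ ix [B -> Bx] [B' -> B'x].
  apply/funext => C; apply/propext; have BB' := E_node i B B' x ix Bx B'x.
  by split=> h y j ji jy; rewrite -(h y j) // (BB' y j).
- by rewrite (card_le_eqr BrE).
Qed.

(** * Proper extensions of models *)

Lemma surjection_graph_map (X Y : Type) (e : X -> Y) (R : X -> X -> Prop) (A B : set X)
    (R' : Y -> Y -> Prop) (A' B' : set Y) :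
  injective e -> surjection_graph R A B ->
  (forall y, A' y <-> exists2 x, A x & e x = y) ->
  (forall y, B' y <-> exists2 x, B x & e x = y) ->
  (forall y z, R' y z <-> exists x w, [/\ R x w, e x = y & e w = z]) ->
  surjection_graph R' A' B'.
Proof.
move=> einj [RAB tot surj] AE BE RE; split.
- move=> y z /RE[x [w [Rxw <- <-]]]; have [Ax Bw] := RAB _ _ Rxw.
  by split; [apply/AE; exists x|apply/BE; exists w].
- move=> y /AE[x Ax <-]; have [w [Rxw uw]] := tot x Ax; exists (e w); split.
    by apply/RE; exists x, w.
  by move=> z /RE[x' [w' [Rxw' /einj E <-]]]; subst x'; rewrite (uw w').
- move=> z /BE[w Bw <-]; have [x Rxw] := surj w Bw; exists (e x).
  by apply/RE; exists x, w.
Qed.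

(** New levels [P] are inserted above the levels of [M] that are not maximal
    and below the maximal one; a new node lies at a new level, or at the old
    maximal level when [lv] gives [None]. The new nodes sit on the branches
    [D b] of the tree below, and [U b v] says that [b] is continued by
    the old node [v] of the maximal level. *)
Section TreeExtension.
Variables (al : Ord) (M : structure al).
Hypothesis psiM : psi M.
Variables (P Lq Br : Type) (ltP : P -> P -> Prop) (lv : Lq -> option P).
Variables (D : Br -> set M) (U : Br -> M -> Prop).

Let imm_succ (p p' : P) := ltP p p' /\ forall q, ltP q p' -> q = p \/ ltP q p.

(* A new level without a successor has to be the new maximal level. *)
Hypothesis P_linear : linear_on ltP [set: P].
Hypothesis P_succ : forall p, (exists p', imm_succ p p') \/
  (forall p', p' = p) /\ ~ exists m : M, is_max m.
Hypothesis new_max : (exists m : M, is_max m) \/ exists p : P, forall p', p' = p.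
Hypothesis lv_inj : injective lv.
Hypothesis lv_None : forall l, lv l = None -> exists m : M, is_max m.
Hypothesis lv_Some : forall p, exists l, lv l = Some p.
Hypothesis D_node : forall b x, D b x -> exists a, [/\ Ltop a, ~ is_max a & V_ M a x].
Hypothesis D_chain : forall b, chain (T_ M) (D b).
Hypothesis D_meet : forall b a, Ltop a -> ~ is_max a -> exists2 x, V_ M a x & D b x.
Hypothesis D_inj : forall b b', (forall x, D b x <-> D b' x) -> b = b'.
Hypothesis D_through : (~ exists m : M, is_max m) ->
  forall a x, Ltop a -> V_ M a x -> exists b, D b x.
Hypothesis Br_inh : exists b : Br, True.
Hypothesis U_top : forall b v, U b v -> exists2 m, is_max m & V_ M m v.
Hypothesis U_pred : forall b v, U b v -> forall x, D b x <-> T_ M x v.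
Hypothesis U_inj : forall b b' v, U b v -> U b' v -> b = b'.
Hypothesis U_ex : forall (p : P) (m : M) v, is_max m -> V_ M m v -> exists b, U b v.
Hypothesis U_total : forall (p : P) (m : M) b, is_max m -> exists v, U b v.
(* A new node of the old maximal level must differ from the old nodes there,
   unless that level is the first one. *)
Hypothesis lv_None_sep : forall l b (m v : M), lv l = None -> is_max m -> V_ M m v ->
  m <> zero_ M -> ~ forall x, T_ M x v <-> D b x.
Hypothesis P_zero : P -> ~ is_max (zero_ M).
Hypothesis P_card : (exists p p' : P, ltP p p') ->
  [set: M + (P + Lq * Br)] #<= L_ M (Some None).

Definition xpoint : Type := (M + (P + Lq * Br))%type.
Definition xL (b : idx al) : set xpoint := [set x |
  match x with inl x => L_ M b x | inr (inl p) => b = None | inr (inr _) => False end].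
Definition xlt (b : {b : idx al | pos b}) (x y : xpoint) : Prop :=
  match x, y with
  | inl x, inl y => lt_ M b x y
  | inl x, inr (inl _) => Ltop x /\ ~ is_max x
  | inr (inl _), inl y => is_max y
  | inr (inl p), inr (inl p') => ltP p p'
  | _, _ => False
  end.
Definition xS (x y : xpoint) : Prop :=
  match x, y with
  | inl x, inl y => S_ M x y
  | inr (inl p), inr (inl p') => imm_succ p p'
  | _, _ => False
  end.
Definition xV (x : xpoint) : set xpoint := [set y |
  match x, y with
  | inl x, inl y => V_ M x y
  | inl x, inr (inr q) => is_max x /\ lv q.1 = None
  | inr (inl p), inr (inr q) => lv q.1 = Some p
  | _, _ => False
  end].
Definition xT (x y : xpoint) : Prop :=
  match x, y with
  | inl x, inl y => T_ M x y
  | inl x, inr (inr q) => D q.2 x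
  | inr (inr q), inl y => lv q.1 <> None /\ U q.2 y
  | inr (inr q), inr (inr q') => q.2 = q'.2 /\ succ_lt ltP (lv q.1) (lv q'.1)
  | _, _ => False
  end.
Definition xtop : {b : idx al | pos b} := exist _ (top al) (pos_top al).
Definition xF (b : OrdS al) (x y z : xpoint) : Prop :=
  match x with
  | inl x => if y is inl y then if z is inl z then F_ M b x y z else False else False
  | inr _ => surj_rel (xL (Some None)) [set y | xL None y /\ (y = x \/ xlt xtop y x)] y z
  end.
Definition xG (x y z : xpoint) : Prop :=
  match x with
  | inl x => if y is inl y then if z is inl z then G_ M x y z else False else False
  | inr _ => surj_rel (xL (Some None)) (xV x) y z
  end.
Definition extension : structure al :=
  @Structure al xpoint (inl (zero_ M)) (fun n => inl (c_ M n)) xL xlt xS xV xT xF xG.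
Local Notation N := extension.

Lemma extension_embedding : @embedding al M N inl.
Proof. by split; [move=> x y []|split]. Qed.

Lemma xLtop (x : N) : Ltop x <->
  (exists2 a, Ltop a & x = inl a) \/ (exists p, x = inr (inl p)).
Proof.
case: x => [x|[p|q]]; split=> //.
- by left; exists x.
- by move=> [[a La [->]]|[]].
- by right; exists p.
- by move=> [[]|[]].
Qed.

Lemma max_inl (a : M) : @is_max al N (inl a) <-> is_max a.
Proof.
split=> [[/= La amax]|[La amax]].
  by split=> // x Lx; case: (amax (inl x) Lx) => [[->]|]; [left|right].
split=> // x /xLtop[[b Lb ->]|[p ->]]; last by right; split.
by case: (amax b Lb) => [->|]; [left|right].
Qed.

Lemma max_inr p : @is_max al N (inr (inl p)) <-> (forall p', p' = p) /\ ~ exists m : M, is_max m.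
Proof.
split=> [[_ pmax]|[pall nomax]]; last first.
  split=> // x /xLtop[[a La ->]|[p' ->]]; last by left; rewrite (pall p').
  by right; split=> // am; apply: nomax; exists a.
case: (P_succ p) => // -[p' [pp' _]]; case: (pmax (inr (inl p')) erefl) => [[E]|p'p].
  by have [irr _ _] := P_linear; case: (irr p I); rewrite -{2}E.
by have [irr tr _] := P_linear; case: (irr p I); exact: tr p'p.
Qed.

Lemma xlinear : linear_on (@lttop al N) (@Ltop al N).
Proof.
have [Pirr Ptr Ptot] := P_linear.
have max_nlt (a b : M) : is_max a -> Ltop b -> ~ lttop a b.
  by move=> amax Lb ab; apply: (below_nonmax psiM amax.1 Lb ab).
split.
- by move=> x /xLtop[[a La ->]|[p ->]]; [exact: (top_irr psiM La)|exact: Pirr].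
- move=> x y z /xLtop[[a La ->]|[p ->]] /xLtop[[b Lb ->]|[q ->]] /xLtop[[c Lc ->]|[r ->]] //=.
  + exact: (top_trans psiM La Lb Lc).
  + by move=> ab [_ nb]; split=> // amax; exact: max_nlt amax Lb ab.
  + move=> [_ na] cmax; apply: (nonmax_lt cmax La) => E.
    by subst c; exact: na.
  + by move=> bmax bc; case: (max_nlt b c).
  + by move=> bmax [].
  + exact: Ptr.
- move=> x y /xLtop[[a La ->]|[p ->]] /xLtop[[b Lb ->]|[q ->]] /=.
  + case: (top_total psiM La Lb) => [h|->|h]; [exact: Or31|exact: Or32|exact: Or33].
  + by have [amax|na] := pselect (is_max a); [apply: Or33|apply: Or31].
  + by have [bmax|nb] := pselect (is_max b); [apply: Or31|apply: Or33].
  + by case: (Ptot p q I I) => [h|->|h]; [exact: Or31|exact: Or32|exact: Or33].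
Qed.

Lemma succ_inl (a b : M) : @succ_of al N (inl a) (inl b) <-> succ_of a b.
Proof.
split=> -[La Lb ab h].
  by split=> // x Lx xb; case: (h (inl x) Lx xb) => [[]|]; [left|right].
split=> // x /xLtop[[c Lc ->]|[p ->]] cb; last first.
  by case: (max_not_succ psiM (m := b) cb); exists a; apply/(succE psiM).
by case: (h c Lc cb) => [->|]; [left|right].
Qed.

Lemma succ_inr p p' : @succ_of al N (inr (inl p)) (inr (inl p')) <-> imm_succ p p'.
Proof.
split=> [[_ _ pp' h]|[pp' h]].
  by split=> // q qp'; case: (h (inr (inl q)) erefl qp') => [[]|]; [left|right].
split=> // x /xLtop[[a La ->]|[q ->]] xp'; last by case: (h q xp') => [->|]; [left|right].
by right; case: xp'.
Qed.

Lemma nonmax_succ_nonmax (a : M) : Ltop a -> ~ is_max a ->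
  exists b, succ_of a b /\ ~ is_max b.
Proof.
move=> La na; have [b ab] := nonmax_succ psiM La na; exists b; split=> // bmax.
by apply: (max_not_succ psiM bmax); exists a; apply/(succE psiM).
Qed.

Lemma nsucc_inl_inr a p : ~ @succ_of al N (inl a) (inr (inl p)).
Proof.
move=> [La _ [_ na] h]; have [b [[_ Lb ab _] nb]] := nonmax_succ_nonmax La na.
case: (h (inl b) Lb (conj Lb nb)) => [[E]|ba]; last exact: (top_asym psiM La Lb ab ba).
by subst b; exact: (top_irr psiM La ab).
Qed.

Lemma nsucc_inr_inl p a : ~ @succ_of al N (inr (inl p)) (inl a).
Proof.
move=> [_ La amax h]; case: (P_succ p) => [[p' [pp' _]]|[_ []]]; last by exists a.
have [Pirr Ptr _] := P_linear.
case: (h (inr (inl p')) erefl amax) => [[E]|p'p]; first by apply: (Pirr p I); rewrite -{2}E.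
by apply: (Pirr p I); exact: Ptr p'p.
Qed.

Lemma extension_a : psi_a N.
Proof.
split.
- exact: xlinear.
- split; first exact: (top_zero psiM).
  move=> x /xLtop[[a La ->]|[p ->]].
    by case: (top_zero_min psiM La) => [->|]; [left|right].
  by right; split; [exact: top_zero|exact: P_zero].
- move=> x /xLtop[[a La ->]|[p ->]] nx.
    have na : ~ is_max a by move=> amax; apply: nx; exact/max_inl.
    by have [b ab] := nonmax_succ psiM La na; exists (inl b); exact/succ_inl.
  case: (P_succ p) => [[p' pp']|h]; last by case: nx; exact/max_inr.
  by exists (inr (inl p')); exact/succ_inr.
- move=> x y; split.
    case: x y => [a|[p|q]] [b|[p'|q']] //=; first by move=> ab; apply/succ_inl/(succE psiM).
    by move/succ_inr.
  move=> sxy; have [Lx Ly _ _] := sxy; move: Lx Ly sxy.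
  move=> /xLtop[[a La ->]|[p ->]] /xLtop[[b Lb ->]|[p' ->]].
  + by move/succ_inl => ab; apply/(succE psiM).
  + by move/nsucc_inl_inr.
  + by move/nsucc_inr_inl.
  + by move/succ_inr.
- move=> [a|[p|q]] /[dup] xmax [].
  + move=> _ _ [[b|[p|q]]] //= ba.
    by apply: (max_not_succ psiM (m := a)); [exact/max_inl|exists b].
  + move=> _ _ [[b|[p'|q]]] //= [p'p _].
    have [_ _] := P_linear; have [pall _] := (max_inr p).1 xmax.
    by have [Pirr _ _] := P_linear; case: (Pirr p I); rewrite -{1}(pall p').
  + by [].
Qed.

Lemma xlevel (a b x : N) : Ltop a -> Ltop b -> V_ N a x -> V_ N b x -> a = b.
Proof.
move=> /xLtop[[a' La ->]|[p ->]] /xLtop[[b' Lb ->]|[p' ->]]; case: x => [x|[r|q]] //=.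
- by move=> ax bx; rewrite (node_level psiM La Lb ax bx).
- by move=> [amax _] [bmax _]; rewrite (max_unique psiM amax bmax).
- by move=> [_ ->].
- by move=> -> [].
- by move=> -> [->].
Qed.

Lemma qlevel_ex q : exists2 a : N, Ltop a & V_ N a (inr (inr q)).
Proof.
case E : (lv q.1) => [p|]; first by exists (inr (inl p)).
by have [m mmax] := lv_None E; exists (inl m) => //=; case: mmax.
Qed.

Lemma extension_b : psi_b N.
Proof.
split.
- move=> a b La; apply/seteqP; split=> // -[x|[p|q]] [] //=.
    move: La => /xLtop[[a' La ->]|[p ->]] //= ax bx.
    exact: (node_not_L psiM La ax bx).
  by move: La => /xLtop[[a' La ->]|[p' ->]].
- move=> a b La Lb ab; apply/seteqP; split=> // x [ax bx].
  by apply: ab; exact: xlevel ax bx.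
- move=> [x|[p|q]].
  + case: psiM => _ [_ _ /(_ x)[[b bx]|[a La ax]]] _ _ _; first by left; exists b.
    by right; exists (inl a).
  + by left; exists None.
  + by right; have [a La aq] := qlevel_ex q; exists a.
Qed.

Lemma extension_max : exists m : N, is_max m.
Proof.
have [[m mmax]|nomax] := pselect (exists m : M, is_max m).
  by exists (inl m); exact/max_inl.
by case: new_max => // -[p pall]; exists (inr (inl p)); exact/max_inr.
Qed.

Lemma max_cases (m' : N) : is_max m' -> (exists2 m : M, is_max m & m' = inl m) \/
  exists p, [/\ m' = inr (inl p), forall p', p' = p & ~ exists m : M, is_max m].
Proof.
move=> /[dup] -[/xLtop[[m _ ->]|[p ->]] _] m'max; [left|right].
  by exists m => //; exact/max_inl.
by have [pall nomax] := (max_inr p).1 m'max; exists p.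
Qed.

Lemma D_level_unique a b x y : Ltop a -> V_ M a x -> V_ M a y -> D b x -> D b y -> x = y.
Proof.
move=> La ax ay bx bY; case: (D_chain bx bY) => // h; case: (top_irr psiM La).
  exact: (T_lt psiM La La ax ay h).
exact: (T_lt psiM La La ay ax h).
Qed.

Lemma D_down b x y : T_ M x y -> D b y -> D b x.
Proof.
move=> xy bY; have [a [c [La Lc ax cy ac]]] := T_level psiM xy.
have na := below_nonmax psiM La Lc ac.
have [x' ax' bx'] := D_meet b La na.
suff x'y : T_ M x' y by rewrite (T_pred_unique psiM La ax ax' xy x'y).
case: (D_chain bx' bY) => // [E|h].
  by subst x'; case: (top_irr psiM La); rewrite -{2}(node_level psiM Lc La cy ax').
by case: (top_asym psiM La Lc ac); exact: (T_lt psiM Lc La cy ax' h).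
Qed.

Lemma D_nonmax b x m : is_max m -> V_ M m x -> ~ D b x.
Proof.
move=> mmax mx bx; have [a [La na ax]] := D_node bx.
by apply: na; rewrite (node_level psiM La mmax.1 ax mx).
Qed.

Lemma extension_c : psi_c N.
Proof.
have [m' m'max] := extension_max.
have [Pirr Ptr Ptot] := P_linear.
apply: (psi_c_of_max xlinear xlevel m'max).
- move=> [x|[p|[l b]]] [y|[p'|[l' b']]] [z|[p''|[l'' b'']]] //=.
  + exact: (T_trans psiM).
  + exact: D_down.
  + by move=> bx [_ bz]; apply/(U_pred bz).
  + by move=> bx [<-].
  + move=> [nl /U_top[m mmax my]]; by move/(max_no_T psiM mmax my).
  + by move=> [nl /U_top[m mmax my]] /(D_nonmax mmax my).
  + by move=> [-> ll'] [nl' bz]; split=> // E; move: ll'; rewrite E.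
  + move=> [-> ll'] [-> l'l'']; split=> //; move: ll' l'l''.
    by case: (lv l) (lv l') (lv l'') => [p|] [p'|] [p''|] //=; exact: Ptr.
- move=> [x|[p|[l b]]] [y|[p'|[l' b']]] //=.
  + by move=> /(T_level psiM)[a [c [La Lc ax cy ac]]]; exists (inl a), (inl c).
  + move=> bx; have [a [La na ax]] := D_node bx.
    case E : (lv l') => [p|].
      by exists (inl a), (inr (inl p)); split.
    have [m mmax] := lv_None E; exists (inl a), (inl m); split=> //; first exact: mmax.1.
    by apply: nonmax_lt => // am; apply: na; rewrite am.
  + move=> [nl bU]; have [m mmax my] := U_top bU.
    case E : (lv l) nl => [p|] // _.
    by exists (inr (inl p)), (inl m); split=> //; exact: mmax.1.
  + move=> [_]; case E : (lv l) => [p|]; case E' : (lv l') => [p'|] //= h.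
      by exists (inr (inl p)), (inr (inl p')).
    have [m mmax] := lv_None E'.
    by exists (inr (inl p)), (inl m); split=> //; exact: mmax.1.
- move=> a b y /xLtop[[a' La ->]|[p ->]] /xLtop[[b' Lb ->]|[p' ->]]; case: y => [y|[r|[l c]]] //=.
  + by move=> ay ba; have [x bx xy] := T_pred psiM La Lb ay ba; exists (inl x).
  + move=> [amax lN] ba; have [x bx cx] := D_meet c Lb (below_nonmax psiM Lb La ba).
    by exists (inl x).
  + move=> ay amax; have [l lp] := lv_Some p'; have [c cU] := U_ex p' amax ay.
    by exists (inr (inr (l, c))) => //=; rewrite lp.
  + move=> [amax lN] _; have [l' lp] := lv_Some p'.
    by exists (inr (inr (l', c))) => //=; rewrite lp lN.
  + move=> lp [_ nb]; have [x bx cx] := D_meet c Lb nb.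
    by exists (inl x).
  + move=> lp p'p; have [l' lp'] := lv_Some p'.
    by exists (inr (inr (l', c))) => //=; rewrite lp lp'.
- move=> a x y z /xLtop[[a' La ->]|[p ->]];
    case: x => [x|[r|[l b]]]; case: y => [y|[r'|[l' b']]] //=.
  + case: z => [z|[r''|[l'' b'']]] //= ax ay xz yz.
      by rewrite (T_pred_unique psiM La ax ay xz yz).
    by rewrite (D_level_unique La ax ay xz yz).
  + move=> ax [amax lN]; case: z => [z|[r''|[l'' b'']]] //=; rewrite lN /=; first by move=> _ [].
    by move=> _ [].
  + move=> [amax lN] ay; case: z => [z|[r''|[l'' b'']]] //=; rewrite lN /=; first by case.
    by case.
  + move=> [amax lN] _; case: z => [z|[r''|[l'' b'']]] //=; rewrite lN /=; first by case.
    by case.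
  + move=> lp lp'; have -> : l = l' by apply: lv_inj; rewrite lp lp'.
    case: z => [z|[r''|[l'' b'']]] //=; last by move=> [-> _] [-> _].
    by move=> [_ bz] [_ b'z]; rewrite (U_inj bz b'z).
- move=> a /xLtop[[a' La ->]|[p ->]] a0 ns y z;
    case: y => [y|[r|[l b]]]; case: z => [z|[r'|[l' b']]] //=.
  + move=> ay az same; congr inl; apply: (T_separated psiM La) => // [E|[c ca]|x].
    * by apply: a0; rewrite E.
    * by apply: ns; exists (inl c).
    * exact: (same (inl x)).
  + move=> ay [amax lN] same; case: (lv_None_sep (b := b') lN amax ay).
      by move=> E; apply: a0; rewrite E.
    by move=> x; exact: (same (inl x)).
  + move=> [amax lN] az same; case: (lv_None_sep (b := b) lN amax az).
      by move=> E; apply: a0; rewrite E.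
    by move=> x; apply: iff_sym; exact: (same (inl x)).
  + move=> [amax lN] [_ l'N] same; have -> : l = l' by apply: lv_inj; rewrite lN l'N.
    have bb' : b = b' := D_inj (fun x => same (inl x)).
    by rewrite bb'.
  + move=> lp lp' same; have -> : l = l' by apply: lv_inj; rewrite lp lp'.
    have bb' : b = b' := D_inj (fun x => same (inl x)).
    by rewrite bb'.
- move=> a x /xLtop[[a' La ->]|[p ->]] am; case: x => [x|[r|[l b]]] //=.
  + move=> ax; case: (max_cases m'max) => [[m mmax E]|[p [E pall nomax]]].
      have [|v mv xv] := max_node_above psiM mmax La _ ax; last by exists (inl v); rewrite ?E.
      by move=> E'; apply: am; rewrite E E'.
    have [b bx] := D_through nomax La ax; have [l lp] := lv_Some p.
    by exists (inr (inr (l, b))); rewrite ?E.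
  + move=> [amax lN]; case: (max_cases m'max) => [[m mmax E]|[p [E pall nomax]]].
      by case: am; rewrite E (max_unique psiM amax mmax).
    by case: nomax; exists a'.
  + move=> lp; case: (max_cases m'max) => [[m mmax E]|[p' [E pall nomax]]].
      have [v bv] := U_total p b mmax; have [m2 m2max m2v] := U_top bv.
      exists (inl v); last by rewrite lp.
      by rewrite E (max_unique psiM mmax m2max).
    by case: am; rewrite E (pall p).
Qed.

Lemma extension_d : psi_d N.
Proof.
case: psiM => _ _ _ [cinj cP] _; split; first by move=> m n [/cinj].
move=> b nb [x|[p|q]] /=; split.
- by move/(cP b nb) => [n ->]; exists n.
- by move=> [n [->]]; apply/(cP b nb); exists n.
- by move=> bE; case: nb; rewrite bE; exact: pos_top.
- by move=> [].
- by [].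
- by move=> [].
Qed.

Lemma extension_e : psi_e N.
Proof.
split.
  move=> b bt; have [irr tr tot] := L_linear psiM b; split.
  - by move=> [x|[p|q]] //=; exact: irr.
  - by move=> [x|[p|q]] [y|[p'|q']] [z|[p''|q'']] //= Lx Ly Lz; exact: tr.
  - move=> [x|[p|q]] [y|[p'|q']] //= Lx Ly.
    by case: (tot x y Lx Ly) => [h|->|h]; [exact: Or31|exact: Or32|exact: Or33].
move=> b lb; have bN : b <> None.
  by move=> E; have [_ []] := lb; exists (Some None); rewrite E; exact: is_succ_None.
apply/seteqP; split=> [[x|[p|q]] //= bx|[x|[p|q]] [c /= cb cx]] //.
- by move: bx; rewrite (L_limit psiM lb) => -[c cb cx]; exists c.
- by rewrite (L_limit psiM lb); exists c.
- by move: cb; rewrite cx; case: (b).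
Qed.

Lemma extension_f : psi_f N.
Proof.
move=> b b' bb' x; have bN : sval b' <> None.
  by case: b' bb' => [[b'|] ?] // [_ /(_ (Some None) I)] [].
case: x => [x|[p|q]] //= bx.
have Fs : surjection_graph (F_ M (Some b) x) (L_ M (Some (Some b)))
    [set y | L_ M (sval b') y /\ (y = x \/ lt_ M b' y x)].
  by case: psiM => _ _ _ _ [_ h _]; exact: h.
apply: (surjection_graph_map (e := inl) _ Fs).
- by move=> y z [].
- by move=> [y|[p|q]] /=; split=> //; [exists y|move=> [z Lz [<-]]|move=> []|move=> []].
- move=> [y|[p|q]] /=; split=> //.
  + by move=> [Ly h]; exists y => //; split=> //; case: h => [[->]|]; [left|right].
  + by move=> [z [Lz h] [<-]]; split=> //; case: h => [->|]; [left|right].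
  + by move=> [].
  + by move=> [].
  + by move=> [].
  + by move=> [].
- move=> [y|[p|q]] z; last 2 first.
  + by split=> // -[? [? []]].
  + by split=> // -[? [? []]].
  case: z => [z|[p|q]]; split=> //; try by move=> [? [? []]].
    by move=> h; exists y, z.
  by move=> [y' [z' [h [<-] [<-]]]].
Qed.

Lemma extension_g : psi_g N.
Proof.
move=> x Lx nx.
move: Lx nx => /xLtop[[a La ->]|[p ->]] nx.
  have na : ~ is_max a by move=> amax; apply: nx; exact/max_inl.
  split.
    apply: (surjection_graph_map (e := inl) _ (Ftop_surj psiM La na)).
    - by move=> y z [].
    - by move=> [y|[p|q]] /=; split=> //; [exists y|move=> [z Lz [<-]]|move=> []|move=> []].
    - move=> [y|[p|q]] /=; split.
      + by move=> [Ly h]; exists y => //; split=> //; case: h => [[->]|]; [left|right].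
      + by move=> [z [Lz h] [<-]]; split=> //; case: h => [->|]; [left|right].
      + by move=> [_ [//|/na]].
      + by move=> [].
      + by move=> [].
      + by move=> [].
    - move=> [y|[p|q]] z; last 2 first.
      + by split=> // -[? [? []]].
      + by split=> // -[? [? []]].
      case: z => [z|[p|q]]; split=> //; try by move=> [? [? []]].
        by move=> h; exists y, z.
      by move=> [y' [z' [h [<-] [<-]]]].
  apply: (surjection_graph_map (e := inl) _ (G_surj psiM La na)).
  - by move=> y z [].
  - by move=> [y|[p|q]] /=; split=> //; [exists y|move=> [z Lz [<-]]|move=> []|move=> []].
  - move=> [y|[p|q]] /=; split=> //.
    + by exists y.
    + by move=> [z az [<-]].
    + by move=> [].
    + by move=> [/na].
    + by move=> [].
  - move=> [y|[p|q]] z; last 2 first.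
    + by split=> // -[? [? []]].
    + by split=> // -[? [? []]].
    case: z => [z|[p|q]]; split=> //; try by move=> [? [? []]].
      by move=> h; exists y, z.
    by move=> [y' [z' [h [<-] [<-]]]].
have card_le : forall A : set N, A #<= L_ N (Some None).
  move=> A; apply: card_le_trans (card_leT A) _.
  apply: (card_le_trans (B := L_ M (Some None))); last first.
    by apply: (@card_le_inj _ _ _ _ inl) => // y z _ _ [].
  apply: P_card; case: (P_succ p) => [[p' [pp' _]]|h]; first by exists p, p'.
  by case: nx; exact/max_inr.
split; (apply: surj_relP; last exact: card_le).
  by exists (inr (inl p)); split=> //; left.
have [b _] := Br_inh; have [l lp] := lv_Some p.
by exists (inr (inr (l, b))).
Qed.

Lemma extension_psi : psi N.
Proof.
split; [exact: extension_a|exact: extension_b|exact: extension_c|exact: extension_d|].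
by split; [exact: extension_e|exact: extension_f|exact: extension_g].
Qed.

Lemma maximal_no_extension : maximal_model M -> P + Lq * Br -> False.
Proof. by move=> [_ Mmax] w; have [x] := Mmax N inl extension_psi extension_embedding (inr w). Qed.

End TreeExtension.

(** Otherwise a maximal level could be added, whose nodes are the maximal branches
    of the tree. *)
Lemma maximal_has_max (al : Ord) (M : structure al) : maximal_model M ->
  exists m : M, is_max m.
Proof.
move=> Mmax; have psiM := Mmax.1; apply: contrapT => nomax.
have na (a : M) : ~ is_max a by move=> amax; apply: nomax; exists a.
have pruned (x : M) : nodes x -> exists2 B : set M, maximal_branch B & B x.
  by case: psiM => _ _ [_ _ _ _ h] _ _; exact: h.
have through a (x : M) : Ltop a -> V_ M a x -> exists b : {B | @maximal_branch _ M B}, sval b x.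
  move=> La ax; have [|B mB Bx] := pruned x; first by exists a.
  by exists (exist _ B mB).
have Lz := top_zero psiM.
have [v zv] := nonmax_node_ex psiM Lz (na _).
have [b0 b0v] := through _ _ Lz zv.
apply: (@maximal_no_extension al M psiM unit unit {B | @maximal_branch _ M B}
  (fun _ _ => False) Some (fun b => sval b) (fun _ _ => False)
  _ _ _ _ _ _ _ _ _ _ _ _ _ _ _ _ _ _ _ _ Mmax (inl tt)) => //.
- by split=> [x _ []|x y z _ _ _ []|[] [] _ _]; exact: Or32.
- by move=> []; right; split=> // -[].
- by right; exists tt => -[].
- by move=> p; exists p.
- by move=> [B mB] x; have [[Bn _ _] _] := mB; move=> /Bn[a La ax]; exists a.
- by move=> [B mB]; have [[_ Bch _] _] := mB.
- by move=> [B mB] a La _; have [_ Bmeet] := mB; have [x [Bx ax]] := Bmeet a La; exists x.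
- by move=> b b' h; apply: sval_inj; apply/seteqP; split=> x /h.
- by move=> _ m w /na.
- by move=> _ m w /na.
- by move=> [p [p' []]].
Qed.

(** If a branch below the maximal level were not realized there, a new node
    could be put on top of it; when the maximal level is also the first one,
    this applies to the empty branch. *)
Lemma maximal_branch_realized (al : Ord) (M : structure al) (m : M) (B : set M) :
  maximal_model M -> is_max m -> branch_below m B ->
  m <> zero_ M /\ exists2 v, V_ M m v & forall x, T_ M x v <-> B x.
Proof.
move=> Mmax mmax [Bn Bch Bm]; have psiM := Mmax.1; apply: contrapT => none.
have nm (a : M) : Ltop a -> ~ is_max a <-> a <> m.
  by move=> La; split=> [na E|am amax]; [apply: na; rewrite E|apply: am; exact: max_unique].
apply: (@maximal_no_extension al M psiM void unit unit
  (fun _ _ => False) (fun=> None) (fun _ => B) (fun _ _ => False)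
  _ _ _ _ _ _ _ _ _ _ _ _ _ _ _ _ _ _ _ _ Mmax (inr (tt, tt))) => //.
- by left; exists m.
- by move=> [] [].
- by exists m.
- by move=> _ x /Bn[a [La am ax]]; exists a; split=> //; exact/nm.
- by move=> _ a La /(nm a La) am; have [x [Bx ax]] := Bm a La am; exists x.
- by move=> [] [].
- by move=> nomax; case: nomax; exists m.
- move=> _ _ m' v _ m'max m'v m'0 h; apply: none.
  have E := max_unique psiM m'max mmax; subst m'.
  by split=> //; exists v.
- by move=> [[]].
Qed.

Lemma maximal_max_nonzero (al : Ord) (M : structure al) (m : M) :
  maximal_model M -> is_max m -> m <> zero_ M.
Proof.
move=> Mmax mmax m0; have psiM := Mmax.1.
suff [] : m <> zero_ M /\ exists2 v, V_ M m v & forall x, T_ M x v <-> (set0 : set M) x by [].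
apply: maximal_branch_realized => //; split=> [x []|x y []|a La am].
case: (top_zero_min psiM La) => [E|h]; first by case: am; rewrite E.
by case: (top_asym psiM La mmax.1) => //; [exact: nonmax_lt|rewrite m0].
Qed.

Lemma maximal_complete (al : Ord) (M : structure al) (m : M) :
  maximal_model M -> is_max m -> complete_at m.
Proof.
by move=> Mmax mmax B Bb; have [_ [v mv h]] := maximal_branch_realized Mmax mmax Bb; exists v.
Qed.

Lemma nodes_below_branch (al : Ord) (M : structure al) (m v : M) : psi M ->
  is_max m -> V_ M m v -> branch_below m [set x | T_ M x v].
Proof.
move=> psiM mmax mv; split.
- move=> x xv; have [a [b [La Lb ax bv ab]]] := T_level psiM xv.
  have E := node_level psiM Lb mmax.1 bv mv; subst b.
  by exists a; split=> // E; subst a; exact: (top_irr psiM La ab).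
- exact: T_chain.
- move=> a La am; have [x ax xv] := T_pred psiM mmax.1 La mv (nonmax_lt mmax La am).
  by exists x.
Qed.

(** Otherwise $\omega$ new levels, each a copy of the maximal one, could be
    inserted just below it. *)
Lemma maximal_not_small (al : Ord) (M : structure al) : maximal_model M ->
  ℵ (Some None : idx al) #<= L_ M (Some None) ->
  ~ ([set: M] #<= ℵ (Some None : idx al)).
Proof.
move=> Mmax Lbig Msmall; have psiM := Mmax.1.
have [m mmax] := maximal_has_max Mmax.
have m0 := maximal_max_nonzero Mmax mmax.
have Lm := mmax.1.
have sep (v v' : M) : V_ M m v -> V_ M m v' -> (forall x, T_ M x v <-> T_ M x v') -> v = v'.
  by move=> mv mv' h; exact: (T_separated psiM Lm m0 (max_not_succ psiM mmax) mv mv' h).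
have nz : ~ is_max (zero_ M) by move=> zmax; apply: m0; exact: max_unique zmax.
have ltz : lttop (zero_ M) m by apply: nonmax_lt => //; [exact: top_zero|move=> E; apply: m0].
have [v mv] : exists v, V_ M m v.
  have Lz := top_zero psiM.
  have [x zx] := nonmax_node_ex psiM Lz nz.
  have [|v mv _] := max_node_above psiM mmax Lz _ zx; first by move=> E; apply: m0.
  by exists v.
apply: (@maximal_no_extension al M psiM nat nat {v | V_ M m v}
  (fun p q => p < q) Some (fun b => [set x | T_ M x (sval b)]) (fun b v => sval b = v)
  _ _ _ _ _ _ _ _ _ _ _ _ _ _ _ _ _ _ _ _ Mmax (inl 0)) => //.
- by have [] := nat_wo.
- move=> p; left; exists p.+1; split; first exact: leqnn.
  by move=> q; rewrite ltnS leq_eqVlt => /orP[/eqP|]; [left|right].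
- by left; exists m.
- by move=> p; exists p.
- move=> [w mw] x /= xw; have [h _ _] := nodes_below_branch psiM mmax mw.
  have [a [La am ax]] := h x xw; exists a; split=> // amax; apply: am; exact: max_unique.
- by move=> [w mw] x y; exact: T_chain.
- move=> [w mw] a La na; have [_ _ h] := nodes_below_branch psiM mmax mw.
  have [|x [xw ax]] := h a La; last by exists x.
  by move=> E; apply: na; rewrite E.
- by move=> [w mw] [w' mw'] h; apply: sval_inj; exact: sep mw mw' h.
- by move=> nomax; case: nomax; exists m.
- by exists (exist _ v mv).
- by move=> [w mw] _ /= <-; exists m.
- by move=> [w mw] _ /= <-.
- by move=> b b' w e e'; apply: sval_inj; rewrite e e'.
- move=> _ m' w m'max; rewrite (max_unique psiM m'max mmax) => mw.
  by exists (exist _ w mw).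
- by move=> _ m' [w mw] _; exists w.
- move=> _; apply: card_le_trans Lbig.
  have inf := @aleph_infinite (idx al) (Some None).
  apply: card_le_sumT => //; apply: card_le_sumT => //; apply: card_le_prodT => //.
  apply: card_le_trans Msmall.
  apply: (@card_le_inj _ _ _ _ (fun x : {v | V_ M m v} => sval x)) => //.
  by move=> x y _ _; exact: sval_inj.
Qed.

(** One element is put on top of $L_\beta$, for $\beta=\gamma+1$. *)
Section PieceExtension.
Variables (al : Ord) (M : structure al) (g b : OrdS al).
Hypothesis psiM : psi M.
Hypothesis gb : is_succ g b.
Hypothesis M_max : exists m : M, is_max m.
Hypothesis Lg_inf : [set: nat] #<= L_ M (Some g).
Hypothesis Lb_le : L_ M (Some b) #<= L_ M (Some g).

(** At a limit, $L_\delta$ is the union of the earlier sets, so an element added to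
    $L_\beta$ also enters every later $L_\delta$ of limit index. *)
Definition has_new (d : idx al) : Prop :=
  d = Some b \/ is_limit d /\ ord_lt (Some b : idx al) d.

Lemma has_new_top : ~ has_new None.
Proof. by case=> // -[[_ ns] _]; apply: ns; exists (Some None); exact: is_succ_None. Qed.

Lemma has_new_succ (c d : OrdS al) : is_succ c d -> has_new (Some d) -> d = b /\ c = g.
Proof.
move=> cd [[E]|[/is_limit_Some[_ ns] _]]; last by case: ns; exists c.
by subst d; split=> //; exact: is_succ_inj gb.
Qed.

Lemma has_new_limit (d : idx al) : is_limit d -> has_new d <-> exists2 c, ord_lt c d & has_new c.
Proof.
move=> ld; split=> [[E|[_ bd]]|[c cd [E|[_ bc]]]].
- by move: ld; rewrite E => /is_limit_Some[_ []]; exists g.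
- by exists (Some b) => //; left.
- by right; split=> //; rewrite -E.
- by right; split=> //; exact: ord_trans cd.
Qed.

Let pick_node (x : M) : exists y, (exists v, V_ M x v) -> V_ M x y.
Proof.
have [[v xv]|none] := pselect (exists v, V_ M x v); first by exists v.
by exists x.
Qed.

Definition ypoint : Type := option M.
Definition yL (d : idx al) : set ypoint := [set x | if x is Some x then L_ M d x else has_new d].
Definition ylt (d : {d : idx al | pos d}) (x y : ypoint) : Prop :=
  match x, y with
  | Some x, Some y => lt_ M d x y
  | Some _, None => True
  | None, _ => False
  end.
Definition lift2 (R : M -> M -> Prop) (x y : ypoint) : Prop :=
  if x is Some x then if y is Some y then R x y else False else False.
(** The surjection that belongs to an old [x] sends the new element to [x] itself,
    which always lies in the codomain. *)
Definition yF (d : OrdS al) (x y z : ypoint) : Prop :=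
  match x, y, z with
  | Some x, Some y, Some z => F_ M d x y z
  | Some x, None, Some z => has_new (Some d) /\ z = x
  | None, _, _ => surj_rel (yL (Some g)) (yL (Some b)) y z
  | _, _, _ => False
  end.
Definition yG (x y z : ypoint) : Prop :=
  match x, y, z with
  | Some x, Some y, Some z => G_ M x y z
  | Some x, None, Some z => has_new (Some None) /\ z = sval (cid (pick_node x))
  | _, _, _ => False
  end.
Definition piece_extension : structure al :=
  @Structure al ypoint (Some (zero_ M)) (fun n => Some (c_ M n)) yL ylt
    (lift2 (S_ M)) (lift2 (V_ M)) (lift2 (T_ M)) yF yG.
Local Notation N := piece_extension.

Lemma piece_extension_embedding : @embedding al M N Some.
Proof. by split; [move=> x y []|split]. Qed.

Lemma yLtop (x : N) : Ltop x <-> exists2 a, Ltop a & x = Some a.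
Proof.
case: x => [x|]; split=> //; first by exists x.
- by move=> [a La [->]].
- by move/has_new_top.
- by move=> [].
Qed.

Lemma ymax (a : M) : @is_max al N (Some a) <-> is_max a.
Proof.
split=> -[La amax]; split=> //.
  by move=> x Lx; case: (amax (Some x) Lx) => [[]|]; [left|right].
by move=> x /yLtop[c Lc ->]; case: (amax c Lc) => [->|]; [left|right].
Qed.

Lemma ysucc (a c : M) : @succ_of al N (Some a) (Some c) <-> succ_of a c.
Proof.
split=> -[La Lc ac h]; split=> //.
  by move=> x Lx xc; case: (h (Some x) Lx xc) => [[]|]; [left|right].
by move=> x /yLtop[d Ld ->] dc; case: (h d Ld dc) => [->|]; [left|right].
Qed.

Lemma ylinear (d : {d : idx al | pos d}) : linear_on (ylt d) (yL (sval d)).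
Proof.
have [irr tr tot] := L_linear psiM d; split.
- by move=> [x|] Lx // h; exact: (irr x Lx h).
- by move=> [x|] [y|] [z|] // Lx Ly Lz h h'; exact: (tr x y z Lx Ly Lz h h').
- move=> [x|] [y|] //= Lx Ly; [|exact: Or31|exact: Or33|exact: Or32].
  by case: (tot x y Lx Ly) => [h|->|h]; [exact: Or31|exact: Or32|exact: Or33].
Qed.

Lemma yT_level (x y : N) : T_ N x y ->
  exists a b, [/\ Ltop a, Ltop b, V_ N a x, V_ N b y & lttop a b].
Proof.
case: x y => [x|] [y|] //= xy; have [a [c [La Lc ax cy ac]]] := T_level psiM xy.
by exists (Some a), (Some c).
Qed.

Lemma piece_extension_psi : psi N.
Proof.
have psiN_a : psi_a N.
  split.
  - exact: (ylinear (exist _ (top al) (pos_top al))).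
  - split; first exact: (top_zero psiM).
    move=> x /yLtop[a La ->].
    by case: (top_zero_min psiM La) => [->|]; [left|right].
  - move=> x /yLtop[a La ->] nx.
    have na : ~ is_max a by move=> amax; apply: nx; exact/ymax.
    by have [c ac] := nonmax_succ psiM La na; exists (Some c); exact/ysucc.
  - move=> x y; split; first by case: x y => [a|] [c|] //= /(succE psiM) ac; exact/ysucc.
    by move=> /[dup] -[/yLtop[a La ->] /yLtop[c Lc ->] _ _] /ysucc ac; exact/(succE psiM).
  - move=> x /[dup] -[/yLtop[a La ->] _] /ymax amax [[c|]] //= ca.
    by apply: (max_not_succ psiM amax); exists c.
have psiN_b : psi_b N.
  split.
  - move=> x d /yLtop[a La ->]; apply/seteqP; split=> // -[y|] [] //= ay dy.
    exact: (node_not_L psiM La ay dy).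
  - move=> x y /yLtop[a La ->] /yLtop[c Lc ->] ac; apply/seteqP; split=> // -[z|] [] //= az cz.
    by apply: ac; rewrite (node_level psiM La Lc az cz).
  - move=> [x|]; last by left; exists (Some b); left.
    case: psiM => _ [_ _ /(_ x)[[d dx]|[a La ax]]] _ _ _; first by left; exists d.
    by right; exists (Some a).
split=> //.
- have [m mmax] := M_max.
  apply: (@psi_c_of_max al N (Some m)).
  + by case: psiN_a.
  + move=> x y z /yLtop[a La ->] /yLtop[c Lc ->]; case: z => [z|] //= az cz.
    by rewrite (node_level psiM La Lc az cz).
  + exact/ymax.
  + by move=> [x|] [y|] [z|] //=; exact: T_trans.
  + exact: yT_level.
  + move=> x y z /yLtop[a La ->] /yLtop[c Lc ->]; case: z => [z|] //= az ca.
    by have [w cw wz] := T_pred psiM La Lc az ca; exists (Some w).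
  + move=> x [y|] [z|] [w|] //= /yLtop[a La ->] //= ay az yw zw.
    by rewrite (T_pred_unique psiM La ay az yw zw).
  + move=> x /yLtop[a La ->] a0 ns [y|] [z|] //= ay az same; congr Some.
    apply: (T_separated psiM La) => // [E|[c ca]|w].
    * by apply: a0; rewrite E.
    * by apply: ns; exists (Some c).
    * exact: (same (Some w)).
  + move=> x [y|] /yLtop[a La ->] //= am ay.
    have [|v mv yv] := max_node_above psiM mmax La _ ay; last by exists (Some v).
    by move=> E; apply: am; rewrite E.
- case: psiM => _ _ _ [cinj cP] _; split; first by move=> i j [/cinj].
  move=> d nd [x|] /=; split=> //.
  + by move/(cP d nd) => [n ->]; exists n.
  + by move=> [n [->]]; apply/(cP d nd); exists n.
  + case=> [E|[[]] //]; case: nd; rewrite E; exists (Some g); exact: gb.1.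
  + by move=> [].
split.
- split; first by move=> d _; exact: ylinear.
  move=> d ld; apply/seteqP; split=> [[x|] /= dx|[x|] [c cd cx]] /=.
  + by move: dx; rewrite (L_limit psiM ld) => -[c cd cx]; exists c.
  + by move: dx => /(has_new_limit ld)[c cd cx]; exists c.
  + by rewrite (L_limit psiM ld); exists c.
  + by apply/(has_new_limit ld); exists c.
- move=> c d' cd' x dx.
  have [d dE] : exists d, sval d' = Some d.
    case: d' cd' {dx} => [[d|] ?] cd'; first by exists d.
    by case: cd' => _ /(_ (Some None) I)[].
  have cd : is_succ (Some c : OrdS al) d by apply/is_succ_Some; rewrite -dE.
  case: d' dE cd' dx => [d'' pd] /= dE cd' dx; subst d''.
  case: x dx => [x|] dx /=; last first.
    have [E1 E2] := has_new_succ cd dx; rewrite E2; subst d.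
    have -> : [set y : ypoint | yL (Some b) y /\
                (y = None \/ ylt (exist _ _ pd) y None)] = yL (Some b).
      apply/seteqP; split=> [y []//|y by_]; split=> //.
      by case: y by_ => [y|] _; [right|left].
    apply: surj_relP; first by exists None; left.
    have X_inf : [set: nat] #<= [set: {x | L_ M (Some g) x}].
      by rewrite (card_le_eqr (card_subtype _)).
    apply: (@card_le_trans _ _ _ [set: {x | L_ M (Some g) x}]); last first.
      rewrite (card_le_eql (card_subtype _)).
      by apply: (@card_le_inj _ _ _ _ Some) => // ? ? _ _ [].
    have -> : yL (Some b) = Some @` L_ M (Some b) `|` [set None].
      apply/seteqP; split=> [y|y [[z bz <-]|->]]; [|exact: bz|by left].
      by case: y => [y|] by_; [left; exists y|right].
    apply: card_leU => //; last exact: card_le_trans (countable1 _) X_inf.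
    by apply: card_le_trans (card_image_le _ _) _; rewrite (card_le_eqr (card_subtype _)).
  have [RAB tot surj] := F_surj psiM pd cd dx.
  split.
  + move=> [y|] [z|] //=.
      by move=> /RAB[Ly [Lz h]]; split=> //; split=> //; case: h => [->|]; [left|right].
    by move=> [hn ->]; split=> //; split=> //; left.
  + move=> [y|] /= Ly.
      have [z [Rz uz]] := tot y Ly; exists (Some z); split=> // -[w|] //= Rw.
      by rewrite (uz w).
    exists (Some x); split=> // -[w|] //= [_ ->] //.
  + move=> [z|] [/= Lz h]; last by case: h.
    have [|y Ry] := surj z; last by exists (Some y).
    by split=> //; case: h => [[->]|]; [left|right].
- move=> x /yLtop[a La ->] nx.
  have na : ~ is_max a by move=> amax; apply: nx; exact/ymax.
  split.
    have [RAB tot surj] := Ftop_surj psiM La na.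
    split.
    + move=> [y|] [z|] //=.
        by move=> /RAB[Ly [Lz h]]; split=> //; split=> //; case: h => [->|]; [left|right].
      by move=> [hn ->]; split=> //; split=> //; left.
    + move=> [y|] /= Ly.
        have [z [Rz uz]] := tot y Ly; exists (Some z); split=> // -[w|] //= Rw.
        by rewrite (uz w).
      exists (Some a); split=> // -[w|] //= [_ ->] //.
    + move=> [z|] [/= Lz h]; last by case: h.
      have [|y Ry] := surj z; last by exists (Some y).
      by split=> //; case: h => [[->]|]; [left|right].
  have [RAB tot surj] := G_surj psiM La na.
  have pickP : V_ M a (sval (cid (pick_node a))).
    by apply: (svalP (cid (pick_node a))); exact: nonmax_node_ex.
  split.
  + move=> [y|] [z|] //=; first by move=> /RAB[].
    by move=> [hn ->].
  + move=> [y|] /= Ly.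
      have [z [Rz uz]] := tot y Ly; exists (Some z); split=> // -[w|] //= Rw.
      by rewrite (uz w).
    exists (Some (sval (cid (pick_node a)))); split=> // -[w|] //= [_ ->] //.
  + move=> [z|] //= az; have [y Ry] := surj z az; by exists (Some y).
Qed.

End PieceExtension.

(** Otherwise, for the least $\beta$ such that $L_\beta$ is smaller than
    $\aleph_\beta$, one element could be put on top of $L_\beta$. *)
Lemma maximal_L_big (al : Ord) (M : structure al) (b : OrdS al) : maximal_model M ->
  ℵ (Some b : idx al) #<= L_ M (Some b).
Proof.
move=> Mmax; have psiM := Mmax.1.
elim/(well_founded_ind (@ord_wf (OrdS al))): b => b IH.
case: (ord_zero_succ_limit b) => [nb|[g gb]|lb].
- have nb' : ~ pos (Some b : idx al) by move/pos_Some.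
  apply: card_le_trans (aleph_zero_le nb' (card_lexx _)) _.
  have [cinj _] : psi_d M by case: psiM.
  apply: (@card_le_inj _ _ _ _ (c_ M)) => [n _|m n _ _ /cinj //].
  by apply/(L_zero psiM _ nb'); exists n.
- have Lg := IH g gb.1.
  apply: contrapT => nle.
  have Lb_le : L_ M (Some b) #<= L_ M (Some g).
    apply: card_le_trans Lg; apply: contrapT => nle'; apply: nle.
    by apply: (aleph_succ_le (i := Some g : idx al)) => //; exact/is_succ_Some.
  have Lg_inf := card_le_trans (aleph_infinite (Some g : idx al)) Lg.
  have psiN := piece_extension_psi psiM gb (maximal_has_max Mmax) Lg_inf Lb_le.
  by have [x] := Mmax.2 _ _ psiN (piece_extension_embedding M g b) None.
- apply: (@aleph_limit_le (idx al)); first exact/is_limit_Some.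
  move=> [c|] //= cb; apply: card_le_trans (IH c cb) _.
  rewrite (L_limit psiM (b := Some b)) ?is_limit_Some //.
  by apply: subset_card_le => x cx; exists (Some c).
Qed.

(** * The cardinality of a maximal model *)

(** A cofinal subset of least cardinality, enumerated by an initial ordinal;
    the elements larger than all earlier ones form a cofinal subset on which
    the order agrees with the enumeration. *)
Lemma ex_cofinal (X : Type) (lt : X -> X -> Prop) (D : set X) :
  linear_on lt D -> D !=set0 -> (forall d, D d -> exists2 d', D d' & lt d d') ->
  exists C, [/\ C `<=` D, forall d, D d -> exists2 c, C c & lt d c,
    well_order_on lt C & forall c, C c -> card_lt [set c' | C c' /\ lt c' c] C].
Proof.
move=> [irr tr tot] [d0 Dd0] nomax.
pose cofinal (C : set X) := C `<=` D /\ forall d, D d -> exists2 c, C c & lt d c.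
have [[C0 C0P] C0min] := @ex_least_card {C | cofinal C} (fun C => {x | sval C x})
  (exist _ D (conj (@subset_refl _ D) nomax)).
have [C0D C0cof] := C0P.
have [W [Winit Wcard]] := ex_initial {x | C0 x}.
have W_C0 : [set: W] #= C0 by rewrite (card_eql Wcard); exact: card_subtype.
have [c0 C0c0 _] := C0cof d0 Dd0.
have C0W : C0 #<= [set: W] by rewrite (card_le_eqr W_C0); exact: card_lexx.
have [w0 _] : exists w : W, True.
  have [f _ _] : exists2 y, [set: W] y & True.
    move: C0W => /card_leP[f]; by exists (val (f (exist _ c0 (mem_set C0c0)))).
  by exists f.
have [f [_ finj]] := card_le_fun w0 C0W.
pose C := [set c | C0 c /\ forall c', C0 c' -> ord_lt (f c') (f c) -> lt c' c].
have Ccof d : D d -> exists2 c, C c & lt d c.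
  move=> Dd; have [c1 C0c1 dc1] := C0cof d Dd.
  have [w [c [C0c dc cw]] wmin] := @ord_least W (fun w => exists c, [/\ C0 c, lt d c & f c = w])
    (ex_intro _ (f c1) (ex_intro _ c1 (And3 C0c1 dc1 erefl))).
  exists c => //; split=> // c' C0c' c'c.
  have [dc'|ndc'] := pselect (lt d c').
    case: (ord_lt_nle c'c); case: (wmin (f c')) => [|E|h]; first by exists c'.
      by left; rewrite cw.
    by right; rewrite cw.
  case: (tot c' d (C0D c' C0c') Dd) => [h|->|] //.
  by apply: (tr c' d c) => //; exact: C0D.
have CD : C `<=` D by move=> c [/C0D].
have ltf c c' : C c -> C c' -> lt c c' -> ord_lt (f c) (f c').
  move=> Cc Cc' cc'; have Dc := CD c Cc; have Dc' := CD c' Cc'.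
  case: (ord_total (f c) (f c')) => // [E|c'c].
    have E' : c = c' by apply: finj => //; [exact: Cc.1|exact: Cc'.1].
    by case: (irr c) => //; rewrite {2}E'.
  by case: (irr c) => //; apply: (tr c c' c) => //; exact: Cc.2 Cc'.1 c'c.
exists C; split=> //.
- split.
    by split=> [x /CD|x y z /CD Dx /CD Dy /CD Dz|x y /CD Dx /CD Dy];
      [exact: irr|exact: tr|exact: tot].
  move=> Y YC [y0 Yy0].
  have [w [y Yy yw] wmin] := @ord_least W (fun w => exists2 y, Y y & f y = w)
    (ex_intro _ (f y0) (ex_intro2 _ _ y0 Yy0 erefl)).
  exists y => // z Yz; case: (wmin (f z)) => [|E|h]; first by exists z.
    by left; apply: finj; [exact: (YC z Yz).1|exact: (YC y Yy).1|rewrite yw].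
  by right; apply: (YC z Yz).2; [exact: (YC y Yy).1|rewrite yw].
- move=> c Cc.
  apply: (@card_lt_le_trans _ _ _ _ [set: W]).
    apply: card_le_lt_trans (Winit (f c)).
    apply: (@card_le_inj _ _ _ _ f) => [c' [Cc' c'c]|x y [Cx _] [Cy _]]; first exact: ltf.
    by apply: finj; [exact: Cx.1|exact: Cy.1].
  rewrite (card_le_eql Wcard) -(card_le_eqr (card_subtype C)).
  exact: (C0min (exist _ C (conj CD Ccof))).
Qed.

Section MaximalModel.
Variables (al : Ord) (al_countable : countable [set: al]).
Variables (M : structure al) (m : M).
Hypothesis psiM : psi M.
Hypothesis m_max : is_max m.
Hypothesis m_nonzero : m <> zero_ M.
Hypothesis m_complete : complete_at m.
Hypothesis V_big : ~ (V_ M m #<= ℵ (None : idx al)).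

Let lower : set M := [set a | Ltop a /\ a <> m].

Lemma lower_nonmax a : lower a -> ~ is_max a.
Proof. by move=> [_ am] amax; apply: am; exact: max_unique. Qed.

Lemma lower_linear : linear_on (@lttop al M) lower.
Proof.
split=> [x [Lx _]|x y z [Lx _] [Ly _] [Lz _]|x y [Lx _] [Ly _]].
- exact: top_irr.
- exact: (top_trans psiM Lx Ly Lz).
- exact: (top_total psiM Lx Ly).
Qed.

Lemma lower_lt_max a : lower a -> lttop a m.
Proof. by move=> [La am]; exact: nonmax_lt. Qed.

Lemma top_separated v v' : V_ M m v -> V_ M m v' ->
  (forall a, lower a -> exists2 c, lower c /\ lttop a c &
     exists2 u, V_ M c u & T_ M u v /\ T_ M u v') -> v = v'.
Proof.
move=> mv mv' h; apply: (T_separated psiM m_max.1 m_nonzero (max_not_succ psiM m_max) mv mv').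
have half w w' : V_ M m w -> (forall a, lower a -> exists2 c, lower c /\ lttop a c &
     exists2 u, V_ M c u & T_ M u w /\ T_ M u w') -> forall x, T_ M x w -> T_ M x w'.
  move=> mw h' x xw; have [n_ _ _] := nodes_below_branch psiM m_max mw.
  have [a [La am ax]] := n_ x xw.
  have [c [[Lc _] ac] [u cu [uw uw']]] := h' a (conj La am).
  exact: (T_trans psiM) (T_below psiM La Lc ax cu ac xw uw) uw'.
move=> x; split; first exact: half.
apply: half => // a /h[c cP [u cu [uv uv']]]; by exists c => //; exists u.
Qed.

Lemma pred_ex a v : lower a -> V_ M m v -> exists x, V_ M a x /\ T_ M x v.
Proof.
move=> la mv; have [x ax xv] := T_pred psiM m_max.1 la.1 mv (lower_lt_max la).
by exists x.
Qed.

(** When the levels below [m] have countable cofinality, the elements of the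
    top level are the branches of a tree of height $\omega$. *)
Lemma countable_cofinality_card (a : nat -> M) :
  (forall n, lower (a n)) -> (forall n, lttop (a n) (a n.+1)) ->
  (forall d, lower d -> exists n, lttop d (a n)) ->
  V_ M m #= [set: nat -> @aleph_below (idx al) (Some None)].
Proof.
move=> la ainc acof; set L := @aleph_below (idx al) (Some None).
have L_inf : [set: nat] #<= [set: L] := aleph_infinite _.
have La n : Ltop (a n) := (la n).1.
have nodes_small : \bigcup_(n in [set: nat]) V_ M (a n) #<= [set: L].
  apply: card_le_bigcup => // n _; apply: V_card_le => //; exact: lower_nonmax.
have [l0 _] : [set: L] !=set0 by apply: infinite_setN0; apply/infiniteP.
have [e [_ einj]] := card_le_fun l0 nodes_small.
pose Br := {v | V_ M m v}.
pose pr n (v : Br) := sval (cid (pred_ex (la n) (svalP v))).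
have prV n v : V_ M (a n) (pr n v) by rewrite /pr; case: cid => x [].
have prT n v : T_ M (pr n v) (sval v) by rewrite /pr; case: cid => x [].
have prU n v x : V_ M (a n) x -> T_ M x (sval v) -> x = pr n v.
  by move=> ax xv; exact: (T_pred_unique psiM (La n) ax (prV n v) xv (prT n v)).
have einj' n v v' : e (pr n v) = e (pr n v') -> pr n v = pr n v'.
  by move=> E; apply: einj => //; exists n => //; exact: prV.
have prS n v : T_ M (pr n v) (pr n.+1 v).
  exact: (T_below psiM (La n) (La n.+1) (prV n v) (prV n.+1 v) (ainc n) (prT n v) (prT n.+1 v)).
have sep (v v' : Br) : (forall n, e (pr n v) = e (pr n v')) -> v = v'.
  move=> h; apply: sval_inj; apply: (top_separated (svalP v) (svalP v')) => d ld.
  have [n dn] := acof d ld; exists (a n); first by split.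
  exists (pr n v); first exact: prV.
  by split; [exact: prT|rewrite (einj' n v v' (h n)); exact: prT].
have BrE : [set: Br] #= V_ M m := card_subtype _.
rewrite -(card_eql BrE) card_eq_le; apply/andP; split.
  apply/card_leTT; exists (fun v n => e (pr n v)) => v v' E; apply: sep => n.
  exact: (congr1 (@^~ n) E).
apply: (@omega_tree_branches Br L (fun n v => e (pr n v))) => //.
- move=> n v v' /einj' E; congr e; apply: prU; first exact: prV.
  by apply: (T_trans psiM) (prT n.+1 v'); rewrite -E; exact: prS.
- move=> b bP.
  pose u n := pr n (b n).
  have uS n : T_ M (u n) (u n.+1) by rewrite /u (einj' _ _ _ (bP n)); exact: prS.
  have u_le n k x : T_ M x (u n) -> T_ M x (u (k + n)).
    by move=> xn; elim: k => // k IHk; exact: (T_trans psiM IHk (uS _)).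
  have [|v mv vP] := m_complete (B := [set x | exists n, T_ M x (u n)]).
    split.
    + move=> x [n xu]; have [c [d [Lc Ld cx du cd]]] := T_level psiM xu.
      have E := node_level psiM Ld (La n) du (prV n _); subst d.
      exists c; split=> // E; subst c.
      exact: (top_asym psiM Lc (La n) cd (lower_lt_max (la n))).
    + move=> x y [n xn] [k yk].
      apply: (T_chain psiM (z := u (k + n))); first exact: u_le.
      by rewrite /= addnC; exact: u_le.
    + move=> d Ld dm; have [n dn] := acof d (conj Ld dm).
      have [x dx xu] := T_pred psiM (La n) Ld (prV n (b n)) dn.
      by exists x; split=> //; exists n.
  exists (exist _ v mv) => n; congr e; apply/esym/prU; first exact: prV.
  by apply/vP; exists n.+1; exact: uS.
- rewrite (card_le_eql BrE) => le; apply: V_big; apply: card_le_trans le _.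
  exact: (aleph_lt (is_succ_None al).1).1.
Qed.

(** In general, the restriction of the tree to the levels in a cofinal set [C]
    of minimal order type has the elements of the top level as its cofinal
    branches. *)
Section Cofinal.
Variable C : set M.
Hypothesis C_lower : C `<=` lower.
Hypothesis C_cofinal : forall d, lower d -> exists2 c, C c & lttop d c.
Hypothesis C_wo : well_order_on (@lttop al M) C.
Hypothesis C_initial : forall c, C c -> card_lt [set c' | C c' /\ lttop c' c] C.

Definition cof : Ord := Ord_on C_wo.
Definition subtree : Type := {x | exists2 a, C a & V_ M a x}.
Definition subtree_lt (x y : subtree) : Prop := T_ M (sval x) (sval y).

Lemma cof_initial : initial cof.
Proof.
move=> [c Cc]; have lt := C_initial Cc.
apply: (@card_lt_le_trans _ _ _ _ C); last by rewrite (card_le_eqr (card_subtype C)) card_lexx.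
apply: card_le_lt_trans lt.
apply: (@card_le_inj _ _ _ _ (fun x : {x | C x} => sval x)) => [[x Cx] /=|x y _ _];
  last exact: sval_inj.
by split.
Qed.

Lemma level_ex (x : subtree) : exists i : cof, V_ M (sval i) (sval x).
Proof. by case: x => x /= [a Ca ax]; exists (exist _ a Ca). Qed.

Definition level (x : subtree) : cof := sval (cid (level_ex x)).

Lemma levelP x : V_ M (sval (level x)) (sval x).
Proof. exact: (svalP (cid (level_ex x))). Qed.

Lemma cofL (i : cof) : Ltop (sval i).
Proof. by case: i => a Ca; exact: (C_lower Ca).1. Qed.

Lemma level_unique x (i : cof) : V_ M (sval i) (sval x) -> level x = i.
Proof. by move=> ix; apply: sval_inj; exact: (node_level psiM (cofL _) (cofL _) (levelP x) ix). Qed.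

Lemma subtree_lt_level x y : subtree_lt x y -> ord_lt (level x) (level y).
Proof. exact: (T_lt psiM (cofL _) (cofL _) (levelP x) (levelP y)). Qed.

Lemma subtree_level_unique x y (z : M) : level x = level y ->
  T_ M (sval x) z -> T_ M (sval y) z -> x = y.
Proof.
move=> E xz yz; apply: sval_inj; apply: (T_pred_unique psiM (cofL (level x)) (levelP x) _ xz yz).
by rewrite E; exact: levelP.
Qed.

Lemma subtree_below x y (z : M) : ord_lt (level x) (level y) ->
  T_ M (sval x) z -> T_ M (sval y) z ->
  subtree_lt x y.
Proof. exact: (T_below psiM (cofL _) (cofL _) (levelP x) (levelP y)). Qed.

Lemma subtree_pred (i : cof) (c y : M) : Ltop c -> V_ M c y -> lttop (sval i) c ->
  exists2 x : subtree, level x = i & T_ M (sval x) y.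
Proof.
move=> Lc cy ic; have [x ix xy] := T_pred psiM Lc (cofL i) cy ic.
have xs : exists2 a, C a & V_ M a x by exists (sval i) => //; exact: (svalP i).
by exists (exist _ x xs) => //; exact: level_unique.
Qed.

Lemma subtree_at_level x : at_level subtree_lt (level x) x.
Proof.
exists level; split; first split.
- by move=> y; exact: subtree_lt_level.
- move=> y z /set_mem yx /set_mem zx E; exact: subtree_level_unique E yx zx.
- move=> k kx; have [y yk yx] := subtree_pred (cofL _) (levelP x) kx.
  by exists y.
move=> y z yx zx; split; first exact: subtree_lt_level.
by move=> h; exact: subtree_below h yx zx.
Qed.

Lemma subtree_at_levelE i x : at_level subtree_lt i x <-> level x = i.
Proof.
split=> [ix|<-]; last exact: subtree_at_level.
exact: (at_level_inj (subtree_at_level x) ix).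
Qed.

Lemma subtree_tree : tree subtree_lt.
Proof.
split.
- by move=> x /subtree_lt_level; exact: ord_irr.
- by move=> x y z; exact: (T_trans psiM).
- move=> x; split; first split.
  + by move=> y _ /subtree_lt_level; exact: ord_irr.
  + by move=> y z w _ _ _; exact: (T_trans psiM).
  + move=> y z yx zx; case: (ord_total (level y) (level z)) => [h|h|h].
    * by apply: Or31; exact: subtree_below h yx zx.
    * by apply: Or32; exact: subtree_level_unique h yx zx.
    * by apply: Or33; exact: subtree_below h zx yx.
  move=> Y Yx [y0 Yy0].
  have [k [y Yy yk] kmin] := @ord_least cof (fun k => exists2 y, Y y & level y = k)
    (ex_intro _ (level y0) (ex_intro2 _ _ y0 Yy0 erefl)).
  exists y => // z Yz; case: (kmin (level z)) => [|E|h]; first by exists z.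
    by left; apply: (subtree_level_unique _ (Yx z Yz) (Yx y Yy)); rewrite yk.
  by right; apply: (subtree_below _ (Yx y Yy) (Yx z Yz)); rewrite yk.
Qed.

Lemma cof_nomax (i : cof) : exists j, ord_lt i j.
Proof.
have [c Cc ic] := C_cofinal (C_lower (svalP i)).
by exists (exist _ c Cc).
Qed.

Lemma subtree_branches : cofinal_branch subtree_lt cof #= V_ M m.
Proof.
rewrite card_eq_le; apply/andP; split.
  apply: (@card_le_rel _ _ _ _ (fun B v => forall x : subtree, B x <-> T_ M (sval x) v)).
    move=> B Bb; have [[_ Bch _] Bmeet] := Bb.
    have ex i : exists2 x, B x & level x = i.
      by have [x [Bx /subtree_at_levelE E]] := Bmeet i; exists x.
    have [|v mv vP] := m_complete (B := [set y | exists2 x, B x & T_ M y (sval x)]).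
      split.
      + move=> y [x Bx yx]; have [c [d [Lc Ld cy dx cd]]] := T_level psiM yx.
        have E := node_level psiM Ld (cofL _) dx (levelP x); subst d.
        exists c; split=> // E; subst c.
        exact: (top_asym psiM Lc Ld cd (lower_lt_max (C_lower (svalP (level x))))).
      + move=> y y' [x Bx yx] [x' Bx' yx'].
        case: (Bch x x' Bx Bx') => [h|E|h].
        * exact: (T_chain psiM (T_trans psiM yx h) yx').
        * by subst x'; exact: (T_chain psiM yx yx').
        * exact: (T_chain psiM yx (T_trans psiM yx' h)).
      + move=> d Ld dm; have [c Cc dc] := C_cofinal (conj Ld dm).
        have [x Bx xc] := ex (exist _ c Cc).
        have cx : V_ M c (sval x) by have := levelP x; rewrite xc.
        have [y dy yx] := T_pred psiM (C_lower Cc).1 Ld cx dc.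
        by exists y; split=> //; exists x.
    exists v => // x; split=> [Bx|/vP[x' Bx' xx']]; last first.
      exact: (cofinal_branch_down subtree_tree Bb Bx' xx').
    apply/vP; have [j xj] := cof_nomax (level x); have [x' Bx' x'j] := ex j.
    exists x' => //; case: (Bch x x' Bx Bx') => // [E|/subtree_lt_level].
      by subst x'; case: (@ord_irr cof j); rewrite -{1}x'j.
    by rewrite x'j => jx; case: (@ord_irr cof j); exact: ord_trans jx xj.
  move=> B B' v _ _ _ h h'; apply/seteqP; split=> x.
    by move=> /h xv; apply/h'.
  by move=> /h' xv; apply/h.
apply: (@card_le_inj _ _ _ _ (fun v => [set x : subtree | T_ M (sval x) v])).
  move=> v mv; apply: (cofinal_branch_of_chain subtree_tree).
  - by move=> x; exists (level x); exact: subtree_at_level.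
  - move=> x y xv yv; case: (ord_total (level x) (level y)) => [h|h|h].
    + by apply: Or31; exact: subtree_below h xv yv.
    + by apply: Or32; exact: subtree_level_unique h xv yv.
    + by apply: Or33; exact: subtree_below h yv xv.
  - move=> i; have [x xi xv] := subtree_pred m_max.1 mv (lower_lt_max (C_lower (svalP i))).
    by exists x; split=> //; apply/subtree_at_levelE.
move=> v v' mv mv' E; apply: (top_separated mv mv') => d ld.
have [c Cc dc] := C_cofinal ld; exists c; first by split=> //; exact: C_lower.
have [x xc xv] := subtree_pred (i := exist _ c Cc) m_max.1 mv (lower_lt_max (C_lower Cc)).
exists (sval x); first by have := levelP x; rewrite xc.
by split=> //; have : [set x : subtree | T_ M (sval x) v] x by []; rewrite E.
Qed.

Lemma cof_card_le : [set: cof] #<= ℵ (None : idx al).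
Proof.
rewrite (card_le_eql (card_subtype C)); apply: card_le_trans (nonmax_card_le psiM al_countable).
apply: subset_card_le => c Cc; split; first exact: (C_lower Cc).1.
exact: lower_nonmax (C_lower Cc).
Qed.

Lemma subtree_Kurepa (kap : Type) : V_ M m #= [set: kap] ->
  Kurepa_tree cof (aleph (OrdS al)) kap subtree_lt.
Proof.
move=> kapE.
have nle : ~ ([set: kap] #<= ℵ (None : idx al)) by rewrite -(card_le_eql kapE).
have [top_kap _] := card_ltNge nle.
split.
- exact: cof_initial.
- split=> //; first exact: cof_card_le.
  exact: card_le_lt_trans cof_card_le (card_ltNge nle).
- split; first exact: subtree_tree.
  split=> [x|i]; first by exists (level x); exact: subtree_at_level.
  have [v iv] := nonmax_node_ex psiM (cofL i) (lower_nonmax (C_lower (svalP i))).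
  have vs : exists2 a, C a & V_ M a v by exists (sval i) => //; exact: (svalP i).
  by exists (exist _ v vs); apply/subtree_at_levelE; exact: level_unique.
- move=> i; apply: card_le_lt_trans (aleph_lt (is_succ_None al).1).
  apply: card_le_trans (V_card_le psiM al_countable (cofL i) (lower_nonmax (C_lower (svalP i)))).
  apply: (@card_le_inj _ _ _ _ (fun x : subtree => sval x)) => [x /subtree_at_levelE <-|x y _ _].
    exact: levelP.
  exact: sval_inj.
- by rewrite (card_le_eqr subtree_branches) (card_le_eqr kapE) card_lexx.
Qed.

Lemma cof_countable_sequence : [set: cof] #<= [set: nat] ->
  exists a : nat -> M, [/\ forall n, lower (a n), forall n, lttop (a n) (a n.+1)
    & forall d, lower d -> exists n, lttop d (a n)].
Proof.
rewrite (card_le_eql (card_subtype C)) => Cnat.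
have l0 : lower (zero_ M) by split; [exact: top_zero|exact: nesym].
have [h [_ hinj]] := card_le_fun 0 Cnat.
have next (x : {a | lower a}) (n : nat) : exists y : {a | lower a},
    lttop (sval x) (sval y) /\ forall c, C c -> h c = n -> lttop c (sval y).
  have up d : lower d -> exists2 c, lower c & lttop d c.
    by move=> /C_cofinal[c Cc dc]; exists c => //; exact: C_lower.
  have [z lz xz] := up _ (svalP x).
  have [[c [Cc cn]]|none] := pselect (exists c, C c /\ h c = n); last first.
    by exists (exist _ z lz); split=> // c Cc cn; case: none; exists c.
  have [y ly [zy cy]] : exists2 y, lower y & lttop z y /\ lttop c y.
    have lc := C_lower Cc.
    case: (top_total psiM lz.1 lc.1) => [zc|E|cz].
    - have [y ly cy] := up c lc; exists y => //; split=> //.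
      exact: (top_trans psiM lz.1 lc.1 ly.1 zc cy).
    - by have [y ly cy] := up c lc; exists y => //; rewrite E.
    - have [y ly zy] := up z lz; exists y => //; split=> //.
      exact: (top_trans psiM lc.1 lz.1 ly.1 cz zy).
  exists (exist _ y ly); split=> /=; first exact: (top_trans psiM (svalP x).1 lz.1 ly.1 xz zy).
  by move=> c' Cc' c'n; rewrite (hinj c' c) // c'n.
pose nx x n := sval (cid (next x n)).
have nxP x n := svalP (cid (next x n)).
pose a := fix a n := if n is k.+1 then nx (a k) k else exist _ (zero_ M) l0.
exists (fun n => sval (a n)); split.
- by move=> n; exact: (svalP (a n)).
- by move=> n; exact: (nxP (a n) n).1.
- move=> d ld; have [c Cc dc] := C_cofinal ld; exists (h c).+1.
  have ca := (nxP (a (h c)) (h c)).2 c Cc erefl.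
  exact: (top_trans psiM ld.1 (C_lower Cc).1 (svalP (a (h c).+1)).1 dc ca).
Qed.

End Cofinal.

(** The cofinality of the levels below [m] decides between the two shapes of a
    set of branches. *)
Lemma top_card_cases (kap : Type) : V_ M m #= [set: kap] ->
  (exists lam : Type, [/\ [set: nat] #<= [set: lam], [set: lam] #<= [set: aleph al],
      [set: aleph (OrdS al)] #<= [set: nat -> lam] & [set: kap] #= [set: nat -> lam]]) \/
  exists mu : Ord, [/\ [set: aleph (OrdS Ord0)] #<= [set: mu],
    [set: mu] #<= [set: aleph (OrdS al)]
  & exists (X : Type) (lt : X -> X -> Prop),
      Kurepa_tree mu (aleph (OrdS al)) kap lt /\ cofinal_branch lt mu #= [set: kap]].
Proof.
move=> kapE.
have lz : lower (zero_ M) by split; [exact: top_zero|exact: nesym].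
have [||C [Cl Ccof Cwo Cinit]] := ex_cofinal lower_linear.
- by exists (zero_ M).
- move=> d [Ld dm]; have [c [Lc cm dc]] := lt_max_ex psiM m_max Ld dm.
  by exists c.
have [Cbig|Csmall] := pselect ([set: aleph (OrdS Ord0)] #<= [set: cof Cwo]).
  right; exists (cof Cwo); split=> //; first exact: cof_card_le.
  exists (subtree C), (@subtree_lt C); split; first exact: subtree_Kurepa.
  by rewrite (card_eql (subtree_branches Cl Ccof Cwo)).
have Cnat : [set: cof Cwo] #<= [set: nat].
  have le : [set: cof Cwo] #<= [set: @aleph_below (OrdS (OrdS Ord0)) (Some None)].
    by apply: contrapT => nle; apply: Csmall; exact: (aleph_succ_le (is_succ_None Ord0)).
  apply: card_le_trans le _; apply: aleph_zero_le; last exact: card_lexx.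
  by move=> [[[[]|]|] h].
have [a [la ainc acof]] := cof_countable_sequence Cl Ccof Cnat.
have VE := countable_cofinality_card la ainc acof.
left; exists (@aleph_below (idx al) (Some None)); split.
- exact: aleph_infinite.
- by rewrite (card_le_eql (aleph_topE al)) card_lexx.
- by rewrite -(card_le_eqr VE); have [] := card_ltNge V_big.
- by rewrite -(card_eql kapE).
Qed.

End MaximalModel.

Lemma maximal_model_card (al : Ord) (kap : Type) : countable [set: al] ->
  has_maximal_model al kap ->
  [\/ [set: kap] #= [set: aleph (OrdS al)],
      exists lam : Type,
        [/\ [set: nat] #<= [set: lam], [set: lam] #<= [set: aleph al],
            [set: aleph (OrdS al)] #<= [set: nat -> lam]
          & [set: kap] #= [set: nat -> lam]]
    | exists mu : Ord,
        [/\ [set: aleph (OrdS Ord0)] #<= [set: mu],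
            [set: mu] #<= [set: aleph (OrdS al)]
          & exists (X : Type) (lt : X -> X -> Prop),
              Kurepa_tree mu (aleph (OrdS al)) kap lt /\
              cofinal_branch lt mu #= [set: kap]]].
Proof.
move=> alc [M [Mmax Mkap]]; have psiM := Mmax.1.
have [m mmax] := maximal_has_max Mmax.
have topM : [set: aleph (OrdS al)] #<= [set: M].
  apply: (@aleph_succ_le (idx al) (Some None) None); first exact: is_succ_None.
  by apply: maximal_not_small => //; exact: maximal_L_big.
have [le|nle] := pselect (V_ M m #<= ℵ (None : idx al)).
  apply: Or31; rewrite -(card_eql Mkap) card_eq_le topM andbT.
  exact: (model_card_le psiM alc mmax (card_lexx _) le).
have VM : V_ M m #= [set: kap].
  rewrite -(card_eqr Mkap) card_eq_le card_leT /=.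
  rewrite -(card_le_eqr (card_subtype (V_ M m))).
  apply: (model_card_le psiM alc mmax); rewrite (card_le_eqr (card_subtype _)).
    by have [] := card_ltNge nle.
  exact: card_lexx.
case: (top_card_cases alc psiM mmax (maximal_max_nonzero Mmax mmax)
  (maximal_complete Mmax mmax) nle VM).
  exact: Or32.
exact: Or33.
Qed.

Theorem theorem5p2 (al : Ord) (al_countable : countable [set: al]) :
  [/\ has_maximal_model al (aleph (OrdS al)),
      forall lam : Type,
        [set: nat] #<= [set: lam] -> [set: lam] #<= [set: aleph al] ->
        [set: aleph (OrdS al)] #<= [set: nat -> lam] ->
        has_maximal_model al (nat -> lam),
      forall (mu : Ord) (kap : Type),
        [set: aleph (OrdS Ord0)] #<= [set: mu] ->
        [set: mu] #<= [set: aleph (OrdS al)] ->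
        (exists (X : Type) (lt : X -> X -> Prop),
           Kurepa_tree mu (aleph (OrdS al)) kap lt /\
           cofinal_branch lt mu #= [set: kap]) ->
        has_maximal_model al kap
    & forall kap : Type, has_maximal_model al kap ->
        [\/ [set: kap] #= [set: aleph (OrdS al)],
            exists lam : Type,
              [/\ [set: nat] #<= [set: lam], [set: lam] #<= [set: aleph al],
                  [set: aleph (OrdS al)] #<= [set: nat -> lam]
                & [set: kap] #= [set: nat -> lam]]
          | exists mu : Ord,
              [/\ [set: aleph (OrdS Ord0)] #<= [set: mu],
                  [set: mu] #<= [set: aleph (OrdS al)]
                & exists (X : Type) (lt : X -> X -> Prop),
                    Kurepa_tree mu (aleph (OrdS al)) kap lt /\
                    cofinal_branch lt mu #= [set: kap]]]].
Proof.
split.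
- exact: maximal_model_succ.
- by move=> lam; exact: maximal_model_power.
- move=> mu kap mu_big mu_le [X [lt [Kt Kb]]].
  exact: (maximal_model_Kurepa al_countable mu_big mu_le Kt Kb).
- by move=> kap; exact: maximal_model_card.
Qed.
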